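(* Let $K\ge1$ and $m$ be positive integers, and for $k=1,\dots,K$ let $\sigma_k^2>0$, $P_k>0$, $\lambda_k\in[0,1)$; let $\mathcal N_0>0$. Set $\gamma=\frac{P_1+\cdots+P_K}{\mathcal N_0}$, $\theta_k=\frac{P_k}{P_1+\cdots+P_K}$ and $\Omega_k=\frac{P_k\sigma_k^2(1-\lambda_k^2)}{m\mathcal N_0}=\frac{\gamma\theta_k\sigma_k^2(1-\lambda_k^2)}{m}$. For $\boldsymbol\ell=(\ell_1,\dots,\ell_K)\in\mathbb N_0^K$ let $R_{\boldsymbol\ell,1},\dots,R_{\boldsymbol\ell,K}$ be independent with $R_{\boldsymbol\ell,k}\sim\mathcal G(m+\ell_k,\Omega_k)$ and let $F_{\mathcal A_{\boldsymbol\ell}}$ be the CDF of $\mathcal A_{\boldsymbol\ell}=\prod_{k=1}^K(1+R_{\boldsymbol\ell,k})$. Let $d_{\mathcal A_{\boldsymbol\ell}}=mK+\sum_{k=1}^K\ell_k$ and, for $x>0$, $$g_{\boldsymbol\ell}(x)=\int_{\{(t_1,\dots,t_K)\in[0,\infty)^K:\ \prod_{k=1}^K(1+t_k)\le x\}}\prod_{k=1}^K t_k^{m+\ell_k-1}\,dt_1\cdots dt_K.$$ Then for $x>0$ $$F_{\mathcal A_{\boldsymbol\ell}}(x)=\gamma^{-d_{\mathcal A_{\boldsymbol\ell}}}\prod_{k=1}^K\frac{1}{\Gamma(m+\ell_k)}\Big(\frac{m}{\theta_k\sigma_k^2(1-\lambda_k^2)}\Big)^{m+\ell_k}\sum_{n_1,\dots,n_K=0}^\infty\prod_{k=1}^K\frac{1}{n_k!}\Big(-\frac{m}{\gamma\theta_k\sigma_k^2(1-\lambda_k^2)}\Big)^{n_k}g_{\mathbf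 n+\boldsymbol\ell}(x),$$ where $\mathbf n=(n_1,\dots,n_K)$, and moreover $$g_{\boldsymbol\ell}(x)=\prod_{k=1}^K\Gamma(m+\ell_k)\;G_{K+1,K+1}^{0,K+1}\left(\left.\begin{array}{c}1,\,1+\ell_1+m,\dots,1+\ell_K+m\\1,\dots,1,0\end{array}\right|x\right).$$
   Context: $\mathcal G(a,b)$ denotes the Gamma distribution with shape $a$ and scale $b$ (density $x^{a-1}e^{-x/b}/(\Gamma(a)b^a)$, $x>0$). $G_{p,q}^{m,n}(\cdot|x)$ is the Meijer G-function. *)

(* Defs.v *)
From HB Require Import structures.
From mathcomp Require Import all_boot all_order all_algebra.
From mathcomp Require Import all_classical all_reals all_analysis.
From mathcomp Require Import complex.
Set Implicit Arguments.
Unset Strict Implicit.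
Unset Printing Implicit Defensive.
Import Order.TTheory GRing.Theory Num.Theory.
Import numFieldNormedType.Exports.
Local Open Scope classical_set_scope.
Local Open Scope ring_scope.

Section Defs.
Context {R : realType}.
Local Notation mu := (@lebesgue_measure R).

Definition GammaR (a : R) : R :=
  \int[mu]_(t in `]0, +oo[%classic) (t `^ (a - 1) * expR (- t)).

Definition gamma_pdf (a b : R) (r : R) : R :=
  if 0 < r then r `^ (a - 1) * expR (- r / b) / (GammaR a * b `^ a) else 0.

Definition cpowR (t : R) (z : R[i]) : R[i] :=
  let r := expR (complex.Re z * ln t) in
  Complex (r * cos (complex.Im z * ln t)) (r * sin (complex.Im z * ln t)).

Definition cint (D : set R) (f : R -> R[i]) : R[i] :=
  Complex (\int[mu]_(t in D) complex.Re (f t)) (\int[mu]_(t in D) complex.Im (f t)).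

Definition CGammaEuler (z : R[i]) : R[i] :=
  cint `]0, +oo[%classic (fun t => cpowR t (z - 1) * (Complex (expR (- t)) 0)).

(** complex Gamma function on C: Euler integral for complex.Re z > 0, extended to
    complex.Re z <= 0 by Gamma(z) = Gamma(z + N) / (z (z+1) ... (z+N-1)), N large
    enough; at the poles this gives the value 0 (division by 0). *)
Definition CGamma (z : R[i]) : R[i] :=
  let N := if 0 < complex.Re z then 0%N else (Num.truncn (- complex.Re z)).+1 in
  CGammaEuler (z + Complex N%:R 0) / \prod_(j < N) (z + Complex j%:R 0).

(** Meijer G-function G^{m,n}_{p,q}(a_1..a_p ; b_1..b_q | x), x > 0,
    p = size a, q = size b, defined by the Mellin-Barnes integral
      (1/(2 pi i)) int_L  prod_{j<=m} Gamma(b_j - s) prod_{j<=n} Gamma(1 - a_j + s)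
                        / (prod_{j>m} Gamma(1 - b_j + s) prod_{j>n} Gamma(a_j - s))  x^s ds
    along the vertical contour L = c + iR (so ds = i dt).  The theorem
    below only uses it with c such that L separates the poles as required. *)
Definition meijerG (m n : nat) (a b : seq R) (c x : R) : R[i] :=
  let p := size a in let q := size b in
  let Phi (s : R[i]) :=
    (\prod_(j < m) CGamma ((Complex (nth (0%R : R) b j) 0) - s) * \prod_(j < n) CGamma (1 - (Complex (nth (0%R : R) a j) 0) + s))
    / (\prod_(m <= j < q) CGamma (1 - (Complex (nth (0%R : R) b j) 0) + s)
       * \prod_(n <= j < p) CGamma ((Complex (nth (0%R : R) a j) 0) - s)) in
  (Complex (2 * pi)^-1 0) * cint setT (fun t => Phi (Complex c t) * cpowR x (Complex c t)).

Fixpoint iint (n : nat) (F : seq R -> \bar R) : \bar R :=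
  if n is n'.+1 then
    (\int[mu]_(t in `[0%R, +oo[%classic) iint n' (fun s => F (t :: s)))%E
  else F [::].

Definition g_fun (K m : nat) (l : 'I_K -> nat) (x : R) : R :=
  fine (iint K (fun t =>
    ((((\prod_(k < K) (1 + (nth (0%R : R) t k)) <= x)%R%:R) *
      \prod_(k < K) (nth (0%R : R) t k) ^+ (m + l k - 1)%N)%R)%:E)).

Definition mutually_independent d (T : measurableType d)
  (P : probability T R) (K : nat) (X : 'I_K -> T -> R) : Prop :=
  forall B : 'I_K -> set R, (forall k, measurable (B k)) ->
    P (\bigcap_(k in [set: 'I_K]) (X k @^-1` B k)) =
    (\prod_(k < K) P (X k @^-1` B k))%E.

Definition has_density d (T : measurableType d) (P : probability T R)
  (X : T -> R) (f : R -> R) : Prop :=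
  forall B : set R, measurable B ->
    P (X @^-1` B) = (\int[mu]_(r in B) (f r)%:E)%E.

Definition cdf_of d (T : measurableType d) (P : probability T R) (Y : T -> R)
  (x : R) : R := fine (P [set w | Y w <= x]).

Definition snr (K : nat) (Pw : 'I_K -> R) (N0 : R) : R := (\sum_(k < K) Pw k) / N0.
Definition theta (K : nat) (Pw : 'I_K -> R) (k : 'I_K) : R := Pw k / \sum_(j < K) Pw j.
Definition Omega (K m : nat) (Pw sigma2 lam : 'I_K -> R) (N0 : R) (k : 'I_K) : R :=
  Pw k * sigma2 k * (1 - lam k ^+ 2) / (m%:R * N0).

End Defs.

(* Main.v *)
(** Both claims rest on the recursion
    g_{e :: es}(y) = int_0^oo t^e g_es(y / (1 + t)) dt, started at the indicator
    of y >= 1.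

    Meijer representation: this multiplicative convolution multiplies Mellin
    transforms by the Beta integrals int_0^oo t^e (1 + t)^(-s) dt. Mellin inversion
    for the indicator (transform 1 / s) is not absolutely convergent, so one starts
    instead from the kernel x^c exp(-c |ln x|) / (2 c), whose transform
    1 / (s (2 c - s)) is inverted by the Poisson integral of
    cos (u t) / (1 + t^2); after one convolution, the kernel and the indicator
    differ by a multiple of the kernel itself. The resulting rational function of s
    is the quotient of Gamma functions in the Meijer integrand, because Gamma has no
    zero in the right half-plane: Gamma(z) = 0 would give Gamma(z + n) = 0 for all n,
    whereas for large a the mass of t^(a-1) exp(-t) concentrates near t = a, so
    that Re (a^(-iy) Gamma(a + iy)) > 0.

    Series: the distribution function of the product obeys the same recursion with
    the Gamma densities in place of the powers t^e. Expanding the exponentials in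
    these densities and passing to the limit by dominated convergence, one factor
    at a time, gives the expansion. *)

Require Import Defs.
From HB Require Import structures.
From mathcomp Require Import all_boot all_order all_algebra.
From mathcomp Require Import all_classical all_reals all_analysis.
From mathcomp Require Import measurable_realfun complex ring lra.
Set Implicit Arguments.
Unset Strict Implicit.
Unset Printing Implicit Defensive.
Import Order.TTheory GRing.Theory Num.Theory.
Import numFieldNormedType.Exports.
Local Open Scope classical_set_scope.
Local Open Scope ring_scope.

(** * Lebesgue integrals on the real line *)

Section RealIntegrals.
Context {R : realType}.
Implicit Types (f g F : R -> R) (D : set R).
Local Notation mu := (@lebesgue_measure R).

(** Absolute convergence on the line shapes the Mellin half. A first convolution brings the decay to
    order 1/|s|^2, and every further Beta factor only has to be bounded on the line; so the
    induction starts at one variable, not at none. The exchange of kernel and indicator is made for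
    the weights (1 + t)^k. This is why Beta integrals appear with two parameters: t^(a+1) (1 + t)^k
    = t^a (1 + t)^(k+1) - t^a (1 + t)^k leads from a = 0 to the wanted case k = 0. Under the
    convention 1 / 0 = 0 a factor Gamma(s) cancels only where it is nonzero; hence the detour
    through zeros of Gamma. In the series half the multiple sum is truncated along cubes {0, ...,
    N}^K, because these partial sums inherit the recursion, with one truncated exponential per
    variable. In all estimates, vanishing below 1 confines t to 1 + t <= y, where 1 <= y^2 (1 +
    t)^(-2): a multiple of (1 + t)^(-2) is then a majorant uniform in N and in bounded y. *)

Lemma integrable_le D f g : measurable D -> measurable_fun D f ->
  mu.-integrable D (EFin \o g) -> (forall x, D x -> `|f x| <= g x) ->
  mu.-integrable D (EFin \o f).
Proof.
move=> mD mf ig fg; apply: le_integrable ig => //; first exact/measurable_EFinP.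
by move=> x Dx /=; rewrite lee_fin (le_trans (fg _ Dx))// ler_norm.
Qed.

Lemma integrableRZ D k f : measurable D -> mu.-integrable D (EFin \o f) ->
  mu.-integrable D (EFin \o (fun x => k * f x)).
Proof. by move=> mD fi; change (mu.-integrable D (fun x => k%:E * (EFin \o f) x)%E); exact: integrableZl. Qed.

Lemma integrableRD D f g : measurable D -> mu.-integrable D (EFin \o f) ->
  mu.-integrable D (EFin \o g) -> mu.-integrable D (EFin \o (fun x => f x + g x)).
Proof. by move=> mD fi gi; change (mu.-integrable D ((EFin \o f) \+ (EFin \o g))%E); exact: integrableD. Qed.

Lemma integrableRB D f g : measurable D -> mu.-integrable D (EFin \o f) ->
  mu.-integrable D (EFin \o g) -> mu.-integrable D (EFin \o (fun x => f x - g x)).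
Proof. by move=> mD fi gi; change (mu.-integrable D ((EFin \o f) \- (EFin \o g))%E); exact: integrableB. Qed.

Lemma integrable_patch D f : measurable D -> mu.-integrable D (EFin \o f) ->
  mu.-integrable setT (EFin \o (f \_ D)).
Proof. by move=> mD fi; have := (@integrable_mkcond _ _ _ mu D (EFin \o f) mD).1 fi; rewrite restrict_EFin. Qed.

Lemma EFin_Rintegral D f : measurable D -> mu.-integrable D (EFin \o f) ->
  (\int[mu]_(x in D) f x)%:E = (\int[mu]_(x in D) (f x)%:E)%E.
Proof.
by move=> mD fi; rewrite /Rintegral fineK//; exact: integrable_fin_num.
Qed.

(** Uniqueness of Lebesgue measure: the rescaled pushforward gives every half-open interval its
    length. *)
Lemma lebesgue_measure_scale (c : R) (A : set R) : 0 < c -> measurable A ->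
  mu A = (c%:E * pushforward mu ( *%R c : R -> measurableTypeR R) A)%E.
Proof.
move=> c0 mA.
pose k := NngNum (ltW c0).
have mphi : measurable_fun setT ( *%R c : R -> measurableTypeR R).
  exact: mulrl_measurable.
pose phi : {mfun R >-> measurableTypeR R} :=
  HB.pack ( *%R c : R -> measurableTypeR R)
   (isMeasurableFun.Build _ _ R (measurableTypeR R) _ mphi).
have := @lebesgue_measure_unique R (mscale k (pushforward mu phi)); apply => // _ [[a b]] _ <-.
change (mu `]a, b] = (c%:E * mu ( *%R c @^-1` `]a, b]))%E).
rewrite (_ : _ @^-1` _ = `]a / c, b / c]%classic); last first.
  by apply/seteqP; split => x /=; rewrite !in_itv/= ltr_pdivrMr// ler_pdivlMr// ![_ * c]mulrC.
rewrite !lebesgue_measure_itv/= !lte_fin ltr_pM2r ?invr_gt0//.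
case: ifP => // _; last by rewrite mule0.
by rewrite -!EFinB -EFinM -mulrBl mulrCA divff ?mulr1// gt_eqF.
Qed.

Lemma ge0_integral_scale (c : R) (f : R -> \bar R) : 0 < c ->
  measurable_fun setT f -> (forall x, 0 <= f x)%E ->
  (\int[mu]_x f x = c%:E * \int[mu]_x f (c * x)%R)%E.
Proof.
move=> c0 mf f0.
pose k := NngNum (ltW c0).
have mphi : measurable_fun setT ( *%R c : R -> measurableTypeR R).
  exact: mulrl_measurable.
pose phi : {mfun R >-> measurableTypeR R} :=
  HB.pack ( *%R c : R -> measurableTypeR R)
   (isMeasurableFun.Build _ _ R (measurableTypeR R) _ mphi).
rewrite (@eq_measure_integral _ _ _ _ (mscale k (pushforward mu phi))); last first.
  by move=> A mA _; exact: lebesgue_measure_scale.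
rewrite ge0_integral_mscale// ge0_integral_pushforward//=.
Qed.

(** The nonnegative case applies to the positive and negative parts separately; integrability of the
    rescaled function keeps the difference of the two extended integrals meaningful. *)
Lemma Rintegral_scale (c : R) f : 0 < c -> measurable_fun setT f ->
  mu.-integrable setT (fun x => (f (c * x))%:E) ->
  \int[mu]_x f x = c * \int[mu]_x f (c * x).
Proof.
move=> c0 mf fi; have mEf : measurable_fun setT (EFin \o f) by exact/measurable_EFinP.
rewrite /Rintegral [in LHS]integralE (ge0_integral_scale c0)//; last exact: measurable_funepos.
rewrite [X in (_ - X)%E](ge0_integral_scale c0)//; last exact: measurable_funeneg.
rewrite [in RHS]integralE -muleBr//.
  have h := integrable_fin_num measurableT fi; rewrite integralE in h.
  have fM (z : \bar R) : z \is a fin_num -> fine (c%:E * z)%E = c * fine z by move=> zf; rewrite fineM.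
  have -> : (\int[mu]_x (fun y => (f y)%:E)^\+ (c * x)%R = \int[mu]_x (fun y => (f (c * y))%:E)^\+ x)%E.
    by apply: eq_integral => x _; rewrite !funeposE.
  have -> : (\int[mu]_x (fun y => (f y)%:E)^\- (c * x)%R = \int[mu]_x (fun y => (f (c * y))%:E)^\- x)%E.
    by apply: eq_integral => x _; rewrite !funenegE.
  exact: fM.
rewrite fin_num_adde_defr//.
have := integrable_pos_fin_num measurableT fi; congr (_ \is a fin_num).
by apply: eq_integral => x _; rewrite !funeposE.
Qed.

(** Lebesgue measure is invariant under reflection, so the integral equals its own opposite. *)
Lemma Rintegral_odd f : mu.-integrable setT (EFin \o f) ->
  (forall x, f (- x) = - f x) -> \int[mu]_x f x = 0.
Proof.
move=> fi fN.
have mf : measurable_fun [set: measurableTypeR R] (EFin \o f : measurableTypeR R -> \bar R).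
  exact: measurable_int fi.
have mN : measurable_fun [set: measurableTypeR R] (-%R : measurableTypeR R -> measurableTypeR R).
  exact: oppr_measurable.
have fiN : mu.-integrable setT ((EFin \o f) \o (-%R : measurableTypeR R -> measurableTypeR R)).
  apply: eq_integrable (integrableRZ (-1) measurableT fi) => // x _ /=.
  by rewrite fN mulN1r.
have := integral_pushforward mN mf fiN measurableT.
rewrite [X in X = _](@eq_measure_integral _ _ _ _ mu); last first.
  by move=> A mA _; exact: lebesgue_measureN.
rewrite preimage_setT => /(congr1 fine) e.
have : \int[mu]_x f x = - \int[mu]_x f x.
  rewrite {1}/Rintegral [LHS]e -[RHS]mulN1r -RintegralZl//.
  by congr fine; apply: eq_integral => x _ /=; rewrite fN mulN1r.
by move=> /eqP; rewrite -subr_eq0 opprK -mulr2n mulrn_eq0/= => /eqP.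
Qed.

Lemma Rdominated_cvg D (f_ : nat -> R -> R) f g : measurable D ->
  (forall n, measurable_fun D (f_ n)) ->
  (forall x, D x -> f_ ^~ x @ \oo --> f x) ->
  mu.-integrable D (EFin \o g) ->
  (forall n x, D x -> `|f_ n x| <= g x) ->
  mu.-integrable D (EFin \o f) /\
  \int[mu]_(x in D) f_ n x @[n --> \oo] --> \int[mu]_(x in D) f x.
Proof.
move=> mD mf ff ig fg.
have mlf : measurable_fun D f by apply: (measurable_fun_cvg mf) => x Dx; exact: ff.
have [] := @dominated_convergence _ _ _ mu D mD (fun n x => (f_ n x)%:E)
  (EFin \o f) (EFin \o g) _ _ _ ig _.
- by move=> n; apply/measurable_EFinP; exact: mf.
- exact/measurable_EFinP.
- by apply: aeW => x Dx; apply: cvg_EFin; [exact: nearW|exact: ff].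
- by apply: aeW => x n Dx; rewrite lee_fin fg.
move=> fi _ cv; split => //; apply: fine_cvg.
by rewrite EFin_Rintegral.
Qed.

Lemma cvg_Rintegral_nd D (E : nat -> set R) f : measurable D ->
  (forall n, measurable (E n)) -> (forall n, E n `<=` D) ->
  (forall x, D x -> \forall n \near \oo, E n x) ->
  mu.-integrable D (EFin \o f) ->
  \int[mu]_(x in E n) f x @[n --> \oo] --> \int[mu]_(x in D) f x.
Proof.
move=> mD mE ED DE fi.
rewrite (_ : (fun n => _) = (fun n => \int[mu]_(x in D) (f \_ (E n)) x)); last first.
  by apply/funext => n; rewrite -Rintegral_mkcondr setIidr.
have mf : measurable_fun D f by move/integrableP : fi => -[/measurable_EFinP].
apply: (@Rdominated_cvg D _ _ (fun x => `|f x|) mD _ _ _ _).2.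
- by move=> n; apply/measurable_restrict => //; apply: measurable_funS mf => // x [].
- move=> x Dx; apply: cvg_near_cst; near=> n.
  rewrite patchE ifT// inE; near: n; exact: DE.
- exact: integrable_norm.
- by move=> n x Dx; rewrite patchE; case: ifP => // _; rewrite normr0.
Unshelve. all: by end_near. Qed.


(** A majorant of product form is what the line integrals provide: one factor for the convolution
    variable, one for the ordinate on the line. The function is extended by 0 to the whole plane, so
    that Fubini applies without restricted product measures. *)
Lemma Rfubini_dom (D E : set R) (f : R -> R -> R) (a b : R -> R) :
  measurable D -> measurable E ->
  measurable_fun [set: R * R] (fun z => f z.1 z.2) ->
  mu.-integrable D (EFin \o a) -> mu.-integrable E (EFin \o b) ->
  (forall x y, D x -> E y -> `|f x y| <= a x * b y) ->
  mu.-integrable D (EFin \o (fun x => \int[mu]_(y in E) f x y)) /\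
  \int[mu]_(x in D) \int[mu]_(y in E) f x y =
  \int[mu]_(y in E) \int[mu]_(x in D) f x y.
Proof.
move=> mD mE mf ia ib fab.
have mf1 x : measurable_fun setT (f x).
  exact: (measurableT_comp mf (pair1_measurable x)).
have mf2 y : measurable_fun setT (f ^~ y).
  exact: (measurableT_comp mf (measurable_pair2 y)).
have if1 x : D x -> mu.-integrable E (EFin \o f x).
  move=> Dx; apply: (@integrable_le E _ (fun y => a x * b y)) => //.
  - exact: measurable_funTS.
  - exact: integrableRZ.
  - by move=> y Ey; exact: fab.
have if2 y : E y -> mu.-integrable D (EFin \o f ^~ y).
  move=> Ey; apply: (@integrable_le D _ (fun x => b y * a x)) => //.
  - exact: measurable_funTS.
  - exact: integrableRZ.
  - by move=> x Dx; rewrite mulrC; exact: fab.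
pose F (z : R * R) := (((fun z => f z.1 z.2) \_ (D `*` E)) z)%:E.
have mF : measurable_fun setT F.
  apply/measurable_EFinP; apply/measurable_restrict => //; first exact: measurableX.
  by rewrite setTI; apply: measurable_funTS.
have FE x y : F (x, y) = ((fun x => ((f x) \_ E y)) \_ D x)%:E.
  rewrite /F !patchE in_setX/=; by case: (x \in D); case: (y \in E); rewrite //= ?patchE.
have F1 x : (\int[mu]_y F (x, y) = ((fun x => \int[mu]_(y in E) f x y) \_ D x)%:E)%E.
  under eq_integral do rewrite FE.
  rewrite patchE; case: ifPn => [/set_mem Dx|xD].
    under eq_integral do rewrite patchE mem_set//.
    by rewrite (@Rintegral_mkcond _ _ _ mu E) EFin_Rintegral//; exact: integrable_patch (if1 _ Dx).
  by rewrite integral0_eq// => y _; rewrite patchE (negbTE xD).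
have F2 y : (\int[mu]_x F (x, y) = ((fun y => \int[mu]_(x in D) f x y) \_ E y)%:E)%E.
  rewrite patchE; case: ifPn => [/set_mem Ey|yE].
    rewrite Rintegral_mkcond EFin_Rintegral//.
      apply: eq_integral => x _; rewrite FE !patchE; case: ifP => // _.
      by rewrite ?patchE mem_set.
    exact: integrable_patch (if2 _ Ey).
  by rewrite integral0_eq// => x _; rewrite FE patchE; case: ifP => // _; rewrite ?patchE (negbTE yE).
have iF : (mu \x mu)%E.-integrable setT F.
  apply/integrable12ltyP => //.
  (* The inner integral of |F(x, y)| over y is at most |a(x)| B on [D] and 0 elsewhere. *)
  pose B := \int[mu]_(y in E) `|b y|.
  have B0 : 0 <= B by exact: Rintegral_ge0.
  have iA : mu.-integrable setT (fun x => (`|(a \_ D) x| * B)%:E).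
    rewrite (_ : (fun _ => _) = EFin \o (fun x => B * `|(a \_ D) x|)); last first.
      by apply/funext => x /=; rewrite mulrC.
    apply: integrableRZ => //; apply: integrable_norm.
    exact: integrable_patch.
  apply: (@le_lt_trans _ _ (\int[mu]_x (`|(a \_ D) x| * B)%:E)%E).
    apply: ge0_le_integral => //.
    - by move=> x _; exact: integral_ge0.
    - by apply: (@measurable_fun_fubini_tonelli_F _ _ _ _ R mu (abse \o F)) => //=; exact: measurableT_comp.
    - exact: measurable_int iA.
    - move=> x _; rewrite patchE; case: ifPn => [/set_mem Dx|xD]; last first.
        rewrite normr0 mul0r integral0_eq// => y _.
        by rewrite FE patchE (negbTE xD) abse0.
      rewrite EFinM EFin_Rintegral//; last exact: integrable_norm.
      rewrite -ge0_integralZl//; last first.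
        by have /integrable_norm/measurable_int := ib.
      rewrite [leRHS]integral_mkcond; apply: ge0_le_integral => //.
      - apply: measurableT_comp => //; exact: (measurableT_comp mF (pair1_measurable x)).
      - apply/(measurable_restrictT _ mE); apply/measurable_EFinP; apply: measurable_funM => //.
        by have /integrable_norm/measurable_int/measurable_EFinP := ib.
      - move=> y _; rewrite FE patchE mem_set//= !patchE; case: ifPn => [/set_mem Ey|_].
          by rewrite lee_fin -normrM (le_trans (fab _ _ Dx Ey))// ler_norm.
        by rewrite normr0.
  by have /integrable_fin_num := iA => /(_ measurableT); rewrite ge0_fin_numE// integral_ge0// => x _; rewrite lee_fin mulr_ge0.
split.
  have iFF : mu.-integrable setT (fun x => \int[mu]_y F (x, y))%E by exact: integrable_fubini_F iF.
  have : mu.-integrable D (fun x => \int[mu]_y F (x, y))%E by apply: integrableS iFF.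
  apply: eq_integrable => // x /set_mem Dx.
  by rewrite F1 patchE mem_set.
have := Fubini iF.
under eq_integral do rewrite F1.
under [X in _ = X -> _]eq_integral do rewrite F2.
rewrite (@Rintegral_mkcond _ _ _ mu D (fun x => \int[mu]_(y in E) f x y)).
rewrite (@Rintegral_mkcond _ _ _ mu E (fun y => \int[mu]_(x in D) f x y)).
exact: congr1.
Qed.

(** A compact exhaustion of the open half-line, on which the fundamental theorem of calculus
    applies. The right end n + 2 keeps the interval nondegenerate already at n = 0. *)
Let E (n : nat) := `[n.+1%:R^-1, n.+2%:R : R]%classic.

Let E_lt n : n.+1%:R^-1 < n.+2%:R :> R.
Proof. by rewrite (@le_lt_trans _ _ 1)// ?invf_le1 ?ler1n ?ltr1n. Qed.

Let E_sub n : E n `<=` `]0, +oo[.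
Proof.
move=> x; rewrite /E/= !in_itv/= => /andP[h _]; rewrite andbT.
by apply: lt_le_trans h; rewrite invr_gt0 ltr0n.
Qed.

Let E_near x : `]0, +oo[%classic x -> \forall n \near \oo, E n x.
Proof.
rewrite /= in_itv/= andbT => x0; near=> n; rewrite /E/= in_itv/=; apply/andP; split.
  rewrite invf_ple ?posrE ?ltr0n//.
  apply: (@le_trans _ _ n%:R); last by rewrite ler_nat.
  by near: n; exact: nbhs_infty_ger.
apply: (@le_trans _ _ n%:R); last by rewrite ler_nat ltnW.
by near: n; exact: nbhs_infty_ger.
Unshelve. all: by end_near. Qed.

Let FTC_E F f (n : nat) : (forall x : R, 0 < x -> is_derive x 1 F (f x)) ->
  (forall x : R, 0 < x -> {for x, continuous f}) ->
  (\int[mu]_(x in E n) (f x)%:E = (F n.+2%:R - F n.+1%:R^-1)%:E)%E.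
Proof.
move=> dF cf; rewrite EFinB; apply: continuous_FTC2 => //.
- apply: continuous_in_subspaceT => x /set_mem/E_sub.
  by rewrite /= in_itv/= andbT; exact: cf.
- have cF (x : R) : 0 < x -> {for x, continuous F}.
    by move=> x0; apply/differentiable_continuous/derivable1_diffP; have [] := dF _ x0.
  have n0 : 0 < n.+1%:R^-1 :> R by rewrite invr_gt0 ltr0n.
  split => [x||].
  + rewrite in_itv/= => /andP[h _]; have x0 : 0 < x by exact: lt_trans h.
    by have [] := dF _ x0.
  + by apply: cvg_at_right_filter; exact: cF.
  + by apply: cvg_at_left_filter; apply: cF; rewrite ltr0n.
- move=> x; rewrite in_itv/= => /andP[h _]; have x0 : 0 < x by apply: lt_trans h; rewrite invr_gt0 ltr0n.
  by have [_] := dF _ x0; rewrite derive1E.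
Qed.

Let cvg_FTC_E F (A B : R) : F x @[x --> 0^'+] --> A -> F x @[x --> +oo] --> B ->
  F n.+2%:R - F n.+1%:R^-1 @[n --> \oo] --> B - A.
Proof.
move=> /cvg_at_rightP FA /cvg_pinftyP FB; apply: cvgB.
- apply: FB; apply/cvgryPge => r; near=> n.
  apply: (@le_trans _ _ n%:R); last by rewrite ler_nat !leqW.
  by near: n; exact: nbhs_infty_ger.
- by apply: FA; split => [n|]; [rewrite invr_gt0|exact: cvg_harmonic].
Unshelve. all: by end_near. Qed.

(** Monotone convergence along [E] turns finite limits of a primitive into integrability. The
    majorants for powers of 1 + t and for the Euler integrand come from here. *)
Lemma ge0_integrable_FTC_0y F f (A B : R) :
  (forall x : R, 0 < x -> 0 <= f x) ->
  (forall x : R, 0 < x -> is_derive x 1 F (f x)) ->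
  (forall x : R, 0 < x -> {for x, continuous f}) ->
  F x @[x --> 0^'+] --> A -> F x @[x --> +oo] --> B ->
  mu.-integrable `]0, +oo[ (EFin \o f).
Proof.
move=> f0 dF cf FA FB.
have mf : measurable_fun (`]0, +oo[%classic : set R) f.
  by apply: open_continuous_measurable_fun => // x; rewrite inE/= in_itv/= andbT => /cf.
apply/integrableP; split; first exact/measurable_EFinP.
rewrite (_ : \int[mu]_(x in _) _ = (B - A)%:E)%E ?ltry//.
have UE : \bigcup_n E n = `]0, +oo[%classic.
  apply/seteqP; split=> [x [n _ /E_sub]//|x /E_near[n _ h]].
  by exists n => //; exact: h (leqnn n).
transitivity (\int[mu]_(x in \bigcup_n E n) (f x)%:E)%E.
  rewrite UE; apply: eq_integral => x; rewrite inE/= in_itv/= andbT => x0.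
  by rewrite ger0_norm// f0.
have h2 : (\int[mu]_(x in E n) (f x)%:E @[n --> \oo] --> \int[mu]_(x in \bigcup_n E n) (f x)%:E)%E.
  apply: ge0_nondecreasing_set_cvg_integral => //.
  - apply/nondecreasing_seqP => n; apply/subsetPset => x; rewrite /E/= !in_itv/=.
    move=> /andP[h1 h2]; apply/andP; split.
      by apply: le_trans h1; rewrite lef_pV2 ?posrE ?ltr0n// ler_nat.
    by apply: (le_trans h2); rewrite ler_nat.
  - by move=> n; exact: measurable_itv.
  - by move=> n; apply/measurable_EFinP; apply: measurable_funS mf => //; exact: E_sub.
  - by move=> n x /E_sub; rewrite /= in_itv/= andbT lee_fin; exact: f0.
apply: cvg_unique h2 _ => //.
rewrite (_ : (fun n => _) = (fun n => (F n.+2%:R - F n.+1%:R^-1)%:E)).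
  by apply: cvg_EFin; [exact: nearW|exact: cvg_FTC_E].
by apply/funext => n; rewrite (FTC_E _ dF cf).
Qed.

(** Real and imaginary parts of complex powers change sign, so integrability is assumed here and
    dominated convergence replaces monotone convergence. *)
Lemma Rintegral_FTC_0y F f (A B : R) :
  mu.-integrable `]0, +oo[ (EFin \o f) ->
  (forall x : R, 0 < x -> is_derive x 1 F (f x)) ->
  (forall x : R, 0 < x -> {for x, continuous f}) ->
  F x @[x --> 0^'+] --> A -> F x @[x --> +oo] --> B ->
  \int[mu]_(x in `]0, +oo[) f x = B - A.
Proof.
move=> fi dF cf FA FB.
have h1 : \int[mu]_(x in E n) f x @[n --> \oo] --> \int[mu]_(x in `]0, +oo[) f x.
  by apply: cvg_Rintegral_nd => // n; exact: measurable_itv.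
apply: cvg_unique h1 _ => //.
rewrite (_ : (fun n => _) = (fun n => F n.+2%:R - F n.+1%:R^-1)); first exact: cvg_FTC_E.
by apply/funext => n; rewrite /Rintegral (FTC_E _ dF cf).
Qed.
End RealIntegrals.

Lemma measurable_invr {R : realType} : measurable_fun setT (fun x : R => x^-1).
Proof.
rewrite -(setUv [set (0 : R)]); apply/measurable_funU => //; first exact: measurableC.
split; first exact: measurable_fun_set1.
apply: open_continuous_measurable_fun.
  by rewrite openC; exact/accessible_closed_set1/hausdorff_accessible/norm_hausdorff.
by move=> x /set_mem/= /eqP x0; apply: inv_continuous.
Qed.

(** * The Poisson integral of cos(ut) / (1 + t^2) *)

Section PoissonIntegral.
Context {R : realType}.
Local Notation mu := (@lebesgue_measure R).

Lemma sin_le_norm (x : R) : `|sin x| <= `|x|.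
Proof.
wlog x0 : x / 0 <= x.
  by move=> h; have [/h//|/ltW x0] := leP 0 x; rewrite -normrN -sinN -(normrN x) h// oppr_ge0.
have [c _] : exists2 c, c \in `[0, x] & sin x - sin 0 = cos c * (x - 0).
  apply: MVT_segment => //.
  by apply: continuous_subspaceT => y; exact: continuous_sin.
rewrite sin0 !subr0 => ->; rewrite normrM ler_piMl//; exact: cos_max.
Qed.

Lemma onem_cos_sqr (x : R) : 1 - cos x = 2 * sin (x / 2) ^+ 2.
Proof.
rewrite {1}(_ : x = (x / 2) *+ 2) ?cos_mulr2n; last by rewrite -mulr_natr divfK.
by rewrite cos2sin2 mulrnBl mulr2n; ring.
Qed.

Lemma onem_cos_ge0 (x : R) : 0 <= 1 - cos x.
Proof. by rewrite subr_ge0 cos_le1. Qed.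

Lemma onem_cos_le (x : R) : 1 - cos x <= x ^+ 2 / 2.
Proof.
rewrite onem_cos_sqr.
have : `|sin (x / 2)| ^+ 2 <= `|x / 2| ^+ 2 by rewrite lerXn2r ?nnegrE// sin_le_norm.
rewrite !real_normK ?num_real// => h.
by apply: (@le_trans _ _ (2 * (x / 2) ^+ 2)); [rewrite ler_pM2l|rewrite le_eqVlt; apply/orP; left; apply/eqP; field].
Qed.

(** E(u) exp(-ku) has derivative 0. The equation is assumed only for u >= 0 because the identities
    that yield it below go through [rho_lin], which holds only there. *)
Lemma exp_ode (E : R -> R) (k : R) :
  (forall u : R, 0 <= u -> is_derive u 1 E (k * E u)) ->
  forall u : R, 0 <= u -> E u = E 0 * expR (k * u).
Proof.
move=> dE u u0.
pose H := E * (expR \o (fun v => - k * v)).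
have dH (v : R) : 0 <= v -> is_derive v 1 H 0.
  move=> v0; have := dE _ v0 => dEv.
  have dk : is_derive v 1 (fun v => - k * v) (- k).
    by apply: is_derive_eq; rewrite /GRing.scale/= mulr1.
  have de : is_derive v 1 (expR \o (fun v => - k * v)) (expR (- k * v) * - k).
    exact: is_derive1_comp.
  apply: is_derive_eq; rewrite /GRing.scale/=; ring.
have [c _] : exists2 c, c \in `[0, u] & H u - H 0 = 0 * (u - 0).
  apply: MVT_segment => // [v|]; first by rewrite in_itv/= => /andP[/ltW v0 _]; exact: dH.
  apply: derivable_within_continuous => v; rewrite in_itv/= => /andP[v0 _].
  by have [] := dH _ v0.
rewrite mul0r => /eqP; rewrite subr_eq0 => /eqP; rewrite /H /= !fctE /= mulr0 expR0 mulr1 => <-.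
by rewrite -mulrA -expRD mulNr addNr expR0 mulr1.
Qed.

(** The window of radius 1 around [a] lets the majorant depend on [a], as in [is_derive_Q], where it
    carries the factor |u| + 1. *)
Lemma is_derive_Rintegral (f df : R -> R -> R) (D : set R) (a : R) (G : R -> R) :
  measurable D -> (forall x : R, mu.-integrable D (EFin \o f x)) ->
  (forall x y : R, D y -> is_derive x 1 (f ^~ y) (df x y)) ->
  mu.-integrable D (EFin \o G) -> (forall y, 0 <= G y) ->
  (forall x y : R, a - 1 < x < a + 1 -> D y -> `|df x y| <= G y) ->
  is_derive a 1 (fun x => \int[mu]_(y in D) f x y) (\int[mu]_(y in D) df a y).
Proof.
move=> mD fi dfP Gi G0 Gub.
have aI : `]a - 1, a + 1[%classic a by rewrite /= in_itv/= ltrBlDr ltrDl ltr01.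
have h1 (x y : R) : `]a - 1, a + 1[%classic x -> D y -> derivable (f ^~ y) x 1.
  by move=> _ Dy; have [] := dfP x _ Dy.
have h2 (x y : R) : `]a - 1, a + 1[%classic x -> D y -> `|partial1of2 f x y| <= G y.
  move=> xI Dy; rewrite partial1of2E; have [_ ->] := dfP x _ Dy.
  by apply: Gub => //; move: xI; rewrite /= in_itv.
apply: DeriveDef.
  exact: (@derivable_under_integral _ _ _ mu f D mD a _ _ aI (fun x _ => fi x) h1 G G0 Gi h2).
rewrite -derive1E (@differentiation_under_integral _ _ _ mu f D mD a _ _ aI (fun x _ => fi x) h1 G G0 Gi h2).
apply: eq_Rintegral => y /set_mem Dy; rewrite partial1of2E.
by have [] := dfP a _ Dy.
Qed.

Let q (t : R) := (1 + t ^+ 2)^-1.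

Let q_gt0 t : 0 < q t.
Proof. by rewrite invr_gt0 ltr_pwDl// sqr_ge0. Qed.

Lemma integral_oneDsqrV : (\int[mu]_t (q t)%:E)%E = pi%:E.
Proof.
have q0 t : 0 <= q t by exact/ltW/q_gt0.
have qN : q =1 q \o -%R by move=> t; rewrite /q/= sqrrN.
rewrite (ge0_symfun_integralT q0 continuous_oneDsqrV qN).
by rewrite -set_itvcy integral0y_oneDsqr -EFinM; congr EFin; field.
Qed.

Lemma integrable_oneDsqrV : mu.-integrable setT (EFin \o q).
Proof.
apply/integrableP; split.
  by apply/measurable_EFinP; apply: continuous_measurable_fun; exact: continuous_oneDsqrV.
rewrite (_ : \int[mu]_(x in _) _ = pi%:E)%E ?ltry// -integral_oneDsqrV.
by apply: eq_integral => t _; rewrite /= ger0_norm// ltW// q_gt0.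
Qed.

(** The quotients by t below take the value 0 at t = 0 by convention, which breaks their derivative
    in u at that point. The origin is therefore removed, and [Rint_setD0] restores it as a null
    set. *)
Let D : set R := [set: R] `\ 0.

Let mD : measurable D.
Proof. by apply: measurableD. Qed.

Let measurable_q : measurable_fun setT q.
Proof. by apply: continuous_measurable_fun; exact: continuous_oneDsqrV. Qed.

(** Differentiating [f] under the integral would give t sin(ut) / (1 + t^2), which is not absolutely
    integrable. So [f] is integrated twice instead: A' = f and Q' = A. *)
Let f (u : R) := \int[mu]_t (cos (u * t) * q t).
Let A (u : R) := \int[mu]_(t in D) (sin (u * t) / t * q t).
Let Q (u : R) := \int[mu]_(t in D) ((1 - cos (u * t)) / t ^+ 2 * q t).

Let measurable_cosM u (E : set R) : measurable_fun E (fun t : R => cos (u * t)).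
Proof.
apply: measurable_funTS; apply: continuous_measurable_fun => t.
by apply: continuous_comp; [exact: mulrl_continuous|exact: continuous_cos].
Qed.

Let measurable_sinM u (E : set R) : measurable_fun E (fun t : R => sin (u * t)).
Proof.
apply: measurable_funTS; apply: continuous_measurable_fun => t.
by apply: continuous_comp; [exact: mulrl_continuous|exact: continuous_sin].
Qed.

Let measurable_sinc u : measurable_fun D (fun t : R => sin (u * t) / t).
Proof. by apply: measurable_funM => //; exact: measurable_funTS measurable_invr. Qed.

Let measurable_Vsqr (E : set R) : measurable_fun E (fun t : R => t ^- 2).
Proof.
rewrite (_ : (fun _ => _) = (fun t : R => t^-1 ^+ 2)); last by apply/funext => t; rewrite exprVn.
by apply: measurable_funX; exact: measurable_funTS measurable_invr.
Qed.

Let integrable_f u : mu.-integrable setT (EFin \o (fun t => cos (u * t) * q t)).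
Proof.
apply: integrable_le integrable_oneDsqrV _ => //; first exact: measurable_funM.
move=> t _; by rewrite normrM (gtr0_norm (q_gt0 t)) ler_piMl ?cos_max// ltW.
Qed.

Let integrable_A u : mu.-integrable D (EFin \o (fun t => sin (u * t) / t * q t)).
Proof.
apply: (@integrable_le _ _ _ (fun t => `|u| * q t)) => //.
- by apply: measurable_funM; last exact: measurable_funTS.
- apply: integrableRZ => //; apply: integrableS integrable_oneDsqrV => //.
- move=> t [_ /eqP t0]; rewrite normrM (gtr0_norm (q_gt0 t)) ler_pM2r//.
  rewrite normrM normfV ler_pdivrMr ?normr_gt0// -normrM; exact: sin_le_norm.
Qed.

Let Q_ub u t : t != 0 -> `|(1 - cos (u * t)) / t ^+ 2 * q t| <= u ^+ 2 / 2 * q t.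
Proof.
move=> t0; rewrite normrM (gtr0_norm (q_gt0 t)) ler_pM2r//.
rewrite ger0_norm ?divr_ge0 ?onem_cos_ge0 ?sqr_ge0// ler_pdivrMr ?exprn_even_gt0//.
by apply: le_trans (onem_cos_le _) _; rewrite exprMn mulrAC.
Qed.

Let integrable_Q u : mu.-integrable D (EFin \o (fun t => (1 - cos (u * t)) / t ^+ 2 * q t)).
Proof.
apply: (@integrable_le _ _ _ (fun t => u ^+ 2 / 2 * q t)) => //.
- apply: measurable_funM; last exact: measurable_funTS.
  by apply: measurable_funM => //; exact: measurable_funB.
- apply: integrableRZ => //; apply: integrableS integrable_oneDsqrV => //.
- by move=> t [_ /eqP t0]; exact: Q_ub.
Qed.

Let is_derive_cosM (t : R) (x : R) : is_derive x 1 (fun x => cos (x * t)) (- sin (x * t) * t).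
Proof.
have dk : is_derive x 1 (fun x : R => x * t) t.
  by apply: is_derive_eq; rewrite /GRing.scale/= mulr1 ?mulr0 ?addr0 ?add0r.
by have := @is_derive1_comp R cos (fun x => x * t) x _ _ (is_derive_cos _) dk.
Qed.

Let is_derive_sinM (t : R) (x : R) : is_derive x 1 (fun x => sin (x * t)) (cos (x * t) * t).
Proof.
have dk : is_derive x 1 (fun x : R => x * t) t.
  by apply: is_derive_eq; rewrite /GRing.scale/= mulr1 ?mulr0 ?addr0 ?add0r.
by have := @is_derive1_comp R sin (fun x => x * t) x _ _ (is_derive_sin _) dk.
Qed.

Let Rint_setD0 (h : R -> R) : measurable_fun D h ->
  \int[mu]_(t in D) h t = \int[mu]_t h t.
Proof.
by move=> mh; rewrite /Rintegral /D integral_setD1//; exact/measurable_EFinP.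
Qed.

Let is_derive_A (u : R) : is_derive u 1 A (f u).
Proof.
rewrite /f -Rint_setD0; last by apply: measurable_funTS; apply: measurable_funM.
apply: (@is_derive_Rintegral _ (fun u t => cos (u * t) * q t) D u q) => //.
- move=> x t [_ /eqP t0]; have := is_derive_sinM t x => ds.
  rewrite (_ : (fun x => _) = (q t / t) *: (fun x => sin (x * t))); last first.
    by apply/funext => y; change (sin (y * t) / t * q t = q t / t * sin (y * t)); ring.
  by apply: is_derive_eq; rewrite /GRing.scale/=; field.
- exact: integrableS integrable_oneDsqrV.
- by move=> t; exact/ltW/q_gt0.
- move=> x t _ _; by rewrite normrM (gtr0_norm (q_gt0 t)) ler_piMl ?cos_max// ltW.
Qed.

Let is_derive_Q (u : R) : is_derive u 1 Q (A u).
Proof.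
apply: (@is_derive_Rintegral _ (fun u t => sin (u * t) / t * q t) D u (fun t => (`|u| + 1) * q t)) => //.
- move=> x t [_ /eqP t0]; have := is_derive_cosM t x => ds.
  rewrite (_ : (fun x => _) = cst (q t / t ^+ 2) - (q t / t ^+ 2) *: (fun x => cos (x * t))); last first.
    apply/funext => y; change ((1 - cos (y * t)) / t ^+ 2 * q t = q t / t ^+ 2 - q t / t ^+ 2 * cos (y * t)); ring.
  by apply: is_derive_eq; rewrite /GRing.scale/=; field.
- by apply: integrableRZ => //; exact: integrableS integrable_oneDsqrV.
- by move=> t; rewrite mulr_ge0 ?addr_ge0// ltW.
- move=> x t /andP[x1 x2] [_ /eqP t0]; rewrite normrM (gtr0_norm (q_gt0 t)) ler_pM2r//.
  rewrite normrM normfV ler_pdivrMr ?normr_gt0//; apply: (le_trans (sin_le_norm _)).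
  rewrite normrM ler_pM2r ?normr_gt0// ler_norml.
  have := ler_norm u; have := ler_norm (- u); rewrite normrN => h1 h2.
  by apply/andP; split; lra.
Qed.

Let h (t : R) := (1 - cos t) / t ^+ 2.

(** From 1 / t^2 = 1 / (t^2 (1 + t^2)) + 1 / (1 + t^2). Once integrated, this expresses [f] through
    [Q]. *)
Let rhoE u (t : R) : D t -> (1 - cos (u * t)) / t ^+ 2 =
  (1 - cos (u * t)) / t ^+ 2 * q t + (q t - cos (u * t) * q t).
Proof.
move=> [_ /eqP t0]; have q0 : 1 + t ^+ 2 != 0 by rewrite gt_eqF// ltr_pwDl// sqr_ge0.
rewrite /q; field; by rewrite t0 q0.
Qed.

Let integrable_rho u : mu.-integrable D (EFin \o (fun t => (1 - cos (u * t)) / t ^+ 2)).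
Proof.
apply: (@eq_integrable _ _ _ mu D mD (EFin \o (fun t => (1 - cos (u * t)) / t ^+ 2 * q t + (q t - cos (u * t) * q t)))).
  by move=> t /set_mem Dt /=; rewrite -rhoE.
apply: integrableRD => //; apply: integrableRB => //.
- exact: integrableS integrable_oneDsqrV.
- exact: integrableS (integrable_f u).
Qed.

Let rho_f u : \int[mu]_(t in D) ((1 - cos (u * t)) / t ^+ 2) = Q u + (pi - f u).
Proof.
have iq : mu.-integrable D (EFin \o q) by exact: integrableS integrable_oneDsqrV.
have ic : mu.-integrable D (EFin \o (fun t => cos (u * t) * q t)) by exact: integrableS (integrable_f u).
rewrite (@eq_Rintegral _ _ _ mu D (fun t => (1 - cos (u * t)) / t ^+ 2 * q t + (q t - cos (u * t) * q t))); last first.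
  by move=> t /set_mem Dt; rewrite -rhoE.
rewrite RintegralD//; last exact: integrableRB.
rewrite RintegralB//; congr (_ + (_ - _)).
  by rewrite Rint_setD0; [rewrite /Rintegral integral_oneDsqrV|exact: measurable_funTS].
by apply: Rint_setD0; apply: measurable_funTS; exact: measurable_funM.
Qed.

(** Substituting ut for t gives homogeneity of degree 1. Together with [rho_f], [f] becomes a linear
    function plus [Q], hence differentiable; the constant is identified as pi at the end. *)
Let rho_lin u : 0 <= u ->
  \int[mu]_(t in D) ((1 - cos (u * t)) / t ^+ 2) = u * \int[mu]_(t in D) h t.
Proof.
rewrite le_eqVlt => /predU1P[<-|u0].
  rewrite mul0r; under eq_Rintegral do rewrite mul0r cos0 subrr mul0r.
  by rewrite Rintegral_cst// mul0r.
have mhT : measurable_fun setT h.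
  apply: measurable_funM => //; apply: measurable_funB => //.
  by apply: continuous_measurable_fun; exact: continuous_cos.
have mh : measurable_fun D h by exact: measurable_funTS.
rewrite !Rint_setD0//; last first.
  by have /measurable_int/measurable_EFinP := integrable_rho u.
have hu t : (1 - cos (u * t)) / t ^+ 2 = u ^+ 2 * h (u * t).
  have [->|t0] := eqVneq t 0; first by rewrite /h mulr0 cos0 subrr !mul0r mulr0.
  by rewrite /h; field; rewrite t0 gt_eqF.
have iT : mu.-integrable setT (EFin \o (fun t => h (u * t))).
  have mhu : measurable_fun setT (fun t => h (u * t)).
    by apply: measurableT_comp => //; exact: mulrl_measurable.
  apply/(@negligible_integrable _ _ _ mu setT [set 0]) => //.
  - exact/measurable_EFinP.
  - exact: lebesgue_measure_set1.
  - rewrite -/D.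
    apply: (@eq_integrable _ _ _ mu D mD (EFin \o (fun t => u ^- 2 * ((1 - cos (u * t)) / t ^+ 2)))).
      by move=> t _ /=; rewrite hu mulrA mulVf ?mul1r// gt_eqF// exprn_gt0.
    exact: integrableRZ.
rewrite (Rintegral_scale u0 mhT)//.
under eq_Rintegral do rewrite hu.
by rewrite RintegralZl// expr2 !mulrA.
Qed.

(* Let [f u] be the left-hand side, [A] its primitive and [C] the integral of
   [(1 - cos t) / t ^+ 2]. Then [f + (A - C)] and [f - (A - C)] solve [y' = y]
   and [y' = - y], and boundedness of [f] rules out the growing solution. *)
Lemma poisson_integral u : 0 <= u -> \int[mu]_t (cos (u * t) * (1 + t ^+ 2)^-1) = pi * expR (- u).
Proof.
pose C := \int[mu]_(t in D) h t.
pose f1 v := pi - C * v + Q v.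
have f1E v : 0 <= v -> f1 v = f v.
  by move=> v0; rewrite /f1; have := rho_f v; rewrite rho_lin// => e; rewrite -/C in e; lra.
have dL (v : R) : is_derive v 1 (fun w => pi - C * w) (- C).
  have dC : is_derive v 1 (fun w : R => C * w) C.
    by apply: is_derive_eq; rewrite /GRing.scale/= mulr1.
  by have := is_deriveB (is_derive_cst (pi : R) v 1) dC; rewrite sub0r.
have df1 (v : R) : is_derive v 1 f1 (- C + A v).
  exact: is_deriveD (dL v) (is_derive_Q v).
have dAC (v : R) : is_derive v 1 (fun w => A w - C) (f v).
  by have := is_deriveB (is_derive_A v) (is_derive_cst C v 1); rewrite subr0.
have f10 : f1 0 = pi.
  rewrite /f1 mulr0 subr0 /Q; under eq_Rintegral do rewrite mul0r cos0 subrr !mul0r.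
  by rewrite Rintegral_cst// mul0r addr0.
have A0 : A 0 = 0.
  rewrite /A; under eq_Rintegral do rewrite mul0r sin0 !mul0r.
  by rewrite Rintegral_cst// mul0r.
have eE (v : R) : 0 <= v -> f1 v + (A v - C) = (pi - C) * expR v.
  move=> v0.
  have dd (w : R) : 0 <= w -> is_derive w 1 (fun w => f1 w + (A w - C)) (1 * (f1 w + (A w - C))).
    move=> w0; have := is_deriveD (df1 w) (dAC w).
    by rewrite (_ : 1 * _ = - C + A w + f w)// f1E//; ring.
  by have := exp_ode dd v0; rewrite f10 A0 sub0r mul1r.
have eG (v : R) : 0 <= v -> f1 v - (A v - C) = (pi + C) * expR (- v).
  move=> v0.
  have dd (w : R) : 0 <= w -> is_derive w 1 (fun w => f1 w - (A w - C)) (-1 * (f1 w - (A w - C))).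
    move=> w0; have := is_deriveB (df1 w) (dAC w).
    by rewrite (_ : -1 * _ = - C + A w - f w)// f1E//; ring.
  by have := exp_ode dd v0; rewrite f10 A0 sub0r opprK mulN1r.
have f_le v : `|f v| <= pi.
  apply: (le_trans (le_normr_Rintegral _ (integrable_f v))) => //.
  rewrite -[leRHS]/(fine pi%:E) -integral_oneDsqrV; apply: le_Rintegral => //.
  - exact: integrable_norm.
  - exact: integrable_oneDsqrV.
  - by move=> t _; rewrite normrM (gtr0_norm (q_gt0 t)) ler_piMl ?cos_max// ltW.
have piC : pi = C.
  apply/eqP; rewrite -subr_eq0; apply/negPn/negP => n0.
  (* At this point |pi - C| v is already 2 pi + |pi + C| + 1, and exp(v) > v, whereas |f| <= pi
     bounds |pi - C| exp(v) by 2 pi + |pi + C|. *)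
  pose v := (2 * pi + `|pi + C| + 1) / `|pi - C|.
  have p0 : 0 < `|pi - C| by rewrite normr_gt0.
  have pi0 : 0 <= pi :> R by exact: pi_ge0.
  have v0 : 0 <= v by rewrite divr_ge0// !addr_ge0// mulr_ge0.
  have : (pi - C) * expR v = 2 * f v - (pi + C) * expR (- v).
    by rewrite -eE// -eG// f1E//; ring.
  move/(congr1 Num.norm); rewrite normrM (ger0_norm (expR_ge0 _)) => e.
  have : `|pi - C| * v < `|pi - C| * expR v.
    by rewrite ltr_pM2l//; apply: lt_le_trans (expR_ge1Dx v); rewrite ltrDr.
  rewrite e /v mulrCA divff ?mulr1 ?gt_eqF//; apply/negP; rewrite -leNgt.
  apply: (le_trans (ler_normB _ _)); rewrite normrM normrM (ger0_norm (expR_ge0 _)) ger0_norm//.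
  have h1 := f_le v.
  have h2 : `|pi + C| * expR (- v) <= `|pi + C|.
    by rewrite ler_piMr// expR_le1 oppr_le0.
  lra.
by move=> u0; have := eE _ u0; have := eG _ u0; rewrite -piC f1E// subrr mul0r /f; lra.
Qed.
End PoissonIntegral.

(** * Complex powers and Beta integrals *)

Section ComplexIntegrals.
Context {R : realType}.
Local Notation mu := (@lebesgue_measure R).
Local Notation C := (R[i]).
Local Notation Re := (@complex.Re R).
Local Notation Im := (@complex.Im R).
Local Notation normc := (@ComplexField.Normc.normc R).
Local Notation "x %:C" := (Complex (x : R) 0) (format "x %:C").
Implicit Types (z w : C) (D : set R) (f g : R -> C).

Lemma cReM z w : Re (z * w) = Re z * Re w - Im z * Im w.
Proof. by case: z; case: w. Qed.

Lemma cImM z w : Im (z * w) = Re z * Im w + Im z * Re w.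
Proof. by case: z; case: w. Qed.

Lemma complex_ReIm z : Complex (Re z) (Im z) = z.
Proof. by case: z. Qed.

Lemma complex_eq z w : Re z = Re w -> Im z = Im w -> z = w.
Proof. by case: z; case: w => ? ? ? ? /= -> ->. Qed.

Lemma normc_Re z : `|Re z| <= normc z.
Proof.
by case: z => a b /=; rewrite -sqrtr_sqr ler_wsqrtr// lerDl sqr_ge0.
Qed.

Lemma normc_Im z : `|Im z| <= normc z.
Proof.
by case: z => a b /=; rewrite -sqrtr_sqr ler_wsqrtr// lerDr sqr_ge0.
Qed.

Lemma normc_ge0 z : 0 <= normc z.
Proof. by case: z => a b /=; exact: sqrtr_ge0. Qed.

Lemma normcR (a : R) : normc a%:C = `|a|.
Proof. by rewrite /= expr0n addr0 sqrtr_sqr. Qed.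

Lemma normc_cpowR (t : R) z : normc (cpowR t z) = expR (Re z * ln t).
Proof.
rewrite /cpowR /= !exprMn -mulrDr cos2Dsin2 mulr1 sqrtr_sqr ger0_norm// expR_ge0.
Qed.

Lemma cpowRD (t : R) z w : cpowR t (z + w) = cpowR t z * cpowR t w.
Proof.
apply: complex_eq; rewrite ?cReM ?cImM /cpowR; case: z => a b; case: w => a' b' /=;
  rewrite !mulrDl expRD ?cosD ?sinD; ring.
Qed.

Lemma cpowRM (t u : R) z : 0 < t -> 0 < u -> cpowR (t * u) z = cpowR t z * cpowR u z.
Proof.
move=> t0 u0; apply: complex_eq; rewrite ?cReM ?cImM /cpowR /= lnM ?posrE// !mulrDr expRD ?cosD ?sinD; ring.
Qed.

Lemma cpowRV (t : R) z : 0 < t -> cpowR t^-1 z = cpowR t (- z).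
Proof.
move=> t0; rewrite /cpowR; case: z => a b /=; rewrite lnV ?posrE//.
by rewrite !mulrN !mulNr.
Qed.

Lemma cpowR1 z : cpowR (1 : R) z = 1.
Proof. by apply: complex_eq; rewrite /cpowR /= ln1 !mulr0 expR0 ?cos0 ?sin0 mul1r. Qed.

Lemma cpowR_nat (t : R) (n : nat) : 0 < t -> cpowR t n%:R%:C = (t ^+ n)%:C.
Proof.
move=> t0; apply: complex_eq; rewrite /cpowR /= mul0r ?cos0 ?sin0 ?mulr0// mulr1.
by rewrite mulrC expRM_natr lnK ?posrE.
Qed.

Definition cmeasurable d (T : measurableType d) (D : set T) (f : T -> C) :=
  measurable_fun D (fun t => Re (f t)) /\ measurable_fun D (fun t => Im (f t)).

Definition cintegrable D f :=
  mu.-integrable D (EFin \o (fun t => Re (f t))) /\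
  mu.-integrable D (EFin \o (fun t => Im (f t))).

Lemma cintegrable_le D f (b : R -> R) : measurable D -> cmeasurable D f ->
  mu.-integrable D (EFin \o b) -> (forall x, D x -> normc (f x) <= b x) ->
  cintegrable D f.
Proof.
move=> mD [mr mi] ib fb; split; apply: (integrable_le mD _ ib) => // x Dx.
  exact: le_trans (normc_Re _) (fb _ Dx).
exact: le_trans (normc_Im _) (fb _ Dx).
Qed.

Lemma eq_cint D f g : {in D, f =1 g} -> cint D f = cint D g.
Proof.
by move=> fg; congr Complex; apply: eq_Rintegral => x xD; rewrite fg.
Qed.

Lemma eq_cintegrable D f g : measurable D -> {in D, f =1 g} -> cintegrable D f -> cintegrable D g.
Proof.
move=> mD fg [fr fi]; split.
  by apply: eq_integrable fr => // t tD /=; rewrite fg.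
by apply: eq_integrable fi => // t tD /=; rewrite fg.
Qed.

Lemma cintegrableD D f g : measurable D -> cintegrable D f -> cintegrable D g ->
  cintegrable D (fun t => f t + g t).
Proof.
move=> mD [fr fi] [gr gi]; split.
  apply: eq_integrable (integrableRD mD fr gr) => // t _ /=.
  by case: (f t); case: (g t).
apply: eq_integrable (integrableRD mD fi gi) => // t _ /=.
by case: (f t); case: (g t).
Qed.

Lemma cintegrableZ D z f : measurable D -> cintegrable D f ->
  cintegrable D (fun t => z * f t).
Proof.
move=> mD [fr fi]; split.
  apply: eq_integrable (integrableRB mD (integrableRZ (Re z) mD fr) (integrableRZ (Im z) mD fi)) => //.
  by move=> t _ /=; rewrite cReM.
apply: eq_integrable (integrableRD mD (integrableRZ (Re z) mD fi) (integrableRZ (Im z) mD fr)) => //.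
by move=> t _ /=; rewrite cImM.
Qed.

Lemma cintD D f g : measurable D -> cintegrable D f -> cintegrable D g ->
  cint D (fun t => f t + g t) = cint D f + cint D g.
Proof.
move=> mD [fr fi] [gr gi]; apply: complex_eq => /=; rewrite -RintegralD//.
  by apply: eq_Rintegral => t _; case: (f t); case: (g t).
by apply: eq_Rintegral => t _; case: (f t); case: (g t).
Qed.

Lemma cintZ D z f : measurable D -> cintegrable D f ->
  cint D (fun t => z * f t) = z * cint D f.
Proof.
move=> mD [fr fi]; apply: complex_eq; rewrite ?cReM ?cImM /=; rewrite -!RintegralZl//.
  rewrite -RintegralB//; [|exact: integrableRZ..].
  by apply: eq_Rintegral => t _; rewrite cReM.
rewrite -RintegralD//; [|exact: integrableRZ..].
by apply: eq_Rintegral => t _; rewrite cImM.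
Qed.

Lemma cmeasurableM d (T : measurableType d) (D : set T) (f g : T -> C) : cmeasurable D f -> cmeasurable D g ->
  cmeasurable D (fun t => f t * g t).
Proof.
move=> [fr fi] [gr gi]; split.
  rewrite (_ : (fun _ => _) = (fun t => Re (f t) * Re (g t) - Im (f t) * Im (g t))).
    by apply: measurable_funB; apply: measurable_funM.
  by apply/funext => t; rewrite cReM.
rewrite (_ : (fun _ => _) = (fun t => Re (f t) * Im (g t) + Im (f t) * Re (g t))).
  by apply: measurable_funD; apply: measurable_funM.
by apply/funext => t; rewrite cImM.
Qed.

Lemma cmeasurableR d (T : measurableType d) (D : set T) (h : T -> R) : measurable_fun D h -> cmeasurable D (fun t => (h t)%:C).
Proof. by move=> mh; split => //=. Qed.

Lemma cmeasurable_cpowR d (T : measurableType d) (D : set T) (h a b : T -> R) :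
  measurable_fun D h -> measurable_fun D a -> measurable_fun D b ->
  cmeasurable D (fun t => cpowR (h t) (Complex (a t) (b t))).
Proof.
move=> mh ma mb.
have ml : measurable_fun D (fun t => ln (h t)) by exact: (measurableT_comp (@measurable_ln R) mh).
have me : measurable_fun D (fun t => expR (a t * ln (h t))).
  by apply: measurableT_comp => //; apply: measurable_funM.
split => /=; apply: measurable_funM => //.
  by apply: measurableT_comp; [apply: continuous_measurable_fun; exact: continuous_cos|apply: measurable_funM].
by apply: measurableT_comp; [apply: continuous_measurable_fun; exact: continuous_sin|apply: measurable_funM].
Qed.

(** Computed in the variable ln t, where both parts are an exponential times a cosine or a sine; the
    inner derivative 1 / t lowers the exponent by 1. *)
Lemma is_derive_cpowR z (t : R) : 0 < t ->
  is_derive t 1 (fun t => Re (cpowR t z)) (Re (z * cpowR t (z - 1))) /\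
  is_derive t 1 (fun t => Im (cpowR t z)) (Im (z * cpowR t (z - 1))).
Proof.
move=> t0; case: z => a b; rewrite cReM cImM /cpowR /= subr0.
have eln : expR ((a - 1) * ln t) = expR (a * ln t) / t.
  by rewrite mulrBl mul1r expRB lnK ?posrE.
have dM (k : R) (u : R) : is_derive u 1 (fun u => k * u) k.
  by apply: is_derive_eq; rewrite /GRing.scale/= mulr1.
have de (u : R) : is_derive u 1 (fun u => expR (a * u)) (expR (a * u) * a).
  exact: (@is_derive1_comp R expR (fun u => a * u) u _ _ (is_derive_expR _) (dM _ _)).
have dc (u : R) : is_derive u 1 (fun u => cos (b * u)) (- sin (b * u) * b).
  exact: (@is_derive1_comp R cos (fun u => b * u) u _ _ (is_derive_cos _) (dM _ _)).
have ds (u : R) : is_derive u 1 (fun u => sin (b * u)) (cos (b * u) * b).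
  exact: (@is_derive1_comp R sin (fun u => b * u) u _ _ (is_derive_sin _) (dM _ _)).
have dln := is_derive1_ln t0.
split.
  have dp (u : R) := is_deriveM (de u) (dc u).
  have := @is_derive1_comp R _ (@ln R) t _ _ (dp (ln t)) dln.
  by rewrite eln /GRing.scale/= => h; apply: is_derive_eq h _; ring.
have dp (u : R) := is_deriveM (de u) (ds u).
have := @is_derive1_comp R _ (@ln R) t _ _ (dp (ln t)) dln.
by rewrite eln /GRing.scale/= => h; apply: is_derive_eq h _; ring.
Qed.

Lemma is_derive_MRe (A dz : C) (f : R -> C) (t : R) :
  is_derive t 1 (fun t => Re (f t)) (Re dz) ->
  is_derive t 1 (fun t => Im (f t)) (Im dz) ->
  is_derive t 1 (fun t => Re (A * f t)) (Re (A * dz)) /\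
  is_derive t 1 (fun t => Im (A * f t)) (Im (A * dz)).
Proof.
move=> dr di; split.
  rewrite cReM (_ : (fun _ => _) = Re A \*: (fun t => Re (f t)) - Im A \*: (fun t => Im (f t))).
    exact: is_deriveB (is_deriveZ _ dr) (is_deriveZ _ di).
  by apply/funext => u; rewrite cReM.
rewrite cImM (_ : (fun _ => _) = Re A \*: (fun t => Im (f t)) + Im A \*: (fun t => Re (f t))).
  exact: is_deriveD (is_deriveZ _ di) (is_deriveZ _ dr).
by apply/funext => u; rewrite cImM.
Qed.

(** The limits are stated through the modulus, which is explicit for complex powers and dominates
    both parts. *)
Lemma cint_FTC_0y (F f : R -> C) (A B : C) :
  cintegrable `]0, +oo[ f ->
  (forall t : R, 0 < t -> is_derive t 1 (fun t => Re (F t)) (Re (f t)) /\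
    is_derive t 1 (fun t => Im (F t)) (Im (f t))) ->
  (forall t : R, 0 < t -> {for t, continuous (fun t => Re (f t))} /\
    {for t, continuous (fun t => Im (f t))}) ->
  normc (F t - A) @[t --> 0^'+] --> (0 : R) -> normc (F t - B) @[t --> +oo] --> (0 : R) ->
  cint `]0, +oo[ f = B - A.
Proof.
move=> [fr fi] dF cf FA FB.
have sq (g : R -> R) (l : R) (h : R -> R) (FF : set_system R) : Filter FF ->
    (forall t, `|g t - l| <= h t) -> h @ FF --> (0 : R) -> g @ FF --> l.
  move=> FFF gh h0; apply/cvgrPdist_le => e e0; move/cvgrPdist_le : h0 => /(_ _ e0).
  apply: filterS => t; rewrite sub0r normrN => ht; rewrite distrC.
  by apply: le_trans (gh t) (le_trans (ler_norm _) ht).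
apply: complex_eq => /=.
  rewrite (_ : Re (B - A) = Re B - Re A); last by case: A {FA}; case: B {FB}.
  apply: Rintegral_FTC_0y => //.
  - by move=> t t0; exact: (dF t t0).1.
  - by move=> t t0; exact: (cf t t0).1.
  - by apply: sq FA => t; apply: le_trans (normc_Re _); rewrite raddfB.
  - by apply: sq FB => t; apply: le_trans (normc_Re _); rewrite raddfB.
rewrite (_ : Im (B - A) = Im B - Im A); last by case: A {FA}; case: B {FB}.
apply: Rintegral_FTC_0y => //.
- by move=> t t0; exact: (dF t t0).2.
- by move=> t t0; exact: (cf t t0).2.
- by apply: sq FA => t; apply: le_trans (normc_Im _); rewrite raddfB.
- by apply: sq FB => t; apply: le_trans (normc_Im _); rewrite raddfB.
Qed.
End ComplexIntegrals.

Section BetaIntegrals.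
Context {R : realType}.
Local Notation mu := (@lebesgue_measure R).
Local Notation C := (R[i]).
Local Notation Re := (@complex.Re R).
Local Notation Im := (@complex.Im R).
Local Notation normc := (@ComplexField.Normc.normc R).
Local Notation "x %:C" := (Complex (x : R) 0) (format "x %:C").
Implicit Types (z w s : C).

Lemma natC (n : nat) : n%:R = n%:R%:C :> C.
Proof. by have := rmorph_nat (real_complex R) n => /= <-. Qed.

Lemma is_derive_cpowR1p z (t : R) : -1 < t ->
  is_derive t 1 (fun t => Re (cpowR (1 + t) z)) (Re (z * cpowR (1 + t) (z - 1))) /\
  is_derive t 1 (fun t => Im (cpowR (1 + t) z)) (Im (z * cpowR (1 + t) (z - 1))).
Proof.
move=> t1; have t0 : 0 < 1 + t by rewrite -ltrBlDl sub0r.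
have d1 : is_derive t 1 (fun t : R => 1 + t) 1.
  by have := is_deriveD (is_derive_cst (1 : R) t 1) (is_derive_id t 1); rewrite add0r.
have [dr di] := is_derive_cpowR z t0.
split.
  by have := @is_derive1_comp R _ (fun t : R => 1 + t) t _ _ dr d1; rewrite mulr1.
by have := @is_derive1_comp R _ (fun t : R => 1 + t) t _ _ di d1; rewrite mulr1.
Qed.

Lemma is_derive_continuous (f : R -> R) (t l : R) : is_derive t 1 f l -> {for t, continuous f}.
Proof. by case=> df _; apply/differentiable_continuous/derivable1_diffP. Qed.

Lemma continuous_cpowR1p z (t : R) : -1 < t ->
  {for t, continuous (fun t : R => Re (cpowR (1 + t) z))} /\
  {for t, continuous (fun t : R => Im (cpowR (1 + t) z))}.
Proof. by move=> /(is_derive_cpowR1p z)[/is_derive_continuous ? /is_derive_continuous ?]. Qed.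

Lemma normc_le_ReIm z : normc z <= `|Re z| + `|Im z|.
Proof.
case: z => a b /=; rewrite -(@ler_pXn2r _ 2)// ?nnegrE ?sqrtr_ge0 ?addr_ge0//.
rewrite sqr_sqrtr ?addr_ge0 ?sqr_ge0// sqrrD !real_normK ?num_real//.
by rewrite -addrA lerD2l -[leLHS]add0r lerD2r mulrn_wge0// mulr_ge0.
Qed.

Lemma cvg_cpowR1p_y z : Re z < 0 -> normc (cpowR (1 + t) z) @[t --> +oo] --> (0 : R).
Proof.
move=> z0; apply/cvgrPdist_le => e e0; near=> t.
have t0 : 0 < t by near: t; exact: nbhs_pinfty_gt.
rewrite sub0r normrN ger0_norm ?normc_ge0// normc_cpowR -[leRHS]lnK ?posrE// ler_expR.
rewrite mulrC -ler_ndivrMr// -ler_expR lnK ?posrE ?addr_gt0//.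
apply: (@le_trans _ _ t); last by rewrite lerDr.
by near: t; exact: nbhs_pinfty_ge.
Unshelve. all: by end_near. Qed.

Lemma cvg_cpowR1p_0 z : normc (cpowR (1 + t) z - 1) @[t --> 0^'+] --> (0 : R).
Proof.
have [cr ci] := @continuous_cpowR1p z 0 (ltrN10 _).
have cr0 : Re (cpowR (1 + t) z) @[t --> (0 : R)] --> Re (cpowR (1 + 0) z) by exact: cr.
have ci0 : Im (cpowR (1 + t) z) @[t --> (0 : R)] --> Im (cpowR (1 + 0) z) by exact: ci.
rewrite addr0 cpowR1 /= in cr0 ci0.
apply: (@squeeze_cvgr _ _ _ _ (fun=> 0) (fun t => `|Re (cpowR (1 + t) z) - 1| + `|Im (cpowR (1 + t) z)|)).
- near=> t; apply/andP; split; first exact: normc_ge0.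
  by have := normc_le_ReIm (cpowR (1 + t) z - 1); rewrite !raddfB/= subr0.
- exact: cvg_cst.
- rewrite -[X in _ --> X]addr0; apply: cvgD; apply: cvg_at_right_filter.
    rewrite -[X in _ --> X](@normr0 _ R); apply: cvg_norm.
    rewrite -[X in _ --> X](subrr (1 : R)); apply: cvgB; last exact: cvg_cst.
    exact: cr0.
  rewrite -[X in _ --> X](@normr0 _ R); apply: cvg_norm.
  exact: ci0.
Unshelve. all: by end_near. Qed.

Lemma cmeasurable_cpowR1p (D : set R) z : cmeasurable D (fun t => cpowR (1 + t) z).
Proof. by case: z => a b; apply: cmeasurable_cpowR => //; apply: measurable_funD. Qed.

Lemma cpowR_real (u a : R) : cpowR u a%:C = (expR (a * ln u))%:C.
Proof. by apply: complex_eq; rewrite /cpowR /= mul0r ?cos0 ?sin0 ?mulr1 ?mulr0. Qed.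

Lemma integrable_powR1p (r : R) : r < -1 ->
  mu.-integrable `]0, +oo[ (EFin \o (fun t => expR (r * ln (1 + t)))).
Proof.
move=> r1; have r10 : r + 1 < 0 by rewrite -ltrBrDr sub0r.
pose F t := (r + 1)^-1 * Re (cpowR (1 + t) (r + 1)%:C).
apply: (@ge0_integrable_FTC_0y _ F _ (r + 1)^-1 0).
- by move=> t _; exact: expR_ge0.
- move=> t t0; have [dr _] := is_derive_cpowR1p (r + 1)%:C (lt_trans (ltrN10 R) t0).
  have := is_deriveZ (r + 1)^-1 dr; rewrite (_ : (r + 1)%:C - 1 = r%:C); last first.
    by apply: complex_eq => /=; rewrite ?subr0// addrK.
  have -> : (r + 1)^-1 *: Re ((r + 1)%:C * cpowR (1 + t) r%:C) = expR (r * ln (1 + t)).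
    by rewrite cReM cpowR_real/= mul0r subr0 /GRing.scale/= mulrA mulVf ?mul1r ?lt_eqF.
  exact.
- move=> t t0; have [cr _] := continuous_cpowR1p r%:C (lt_trans (ltrN10 R) t0).
  by move: cr; rewrite (_ : (fun t => Re _) = (fun t => expR (r * ln (1 + t))))//; apply/funext => u; rewrite cpowR_real.
- rewrite -[X in _ --> X]mulr1; apply: cvgM; [exact: cvg_cst|apply: cvg_at_right_filter].
  have [cr _] := @continuous_cpowR1p (r + 1)%:C 0 (ltrN10 _).
  have cr0 : Re (cpowR (1 + t) (r + 1)%:C) @[t --> (0 : R)] --> Re (cpowR (1 + 0) (r + 1)%:C) by exact: cr.
  by rewrite addr0 cpowR1 in cr0.
- rewrite -[X in _ --> X](mulr0 (r + 1)^-1); apply: cvgM; [exact: cvg_cst|].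
  have := @cvg_cpowR1p_y (r + 1)%:C r10; apply: cvg_trans; apply: near_eq_cvg.
  by apply: nearW => t; rewrite cpowR_real normcR/= ger0_norm ?expR_ge0.
Qed.

Lemma cintegrable_cpowR1p z : Re z < -1 -> cintegrable `]0, +oo[ (fun t => cpowR (1 + t) z).
Proof.
move=> z1; apply: cintegrable_le (integrable_powR1p z1) _ => //.
  exact: cmeasurable_cpowR1p.
by move=> t _; rewrite normc_cpowR.
Qed.

Lemma cint_cpowR1p z : Re z < -1 -> cint `]0, +oo[ (fun t => cpowR (1 + t) z) = - (z + 1)^-1.
Proof.
move=> z1; have z10 : Re (z + 1) < 0 by rewrite raddfD/= -ltrBrDr sub0r.
have zn0 : z + 1 != 0 by apply: contraTN z10 => /eqP ->; rewrite ltxx.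
rewrite (@cint_FTC_0y _ (fun t => (z + 1)^-1 * cpowR (1 + t) (z + 1)) _ (z + 1)^-1 0) ?sub0r//.
- exact: cintegrable_cpowR1p.
- move=> t t0; have [dr di] := is_derive_cpowR1p (z + 1) (lt_trans (ltrN10 R) t0).
  by have := is_derive_MRe (z + 1)^-1 dr di; rewrite mulrA mulVf// mul1r addrK.
- by move=> t t0; exact: continuous_cpowR1p (lt_trans (ltrN10 R) t0).
- have := cvg_cpowR1p_0 (z + 1) => h.
  rewrite -[X in _ --> X](mulr0 (normc (z + 1)^-1)).
  under eq_fun do rewrite -{2}[(z + 1)^-1]mulr1 -mulrBr ComplexField.Normc.normcM.
  by apply: cvgM; [exact: cvg_cst|exact: h].
- rewrite -[X in _ --> X](mulr0 (normc (z + 1)^-1)).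
  under eq_fun do rewrite subr0 ComplexField.Normc.normcM.
  by apply: cvgM; [exact: cvg_cst|exact: cvg_cpowR1p_y].
Qed.

(* Closed form of the integral of [t ^+ a * (1 + t) ^+ k * (1 + t) ^ (- s)] over
   the positive half-line; see [beta_integral]. *)
Definition betaC (a k : nat) s : C := (a`!)%:R / \prod_(i < a.+1) (s - (k + i).+1%:R).

(** Counterpart of t^(a+1) (1 + t)^k = t^a (1 + t)^(k+1) - t^a (1 + t)^k. The two denominators on
    the right share all factors but s - (k + 1) and s - (k + a + 2), whose difference a + 1
    completes the factorial. *)
Lemma betaCS a k s : (forall i, (i <= a.+1)%N -> s != (k + i).+1%:R) ->
  betaC a.+1 k s = betaC a k.+1 s - betaC a k s.
Proof.
move=> sn0; rewrite /betaC.
pose P := \prod_(i < a) (s - (k.+1 + i).+1%:R).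
have E1 : \prod_(i < a.+1) (s - (k.+1 + i).+1%:R) = P * (s - (k + a.+1).+1%:R).
  by rewrite big_ord_recr/= addSnnS.
have E2 : \prod_(i < a.+1) (s - (k + i).+1%:R) = (s - k.+1%:R) * P.
  rewrite big_ord_recl/= addn0; congr (_ * _); apply: eq_bigr => i _.
  by rewrite /bump/= add1n addSnnS.
have E3 : \prod_(i < a.+2) (s - (k + i).+1%:R) = (s - k.+1%:R) * P * (s - (k + a.+1).+1%:R).
  by rewrite big_ord_recr/= E2.
have P0 : P != 0.
  apply/prodf_neq0 => i _; rewrite subr_eq0 addSnnS; apply: sn0.
  by rewrite ltnS ltnW.
have s1 : s - k.+1%:R != 0 by rewrite subr_eq0 -[k in k.+1]addn0; apply: sn0.
have s2 : s - (k + a.+1).+1%:R != 0 by rewrite subr_eq0; apply: sn0.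
rewrite E1 E2 E3 factS natrM.
have -> : a.+1%:R = (s - k.+1%:R) - (s - (k + a.+1).+1%:R) :> C.
  by rewrite opprB addrC addrA subrK -addSn natrD addrAC subrr add0r.
move: s1 s2 P0; clear; move: (s - k.+1%:R) (s - (k + a.+1).+1%:R) P (_%:R) => u v p w u0 v0 p0.
by field; rewrite p0 u0 v0.
Qed.

(** The value is B(a + 1, s - a - k - 1). Induction on [a], for all [k], ends at a pure complex
    power of 1 + t; the sum a + k controls convergence, so both terms of the difference stay in
    range. *)
Lemma beta_integral (a k : nat) s : (a + k).+1%:R < Re s ->
  cintegrable `]0, +oo[ (fun t => (t ^+ a * (1 + t) ^+ k)%:C * cpowR (1 + t) (- s)) /\
  cint `]0, +oo[ (fun t => (t ^+ a * (1 + t) ^+ k)%:C * cpowR (1 + t) (- s)) = betaC a k s.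
Proof.
have ReN w : Re (- w) = - Re w by case: w.
have neq (n : nat) : n%:R < Re s -> s != n%:R.
  move=> h; apply: contraTneq h => ->.
  rewrite natC.
  by rewrite ltxx.
elim: a k => [|a IH] k sk.
  have e (t : R) : `]0, +oo[%classic t -> cpowR (1 + t) (k%:R%:C - s) =
      (t ^+ 0 * (1 + t) ^+ k)%:C * cpowR (1 + t) (- s).
    rewrite /= in_itv/= andbT => t0.
    by rewrite expr0 mul1r cpowRD cpowR_nat// addr_gt0.
  have k1 : Re (k%:R%:C - s) < -1.
    rewrite (_ : Re _ = k%:R - Re s); last by case: (s).
    by rewrite add0n -natr1 in sk; lra.
  split.
    by apply: eq_cintegrable (cintegrable_cpowR1p k1) => // t /set_mem; exact: e.
  rewrite (@eq_cint _ _ _ (fun t => cpowR (1 + t) (k%:R%:C - s))); last first.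
    by move=> t /set_mem ht; rewrite -e.
  rewrite cint_cpowR1p// /betaC big_ord1 fact0 addn0 div1r -invrN; congr (_^-1).
  by rewrite -natC -natr1; ring.
have sk1 : (a + k.+1).+1%:R < Re s by rewrite addnS -addSn.
have sk2 : (a + k).+1%:R < Re s by apply: lt_trans sk; rewrite ltr_nat.
have [i1 e1] := IH _ sk1; have [i2 e2] := IH _ sk2.
have i2' := cintegrableZ (-1) (measurable_itv _) i2.
have e t : (t ^+ a * (1 + t) ^+ k.+1)%:C * cpowR (1 + t) (- s) +
   (-1) * ((t ^+ a * (1 + t) ^+ k)%:C * cpowR (1 + t) (- s)) =
   (t ^+ a.+1 * (1 + t) ^+ k)%:C * cpowR (1 + t) (- s).
  rewrite mulrA -mulrDl mulN1r; congr (_ * _); apply: complex_eq; rewrite /= ?subr0 ?oppr0 ?addr0// !exprS; ring.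
split.
  by apply: eq_cintegrable (cintegrableD (measurable_itv _) i1 i2') => // t _; exact: e.
under eq_cint do rewrite -e.
rewrite cintD// cintZ// e1 e2 betaCS ?mulN1r// => i ia; apply: neq; apply: le_lt_trans sk.
by rewrite ler_nat addnC ltnS leq_add2r.
Qed.
End BetaIntegrals.

(** * Mellin-Barnes representations *)

Section MellinRepresentation.
Context {R : realType}.
Local Notation mu := (@lebesgue_measure R).
Local Notation C := (R[i]).
Local Notation Re := (@complex.Re R).
Local Notation Im := (@complex.Im R).
Local Notation normc := (@ComplexField.Normc.normc R).
Local Notation "x %:C" := (Complex (x : R) 0) (format "x %:C").
Variable c : R.
Local Notation line := (fun t : R => Complex c t).

(* [h] is the absolutely convergent inverse Mellin transform of [H] along the
   line of real part [c]. *)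
Definition mellin_rep (h : R -> R) (H : C -> C) := exists B : R -> R,
  [/\ mu.-integrable setT (EFin \o B),
      forall t : R, normc (H (line t)) <= B t,
      cmeasurable [set: R] (fun t => H (line t)) &
      forall x : R, 0 < x -> (h x)%:C = ((2 * pi)^-1)%:C *
        cint setT (fun t => H (line t) * cpowR x (line t))].

Let two_pi_neq0 : 2 * pi != 0 :> R.
Proof. exact: (lt0r_neq0 (mulr_gt0 (ltr0Sn R 1) (pi_gt0 R))). Qed.

Let two_piC : (2 * pi)%:C * ((2 * pi)^-1)%:C = 1 :> C.
Proof.
by apply: complex_eq; rewrite ?cReM ?cImM /= mulr0 ?mul0r ?subr0 ?addr0// mulfV.
Qed.

Let mulr_rot (a b e d : C) : a * b * (e * d) = e * (a * (b * d)).
Proof. by rewrite mulrCA -!mulrA. Qed.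

Let RintZ (D : set R) (k : R) (f : R -> R) : measurable D -> mu.-integrable D (EFin \o f) ->
  \int[mu]_(t in D) (k * f t) = k * \int[mu]_(t in D) f t.
Proof. by move=> mD fi; rewrite RintegralZl. Qed.

Lemma cmeasurable_line (x : R) (D : set R) : cmeasurable D (fun t => cpowR x (line t)).
Proof. by apply: cmeasurable_cpowR. Qed.

Lemma integrable_line H (B : R -> R) x :
  mu.-integrable setT (EFin \o B) -> (forall t : R, normc (H (line t)) <= B t) ->
  cmeasurable [set: R] (fun t => H (line t)) ->
  cintegrable setT (fun t => H (line t) * cpowR x (line t)).
Proof.
move=> Bi HB mH; apply: (@cintegrable_le _ _ _ (fun t => expR (c * ln x) * B t)) => //.
- by apply: cmeasurableM => //; exact: cmeasurable_line.
- exact: integrableRZ.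
- by move=> t _; rewrite ComplexField.Normc.normcM normc_cpowR/= mulrC ler_wpM2l// expR_ge0.
Qed.

Lemma mellin_rep_ext h h' H H' : (forall x, 0 < x -> h x = h' x) ->
  (forall t, H (line t) = H' (line t)) -> mellin_rep h H -> mellin_rep h' H'.
Proof.
move=> hh HH [B [Bi HB mH hE]]; exists B; split => //.
- by move=> t; rewrite -HH.
- by rewrite (_ : (fun _ => _) = (fun t => H (line t)))//; apply/funext => t.
- by move=> x x0; rewrite -hh// hE//; congr (_ * _); apply: eq_cint => t _; rewrite HH.
Qed.

Lemma mellin_rep_lin h1 h2 H1 H2 (a b : R) : mellin_rep h1 H1 -> mellin_rep h2 H2 ->
  mellin_rep (fun x => a * h1 x + b * h2 x) (fun s => a%:C * H1 s + b%:C * H2 s).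
Proof.
move=> [B1 [B1i HB1 mH1 hE1]] [B2 [B2i HB2 mH2 hE2]].
exists (fun t => `|a| * B1 t + `|b| * B2 t); split.
- by apply: integrableRD => //; apply: integrableRZ.
- move=> t; apply: le_trans (le_normcD _ _) _; rewrite !ComplexField.Normc.normcM !normcR.
  by apply: lerD; apply: ler_wpM2l.
- have [m1 m2] := cmeasurableM (cmeasurableR (measurable_cst a)) mH1.
  have [n1 n2] := cmeasurableM (cmeasurableR (measurable_cst b)) mH2.
  by split; under eq_fun do rewrite raddfD/=; apply: measurable_funD.
- move=> x x0.
  have i1 := integrable_line x B1i HB1 mH1; have i2 := integrable_line x B2i HB2 mH2.
  rewrite (_ : Complex _ _ = a%:C * (h1 x)%:C + b%:C * (h2 x)%:C); last first.
    by apply: complex_eq => /=; ring.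
  rewrite hE1// hE2//.
  rewrite [in RHS](@eq_cint _ _ _ (fun t => a%:C * (H1 (line t) * cpowR x (line t)) + b%:C * (H2 (line t) * cpowR x (line t)))); last first.
    by move=> t _; rewrite mulrDl !mulrA.
  rewrite cintD//; [|exact: cintegrableZ..].
  by rewrite !cintZ//; ring.
Qed.

(** Fubini: (x / (1 + t))^s = x^s (1 + t)^(-s), so integrating over t first leaves W(s) under the
    line integral. Since |(1 + t)^(-s)| = (1 + t)^(-c) on the line, the weighted integrability of
    [w] gives absolute convergence, and the bound on [W] preserves an integrable majorant. *)
Lemma mellin_rep_conv h H (w : R -> R) (W : C -> C) (M : R) :
  mellin_rep h H -> measurable_fun setT w ->
  mu.-integrable `]0, +oo[ (EFin \o (fun t => `|w t| * expR (- c * ln (1 + t)))) ->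
  cmeasurable [set: R] (fun t => W (line t)) ->
  (forall t, normc (W (line t)) <= M) ->
  (forall u, cint `]0, +oo[ (fun t => (w t)%:C * cpowR (1 + t) (- line u)) = W (line u)) ->
  mellin_rep (fun x => \int[mu]_(t in `]0, +oo[) (w t * h (x / (1 + t)))) (fun s => H s * W s).
Proof.
move=> [B [Bi HB mH hE]] mw wi mW WM WE.
have B0 t : 0 <= B t by apply: le_trans (HB t); exact: normc_ge0.
exists (fun t => M * B t); split.
- exact: integrableRZ.
- move=> t; rewrite ComplexField.Normc.normcM mulrC; apply: ler_pM; rewrite ?normc_ge0//.
- exact: cmeasurableM.
move=> x x0.
pose K (t u : R) := H (line u) * cpowR x (line u) * ((w t)%:C * cpowR (1 + t) (- line u)).
have mK : cmeasurable [set: R * R] (fun z => K z.1 z.2).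
  apply: cmeasurableM; [apply: cmeasurableM|apply: cmeasurableM].
  - have [m1 m2] := mH; split.
      exact: (measurableT_comp m1 measurable_snd).
    exact: (measurableT_comp m2 measurable_snd).
  - by apply: cmeasurable_cpowR => //; exact: measurable_snd.
  - by apply: cmeasurableR; exact: (measurableT_comp mw measurable_fst).
  - apply: (@cmeasurable_cpowR _ _ _ setT (fun z : R * R => 1 + z.1) (fun=> - c) (fun z => - z.2)) => //.
      by apply: measurable_funD => //; exact: measurable_fst.
    by apply: measurableT_comp => //; exact: measurable_snd.
have NK t u : normc (K t u) <= (`|w t| * expR (- c * ln (1 + t))) * (expR (c * ln x) * B u).
  rewrite /K !ComplexField.Normc.normcM !normc_cpowR normcR /= mulrC.
  by rewrite ler_wpM2l ?mulr_ge0 ?expR_ge0// mulrC ler_wpM2l ?expR_ge0.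
have xBi : mu.-integrable setT (EFin \o (fun u => expR (c * ln x) * B u)) by exact: integrableRZ.
have mI : measurable (`]0, +oo[%classic : set R) by exact: measurable_itv.
have [Fri Fr] := Rfubini_dom mI measurableT mK.1 wi xBi
  (fun t u _ _ => le_trans (normc_Re _) (NK t u)).
have [_ Fi] := Rfubini_dom mI measurableT mK.2 wi xBi
  (fun t u _ _ => le_trans (normc_Im _) (NK t u)).
have wci u : cintegrable `]0, +oo[ (fun t => (w t)%:C * cpowR (1 + t) (- line u)).
  apply: (cintegrable_le mI _ wi).
    by apply: cmeasurableM; [apply: cmeasurableR; exact: measurable_funTS|exact: cmeasurable_cpowR1p].
  by move=> t _; rewrite ComplexField.Normc.normcM normc_cpowR normcR.
have K1 u : cint `]0, +oo[ (K ^~ u) = H (line u) * W (line u) * cpowR x (line u).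
  by rewrite mulrAC -WE; exact: (cintZ (H (line u) * cpowR x (line u)) mI (wci u)).
have K2 t : 0 < t -> cint setT (K t) = (w t * (2 * pi * h (x / (1 + t))))%:C.
  move=> t0; have t1 : 0 < 1 + t by rewrite addr_gt0.
  have xt : 0 < x / (1 + t) by rewrite divr_gt0.
  have pi0 := two_pi_neq0.
  rewrite (_ : Complex (w t * _) _ = (w t)%:C * ((2 * pi)%:C * (h (x / (1 + t)))%:C)); last first.
    by apply: complex_eq => /=; ring.
  rewrite (hE _ xt) [(2 * pi)%:C * _]mulrA two_piC mul1r.
  rewrite -(cintZ _ measurableT (integrable_line (x / (1 + t)) Bi HB mH)).
  have tV : 0 < (1 + t)^-1 by rewrite invr_gt0.
  apply: eq_cint => u _; rewrite /K mulr_rot; congr (_ * (_ * _)).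
  by rewrite (cpowRM _ x0 tV) (cpowRV _ t1).
apply: complex_eq; rewrite ?cReM ?cImM /= mul0r ?addr0 ?subr0.
  transitivity ((2 * pi)^-1 * \int[mu]_(t in `]0, +oo[) \int[mu]_u Re (K t u)).
    have p0 := two_pi_neq0.
    have iw : mu.-integrable `]0, +oo[ (EFin \o (fun t => w t * h (x / (1 + t)))).
      apply: (@eq_integrable _ _ _ mu _ mI _ _ _ (integrableRZ (2 * pi)^-1 mI Fri)) => t.
      rewrite inE/= in_itv/= andbT => /K2/(congr1 Re) /= ->.
      by rewrite [w t * _]mulrCA (mulKf p0).
    rewrite (@eq_Rintegral _ _ _ mu _ (fun t => (2 * pi) * (w t * h (x / (1 + t)))) (fun t => \int[mu]_u Re (K t u))); last first.
      by move=> t; rewrite inE/= in_itv/= andbT => /K2/(congr1 Re) /= ->; rewrite mulrCA.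
    by rewrite (RintZ (2 * pi) mI iw) (mulKf p0).
  rewrite Fr; congr (_ * _); apply: eq_Rintegral => u _.
  by have := congr1 Re (K1 u).
have -> : \int[mu]_u Im (H (line u) * W (line u) * cpowR x (line u)) = \int[mu]_u \int[mu]_(t in `]0, +oo[) Im (K t u).
  by apply: eq_Rintegral => u _; have := congr1 Im (K1 u).
(* The representation is a complex identity, so the imaginary part must vanish too: by [K2] the
   inner line integral is real for each t. *)
have e0 : \int[mu]_(t in `]0, +oo[) \int[mu]_u Im (K t u) = 0.
  transitivity (\int[mu]_(t in `]0, +oo[) (0 : R)); last first.
    by rewrite Rintegral_cst ?mul0r//; exact: mI.
  apply: eq_Rintegral => t; rewrite inE/= in_itv/= andbT => t0.
  exact: (congr1 Im (K2 _ t0)).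
by rewrite -Fi e0 mulr0.
Qed.

(** On the line, 2c - s is the complex conjugate of s, so the transform of the kernel is 1 / |s|^2
    there. *)
Lemma mellin_kernel_conj (t : R) : 0 < c ->
  (line t * ((2 * c)%:C - line t))^-1 = ((c ^+ 2 + t ^+ 2)^-1)%:C.
Proof.
move=> c0; have -> : line t * ((2 * c)%:C - line t) = (c ^+ 2 + t ^+ 2)%:C.
  by apply: complex_eq; rewrite ?cReM ?cImM /=; ring.
by have := fmorphV (real_complex R) (c ^+ 2 + t ^+ 2) => /= <-.
Qed.

Lemma integrable_kernel : 0 < c -> mu.-integrable setT (EFin \o (fun t => (c ^+ 2 + t ^+ 2)^-1)).
Proof.
move=> c0; have c2 : 0 < c ^+ 2 by rewrite exprn_gt0.
have p t : 0 < c ^+ 2 + t ^+ 2 by rewrite ltr_pwDl// sqr_ge0.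
apply: (@integrable_le _ _ _ (fun t => (1 + (c ^+ 2)^-1) * (1 + t ^+ 2)^-1)) => //.
- apply: (measurableT_comp (@measurable_invr R)); apply: measurable_funD => //; exact: measurable_funX.
- by apply: integrableRZ => //; exact: integrable_oneDsqrV.
- move=> t _; rewrite gtr0_norm ?invr_gt0// ler_pdivlMr ?ltr_pwDl ?sqr_ge0// mulrC ler_pdivrMr//.
  have -> : (1 + (c ^+ 2)^-1) * (c ^+ 2 + t ^+ 2) = (1 + t ^+ 2) + (c ^+ 2 + (c ^+ 2)^-1 * t ^+ 2).
    by field; rewrite gt_eqF.
  rewrite lerDl; apply: addr_ge0; first exact: sqr_ge0.
  by apply: mulr_ge0; [rewrite invr_ge0; exact: sqr_ge0|exact: sqr_ge0].
Qed.

(** With u = ln x, the factor x^s is x^c (cos(tu) + i sin(tu)). The sine part is odd and integrates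
    to 0; after rescaling t by c, the cosine part is the Poisson integral at c |u|. *)
Lemma mellin_rep_kernel : 0 < c ->
  mellin_rep (fun x => expR (c * ln x - c * `|ln x|) / (2 * c)) (fun s => (s * ((2 * c)%:C - s))^-1).
Proof.
move=> c0; exists (fun t => (c ^+ 2 + t ^+ 2)^-1).
have c2 : 0 < c ^+ 2 by rewrite exprn_gt0.
have p t : 0 < c ^+ 2 + t ^+ 2 by rewrite ltr_pwDl// sqr_ge0.
have mk : measurable_fun [set: R] (fun t : R => (c ^+ 2 + t ^+ 2)^-1).
  by apply: (measurableT_comp (@measurable_invr R)); apply: measurable_funD => //; exact: measurable_funX.
split.
- exact: integrable_kernel.
- by move=> t; rewrite mellin_kernel_conj// normcR gtr0_norm ?invr_gt0.
- by under eq_fun do rewrite mellin_kernel_conj//; exact: cmeasurableR.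
move=> x x0; pose u := ln x.
have mcos : measurable_fun [set: R] (fun t : R => cos (t * u) * (c ^+ 2 + t ^+ 2)^-1).
  apply: measurable_funM => //; apply: continuous_measurable_fun => t.
  by apply: continuous_comp; [exact: mulrr_continuous|exact: continuous_cos].
have msin : measurable_fun [set: R] (fun t : R => sin (t * u) * (c ^+ 2 + t ^+ 2)^-1).
  apply: measurable_funM => //; apply: continuous_measurable_fun => t.
  by apply: continuous_comp; [exact: mulrr_continuous|exact: continuous_sin].
have fE (t : R) : cos (c * t * u) * (c ^+ 2 + (c * t) ^+ 2)^-1 = c ^- 2 * (cos (c * `|u| * t) * (1 + t ^+ 2)^-1).
  have -> : cos (c * `|u| * t) = cos (c * t * u).
    have [u0|u0] := leP 0 u; first by rewrite ger0_norm// mulrAC.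
    by rewrite ltr0_norm// mulrN mulNr cosN mulrAC.
  by rewrite exprMn -[X in X + _]mulr1 -mulrDr invfM mulrCA.
have ib : mu.-integrable setT (EFin \o (fun t => cos (c * `|u| * t) * (1 + t ^+ 2)^-1)).
  apply: (@integrable_le _ _ _ (fun t => (1 + t ^+ 2)^-1)) => //.
  - apply: measurable_funM.
      apply: continuous_measurable_fun => t.
      by apply: continuous_comp; [exact: mulrl_continuous|exact: continuous_cos].
    by apply: continuous_measurable_fun; exact: continuous_oneDsqrV.
  - exact: integrable_oneDsqrV.
  - move=> t _; have q0 : 0 < (1 + t ^+ 2)^-1 by rewrite invr_gt0 ltr_pwDl// sqr_ge0.
    by rewrite normrM (gtr0_norm q0) ler_piMl ?cos_max// ltW.
have icos : \int[mu]_t (cos (t * u) * (c ^+ 2 + t ^+ 2)^-1) = c^-1 * (pi * expR (- (c * `|u|))).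
  rewrite (Rintegral_scale c0 mcos).
    under eq_Rintegral do rewrite fE.
    rewrite RintZ// poisson_integral ?mulr_ge0 ?(ltW c0)// mulrA; congr (_ * _).
    by rewrite -exprVn expr2 mulrA divff ?mul1r// gt_eqF.
  under eq_fun do rewrite fE.
  exact: integrableRZ.
have isin : \int[mu]_t (sin (t * u) * (c ^+ 2 + t ^+ 2)^-1) = 0.
  apply: Rintegral_odd => [|t]; last by rewrite mulNr sinN sqrrN mulNr.
  apply: integrable_le (integrable_kernel c0) _ => // t _.
  by rewrite normrM (gtr0_norm (x := _^-1)) ?invr_gt0// ler_piMl ?sin_max// ltW// invr_gt0.
have il (g : R -> R) : measurable_fun [set: R] g -> (forall t : R, `|g t| <= 1) ->
    mu.-integrable setT (EFin \o (fun t => g t * (c ^+ 2 + t ^+ 2)^-1)).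
  move=> mg g1; apply: integrable_le (integrable_kernel c0) _ => // [|t _].
    exact: measurable_funM.
  by rewrite normrM (gtr0_norm (x := _^-1)) ?invr_gt0// ler_piMl// ltW// invr_gt0.
rewrite (@eq_cint _ _ _ (fun t => ((c ^+ 2 + t ^+ 2)^-1)%:C * cpowR x (line t))); last first.
  by move=> t _; rewrite mellin_kernel_conj.
apply: complex_eq; rewrite ?cReM ?cImM /= mul0r ?addr0 ?subr0.
  transitivity ((2 * pi)^-1 * (expR (c * u) * (c^-1 * (pi * expR (- (c * `|u|)))))).
    have alg (p' E1 E2 : R) : p' != 0 -> E2 != 0 ->
        E1 / E2 / (2 * c) = (2 * p')^-1 * (E1 * (c^-1 * (p' * E2^-1))).
      by move=> p0 e0; field; rewrite p0 e0 gt_eqF.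
    rewrite expRB expRN; apply: alg; first exact: (lt0r_neq0 (pi_gt0 R)).
    by rewrite gt_eqF ?expR_gt0.
  rewrite -icos -RintZ//; last first.
    apply: (il (fun t => cos (t * u))) => [|t]; last exact: cos_max.
    by apply: continuous_measurable_fun => t; apply: continuous_comp; [exact: mulrr_continuous|exact: continuous_cos].
  congr (_ * _); apply: eq_Rintegral => t _.
  by rewrite mul0r subr0 mulrA mulrC.
rewrite (@eq_Rintegral _ _ _ mu _ (fun t => expR (c * u) * (sin (t * u) * (c ^+ 2 + t ^+ 2)^-1))).
  rewrite RintZ//; first by rewrite isin !mulr0.
  apply: (il (fun t => sin (t * u))) => [|t]; last exact: sin_max.
  by apply: continuous_measurable_fun => t; apply: continuous_comp; [exact: mulrr_continuous|exact: continuous_sin].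
by move=> t _; rewrite mul0r addr0 mulrA mulrC.
Qed.
End MellinRepresentation.

(** * The volume integral as a repeated multiplicative convolution *)

Section IteratedIntegral.
Context {R : realType}.
Local Notation mu := (@lebesgue_measure R).
Implicit Types (F w : R -> R) (e : nat) (es : seq nat).

Definition transf (w F : R -> R) (y : R) : R :=
  \int[mu]_(t in `]0, +oo[) (w t * F (y / (1 + t))).

(* The paper's g, with exponents e_k = m + l_k - 1, as an iterated integral. *)
Fixpoint Gint es : R -> R :=
  if es is e :: es' then transf (fun t => t ^+ e) (Gint es') else fun y => (1 <= y)%R%:R.

(** This is (1 + t)^(-2), at least y^(-2) on the range 1 + t <= y that carries the integrands. It
    spares a truncation of the half-line at a point depending on y. *)
Let q (t : R) := expR (- 2 * ln (1 + t)).

Let q_integrable : mu.-integrable `]0, +oo[ (EFin \o q).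
Proof. by apply: integrable_powR1p; rewrite ltrN2 ltr1n. Qed.

Let mI : measurable (`]0, +oo[%classic : set R).
Proof. exact: measurable_itv. Qed.

Let q_ge y t : 0 < t -> 1 + t <= y -> 1 <= y ^+ 2 * q t.
Proof.
move=> t0 ty; have t1 : 0 < 1 + t by rewrite addr_gt0.
rewrite /q mulNr expRN expRM_natl lnK ?posrE// ler_pdivlMr ?exprn_gt0// mul1r.
by rewrite lerXn2r// nnegrE ltW// (lt_le_trans t1).
Qed.

(** [A] bounds the weight and [M] the function on (0, X]. Since the majorant depends on y only
    through [X], it serves both for integrability at a fixed y and for estimates uniform over y <=
    X. *)
Lemma transf_bound w F (X A M y t : R) :
  (forall y, 0 < y -> y < 1 -> F y = 0) ->
  (forall t, 0 < t -> t <= X -> `|w t| <= A) ->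
  (forall y, 0 < y -> y <= X -> `|F y| <= M) ->
  0 < y -> y <= X -> 0 < t ->
  `|w t * F (y / (1 + t))| <= A * M * X ^+ 2 * expR (- 2 * ln (1 + t)).
Proof.
move=> F0 wA FM y0 yX t0; have t1 : 0 < 1 + t by rewrite addr_gt0.
have yt : 0 < y / (1 + t) by rewrite divr_gt0.
have ytX : y / (1 + t) <= X.
  by apply: le_trans yX; rewrite ler_pdivrMr// ler_peMr// ?lerDl ltW.
have M0 : 0 <= M by apply: le_trans (FM _ y0 yX).
have A0 : 0 <= A.
  have [tX|Xt] := leP t X; first by apply: le_trans (wA _ t0 tX).
  by apply: le_trans (wA X (lt_le_trans y0 yX) (lexx _)).
have [ty|yt1] := leP (1 + t) y; last first.
  rewrite F0// ?ltr_pdivrMr ?mul1r// mulr0 normr0 mulr_ge0 ?expR_ge0//.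
  by rewrite mulr_ge0 ?sqr_ge0// mulr_ge0.
have tX : t <= X by apply: le_trans yX; apply: le_trans ty; rewrite lerDr.
have := q_ge t0 (le_trans ty yX); rewrite /q => h.
rewrite normrM -[leRHS]mulrA; apply: (@le_trans _ _ (A * M)).
  by apply: ler_pM => //; [exact: wA|exact: FM].
by rewrite ler_peMr// mulr_ge0.
Qed.

(** The invariant preserved by [transf] with nonnegative weights: monotonicity gives measurability
    and the local bound F(z) <= F(y) for z <= y, and vanishing below 1 confines t to a bounded
    range. *)
Definition nd_pos F := [/\ forall y, 0 < y -> 0 <= F y,
  forall y z, 0 < y -> y <= z -> F y <= F z & forall y, 0 < y -> y < 1 -> F y = 0].

Lemma measurable_div1p F y : nd_pos F -> 0 < y ->
  measurable_fun (`]0, +oo[%classic : set R) (fun t => F (y / (1 + t))).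
Proof.
move=> [_ mF _] y0.
(* Replacing t by max(t, 0) extends the function to a nonincreasing one on the whole line, where
   monotone functions are measurable. *)
have mm : measurable_fun (`]0, +oo[%classic : set R) (fun t : R => F (y / (1 + Num.max t 0))).
  apply: nonincreasing_measurable => // s t st.
  have m1 (u : R) : 0 < 1 + Num.max u 0 by rewrite ltr_pwDl// le_max lexx orbT.
  apply: mF; first by rewrite divr_gt0.
  by rewrite ler_pM2l// lef_pV2 ?posrE// lerD2l ge_max !le_max st lexx orbT.
apply: eq_measurable_fun mm => t; rewrite inE/= in_itv/= andbT => t0.
by rewrite max_l// ltW.
Qed.

Lemma integrable_transf w F y : nd_pos F -> measurable_fun setT w ->
  (forall X, exists A, forall t, 0 < t -> t <= X -> `|w t| <= A) -> 0 < y ->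
  mu.-integrable `]0, +oo[ (EFin \o (fun t => w t * F (y / (1 + t)))).
Proof.
move=> FP mw wb y0; have [A hA] := wb y; have [F0 Fm Fz] := FP.
apply: (integrable_le mI _ (integrableRZ (A * F y * y ^+ 2) mI q_integrable)).
  by apply: measurable_funM; [exact: measurable_funTS|exact: measurable_div1p].
move=> t; rewrite /= in_itv/= andbT => t0.
apply: (@transf_bound w F y A (F y) y t) => // z z0 zy.
by rewrite ger0_norm ?F0// Fm.
Qed.

Lemma exprn_loc_bounded e (X : R) : exists A, forall t : R, 0 < t -> t <= X -> `|t ^+ e| <= A.
Proof.
exists (X ^+ e) => t t0 tX; rewrite ger0_norm; last by rewrite exprn_ge0// ltW.
by apply: lerXn2r => //; rewrite nnegrE ltW// (lt_le_trans t0).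
Qed.

Lemma nd_pos_transf w F : nd_pos F -> measurable_fun setT w ->
  (forall X, exists A, forall t, 0 < t -> t <= X -> `|w t| <= A) ->
  (forall t, 0 < t -> 0 <= w t) -> nd_pos (transf w F).
Proof.
move=> FP mw wb w0; have [F0 Fm Fz] := FP; split.
- move=> y y0; apply: Rintegral_ge0 => t; rewrite /= in_itv/= andbT => t0.
  by rewrite mulr_ge0 ?w0// F0// divr_gt0// addr_gt0.
- move=> y z y0 yz; apply: le_Rintegral => //; [exact: integrable_transf..| |].
    by apply: integrable_transf => //; exact: lt_le_trans yz.
  move=> t; rewrite /= in_itv/= andbT => t0; have t1 : 0 < 1 + t by rewrite addr_gt0.
  by rewrite ler_wpM2l ?w0// Fm ?divr_gt0// ler_pM2r// invr_gt0.
- move=> y y0 y1; rewrite /transf (@eq_Rintegral _ _ _ mu _ (fun=> 0)).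
    by rewrite Rintegral_cst ?mul0r//; exact: mI.
  move=> t; rewrite inE/= in_itv/= andbT => t0; have t1 : 0 < 1 + t by rewrite addr_gt0.
  rewrite Fz ?mulr0 ?divr_gt0// ltr_pdivrMr// mul1r (lt_trans y1)// ltrDl//.
Qed.

Lemma nd_pos_Gint es : nd_pos (Gint es).
Proof.
elim: es => [|e es IH] /=.
  split=> [y _|y z y0 yz|y y0 y1]; first exact: ler0n.
    by rewrite ler_nat; case: (leP 1 y) => // y1; rewrite (le_trans y1 yz).
  by rewrite leNgt y1.
apply: nd_pos_transf => //.
  by move=> X; exact: exprn_loc_bounded.
by move=> t t0; rewrite exprn_ge0// ltW.
Qed.
End IteratedIntegral.

(** * Exchange of the exponential kernel for the indicator *)

Section KernelTransform.
Context {R : realType}.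
Local Notation mu := (@lebesgue_measure R).
Local Notation C := (R[i]).
Local Notation Re := (@complex.Re R).
Local Notation Im := (@complex.Im R).
Local Notation normc := (@ComplexField.Normc.normc R).
Local Notation "x %:C" := (Complex (x : R) 0) (format "x %:C").

Let mI : measurable (`]0, +oo[%classic : set R).
Proof. exact: measurable_itv. Qed.

Lemma is_derive_powR1p (r t : R) : -1 < t ->
  is_derive t 1 (fun t => expR (r * ln (1 + t))) (r * expR ((r - 1) * ln (1 + t))).
Proof.
move=> t1; have [dr _] := is_derive_cpowR1p r%:C t1.
rewrite (_ : (fun t => _) = (fun t => Re (cpowR (1 + t) r%:C))); last first.
  by apply/funext => u; rewrite cpowR_real.
apply: is_derive_eq dr _.
rewrite (_ : r%:C - 1 = (r - 1)%:C); last by apply: complex_eq => /=; rewrite ?subr0.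
by rewrite cpowR_real cReM /= mul0r subr0.
Qed.

Lemma expR_ln_nat (u : R) (n : nat) : 0 < u -> expR (n%:R * ln u) = u ^+ n.
Proof. by move=> u0; rewrite expRM_natl lnK. Qed.

Lemma Rint_powR1p_ay (a r : R) : 0 <= a -> r < -1 ->
  \int[mu]_(t in `[a, +oo[) expR (r * ln (1 + t)) = - (expR ((r + 1) * ln (1 + a)) / (r + 1)).
Proof.
move=> a0 r1; have r10 : r + 1 < 0 by rewrite -ltrBrDr sub0r.
pose F t := (r + 1)^-1 * expR ((r + 1) * ln (1 + t)).
have dF (t : R) : -1 < t -> is_derive t 1 F (expR (r * ln (1 + t))).
  move=> t1; have := is_deriveZ (r + 1)^-1 (is_derive_powR1p (r + 1) t1).
  by rewrite addrK /GRing.scale/= mulrA mulVf ?mul1r ?lt_eqF.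
have a1 : -1 < a by rewrite (lt_le_trans _ a0)// ltrN10.
have cf (t : R) : -1 < t -> {for t, continuous (fun t : R => expR (r * ln (1 + t)))}.
  by move=> t1; exact: is_derive_continuous (is_derive_powR1p r t1).
rewrite (@Rintegral_ge0_continuous_FTC2y R _ F _ 0).
- by rewrite sub0r /F mulrC.
- by move=> t _; exact: expR_ge0.
- apply: continuous_in_subspaceT => t; rewrite inE/= in_itv/= andbT => at_.
  by apply: cf; exact: lt_le_trans at_.
- rewrite -[X in _ --> X](mulr0 (r + 1)^-1); apply: cvgM; [exact: cvg_cst|].
  have := @cvg_cpowR1p_y R (r + 1)%:C r10; apply: cvg_trans; apply: near_eq_cvg.
  by apply: nearW => t; rewrite cpowR_real normcR/= ger0_norm ?expR_ge0.
- by move=> t at_; have [] := dF t (lt_trans a1 at_).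
- by apply: cvg_at_right_filter; exact: is_derive_continuous (dF _ a1).
- move=> t; rewrite in_itv/= andbT => at_; rewrite derive1E.
  by have [_ ->] := dF t (lt_trans a1 at_).
Qed.

Lemma Rint_pow1p_0b (b : R) (k : nat) : 0 <= b ->
  \int[mu]_(t in `[0, b]) (1 + t) ^+ k = ((1 + b) ^+ k.+1 - 1) / k.+1%:R.
Proof.
rewrite le_eqVlt => /predU1P[<-|b0].
  by rewrite set_itv1 Rintegral_set1 addr0 expr1n subrr mul0r.
pose F (t : R) := k.+1%:R^-1 * expR (k.+1%:R * ln (1 + t)).
have dF (t : R) : -1 < t -> is_derive t 1 F ((1 + t) ^+ k).
  move=> t1; have := is_deriveZ k.+1%:R^-1 (is_derive_powR1p k.+1%:R t1).
  rewrite -natr1 addrK expR_ln_nat -?ltrBlDl ?sub0r//.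
  by rewrite /GRing.scale/= mulrA mulVf ?mul1r ?natr1 ?pnatr_eq0.
have N1 (t : R) : 0 <= t -> -1 < t by move=> t0; rewrite (lt_le_trans _ t0)// ltrN10.
rewrite /Rintegral (@continuous_FTC2 R _ F)//=.
- rewrite /F addr0 ln1 mulr0 expR0 expR_ln_nat ?addr_gt0//=.
  by rewrite -mulrBr mulrC.
- apply: (@continuous_subspaceT _ _ _ (fun t : R => (1 + t) ^+ k)) => t.
  apply: (@continuous_comp R R R (fun t => 1 + t) (fun u => u ^+ k) t); last exact: exprn_continuous.
  by apply: cvgD; [exact: cvg_cst|exact: cvg_id].
- split => [t| |].
  + by rewrite in_itv/= => /andP[t0 _]; have [] := dF t (N1 _ (ltW t0)).
  + by apply: cvg_at_right_filter; exact: is_derive_continuous (dF _ (N1 _ (lexx _))).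
  + by apply: cvg_at_left_filter; exact: is_derive_continuous (dF _ (N1 _ (ltW b0))).
- move=> t; rewrite in_itv/= => /andP[t0 _]; rewrite derive1E.
  by have [_ ->] := dF t (N1 _ (ltW t0)).
Qed.

Let Rint0 (D : set R) (g : R -> R) : measurable D -> (forall t, D t -> g t = 0) ->
  \int[mu]_(t in D) g t = 0.
Proof.
move=> mD g0; transitivity (\int[mu]_(t in D) (0 : R)).
  by apply: eq_Rintegral => t /set_mem; exact: g0.
by rewrite Rintegral_cst ?mul0r.
Qed.

Lemma measurable_pow1p (k : nat) (D : set R) : measurable_fun D (fun t : R => (1 + t) ^+ k).
Proof. by apply: measurable_funX; apply: measurable_funD. Qed.

Lemma integrable_bnd (g : R -> R) (b x : R) : measurable_fun setT g ->
  (forall t, 0 < t -> t <= x -> `|g t| <= b) -> mu.-integrable `]0, x] (EFin \o g).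
Proof.
move=> mg gb; apply: (@integrable_le _ _ _ (fun=> b)) => //.
- exact: measurable_funTS.
- have := @finite_measure_integrable_cst; move=> _.
  apply/integrableP; split; first exact/measurable_EFinP.
  rewrite integral_cst//= lebesgue_measure_itv/=.
  by case: ifP => _; rewrite ?mule0 ?ltry// -EFinD -EFinM ltry.
- by move=> t; rewrite /= in_itv/= => /andP[]; exact: gb.
Qed.

Lemma transf_ind0 (w : R -> R) (x : R) : x <= 1 -> transf w (Gint [::]) x = 0.
Proof.
move=> x1; apply: Rint0 => // t; rewrite /= in_itv/= andbT => t0.
have t1 : 0 < 1 + t by rewrite addr_gt0.
by rewrite ler_pdivlMr// mul1r leNgt (le_lt_trans x1) ?mulr0// ltrDl.
Qed.

Lemma transf_ind (w : R -> R) (x : R) : 1 <= x -> measurable_fun setT w ->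
  (forall X, exists A, forall t, 0 < t -> t <= X -> `|w t| <= A) ->
  transf w (Gint [::]) x = \int[mu]_(t in `[0, x - 1]) w t.
Proof.
move=> x1 mw wb; have [A hA] := wb (x - 1).
rewrite -Rintegral_itv_obnd_cbnd; last exact: integrable_bnd mw hA.
have -> : `]0, x - 1]%classic = (`]0, +oo[ `&` `]0, x - 1])%classic :> set R.
  by rewrite setIidr// => t /=; rewrite !in_itv/= => /andP[->].
rewrite Rintegral_mkcondr; apply: eq_Rintegral => t; rewrite inE/= in_itv/= andbT => t0.
have t1 : 0 < 1 + t by rewrite addr_gt0.
rewrite patchE mem_setE in_itv/= t0/= ler_pdivlMr// mul1r lerBrDl.
by case: ifP; rewrite ?mulr1 ?mulr0.
Qed.

Variable c : R.

Let L (x : R) := expR (c * ln x - c * `|ln x|) / (2 * c).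

(* On the transform side this is
   (2c - s) / (s - k - 1) = (2c - k - 1) / (s - k - 1) - 1: it trades the factor
   1 / (s (2c - s)) of the kernel [L] for the 1 / s of the indicator. *)
Lemma kernel_transf (k : nat) (x : R) : k.+1%:R < c -> 0 < x ->
  (2 * c - k.+1%:R) * transf (fun t => (1 + t) ^+ k) L x - L x =
  transf (fun t => (1 + t) ^+ k) (Gint [::]) x.
Proof.
move=> kc x0; have c0 : 0 < c by apply: lt_trans kc; rewrite ltr0n.
have c20 : 0 < 2 * c by rewrite mulr_gt0.
(* L(y) is y^(2c) / (2c) for y <= 1 and the constant 1 / (2c) for y >= 1. Where 1 + t >= x, the
   integrand is thus A (1 + t)^r. *)
pose r := k%:R - 2 * c.
have r1 : r < -1 by rewrite /r ltrBlDr; move: kc c0; rewrite -natr1; lra.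
have e2 : 2 * c - k.+1%:R = - (r + 1) by rewrite /r -natr1; ring.
have r10 : r + 1 != 0 by rewrite lt_eqF// -ltrBrDr sub0r.
have Lle y : 0 < y -> y <= 1 -> L y = expR (2 * c * ln y) / (2 * c).
  move=> y0 y1; rewrite /L ler0_norm ?ln_le0//; congr (expR _ / _); ring.
have Lge y : 1 <= y -> L y = (2 * c)^-1.
  by move=> y1; rewrite /L ger0_norm ?ln_ge0// subrr expR0 mul1r.
pose A := expR (2 * c * ln x) / (2 * c).
have FA t : 0 < t -> (1 + t) ^+ k * (expR (2 * c * ln (x / (1 + t))) / (2 * c)) = A * expR (r * ln (1 + t)).
  move=> t0; have t1 : 0 < 1 + t by rewrite addr_gt0.
  rewrite ln_div ?posrE// -(expR_ln_nat k t1) /A /r mulrA -expRD [RHS]mulrAC -expRD; congr (expR _ / _); ring.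
have iA : mu.-integrable `]0, +oo[ (EFin \o (fun t => A * expR (r * ln (1 + t)))).
  by apply: integrableRZ => //; exact: integrable_powR1p.
have A0 : 0 <= A by rewrite divr_ge0 ?expR_ge0 ?ltW.
(* The formula of the branch y <= 1 dominates [L] everywhere, because -|u| <= u. *)
have iL : mu.-integrable `]0, +oo[ (EFin \o (fun t => (1 + t) ^+ k * L (x / (1 + t)))).
  apply: (integrable_le mI _ iA).
    apply: measurable_funM; first exact: measurable_pow1p.
    apply: measurable_funM => //; apply: measurableT_comp => //.
    have ml : measurable_fun (`]0, +oo[%classic : set R) (fun t => ln (x / (1 + t))).
      apply: (measurableT_comp (@measurable_ln R)); apply: measurable_funM => //.
      by apply: (measurableT_comp (@measurable_invr R)); apply: measurable_funD.
    by apply: measurable_funB; apply: measurable_funM => //; apply: measurableT_comp.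
  move=> t; rewrite /= in_itv/= andbT => t0; have t1 : 0 < 1 + t by rewrite addr_gt0.
  rewrite -FA// ger0_norm; last by rewrite mulr_ge0 ?exprn_ge0 ?(ltW t1)// divr_ge0 ?expR_ge0// ltW.
  rewrite ler_pM2l ?exprn_gt0// ler_pM2r ?invr_gt0// ler_expR.
  set u := ln _; have := ler_norm (- u); rewrite normrN => h.
  rewrite (_ : 2 * c * u = c * u - c * (- u)); last by ring.
  by rewrite lerD2l lerN2 ler_pM2l.
have iP : \int[mu]_(t in `]0, +oo[) expR (r * ln (1 + t)) = - (r + 1)^-1.
  rewrite Rintegral_itv_obnd_cbnd; last exact: integrable_powR1p.
  by rewrite Rint_powR1p_ay// addr0 ln1 mulr0 expR0 div1r.
have [x1|x1] := leP x 1.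
  rewrite transf_ind0// /transf.
  rewrite (@eq_Rintegral _ _ _ mu _ (fun t => A * expR (r * ln (1 + t)))); last first.
    move=> t; rewrite inE/= in_itv/= andbT => t0; have t1 : 0 < 1 + t by rewrite addr_gt0.
    rewrite -FA// Lle//; first by rewrite divr_gt0.
    by rewrite ler_pdivrMr// mul1r (le_trans x1)// lerDl ltW.
  rewrite RintegralZl//; last exact: integrable_powR1p.
  by rewrite iP e2 Lle// -/A mulrCA mulrNN mulfV// mulr1 subrr.
have x10 : 0 <= x - 1 by rewrite subr_ge0 ltW.
have pb X : exists B : R, forall t : R, 0 < t -> t <= X -> `|(1 + t) ^+ k| <= B.
  exists ((1 + X) ^+ k) => t t0 tX; have t1 : 0 < 1 + t by rewrite addr_gt0.
  rewrite ger0_norm; last by rewrite exprn_ge0// ltW.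
  by apply: lerXn2r; rewrite ?nnegrE ?(ltW t1)// ?lerD2l// (le_trans (ltW t1))// lerD2l.
rewrite (@transf_ind (fun t : R => (1 + t) ^+ k) x (ltW x1) (@measurable_pow1p k setT) pb) Rint_pow1p_0b// [1 + (x - 1)]addrC subrK.
(* The cut at t = x - 1 is where x / (1 + t) crosses 1 and [L] changes branch. *)
have hB := @Rintegral_itvB R (fun t => (1 + t) ^+ k * L (x / (1 + t))) (BRight 0) +oo%O (x - 1) iL.
rewrite /transf.
have -> : \int[mu]_(t in `]0, +oo[) ((1 + t) ^+ k * L (x / (1 + t))) =
   \int[mu]_(t in `]0, x - 1]) ((1 + t) ^+ k * L (x / (1 + t))) +
   \int[mu]_(t in `]x - 1, +oo[) ((1 + t) ^+ k * L (x / (1 + t))).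
  by rewrite -hB ?bnd_simp//; ring.
have -> : \int[mu]_(t in `]0, x - 1]) ((1 + t) ^+ k * L (x / (1 + t))) =
    (2 * c)^-1 * ((x ^+ k.+1 - 1) / k.+1%:R).
  have [B hB'] := pb (x - 1).
  have ib := integrable_bnd (@measurable_pow1p k setT) hB'.
  rewrite -[X in _ * ((X ^+ _ - 1) / _)](subrK 1 x) [x - 1 + 1]addrC -Rint_pow1p_0b//.
  rewrite -Rintegral_itv_obnd_cbnd// -RintegralZl//.
  apply: eq_Rintegral => t; rewrite inE/= in_itv/= => /andP[t0 tx].
  have t1 : 0 < 1 + t by rewrite addr_gt0.
  by rewrite [LHS]mulrC Lge// ler_pdivlMr// mul1r -lerBrDl.
have -> : \int[mu]_(t in `]x - 1, +oo[) ((1 + t) ^+ k * L (x / (1 + t))) =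
    - (A * expR ((r + 1) * ln x) / (r + 1)).
  have ip : mu.-integrable `]x - 1, +oo[ (EFin \o (fun t => expR (r * ln (1 + t)))).
    apply: integrableS (integrable_powR1p r1) => // t /=; rewrite !in_itv/= !andbT.
    exact: le_lt_trans.
  rewrite (@eq_Rintegral _ _ _ mu _ (fun t => A * expR (r * ln (1 + t)))); last first.
    move=> t; rewrite inE/= in_itv/= andbT => tx.
    have t0 : 0 < t by exact: le_lt_trans tx.
    have t1 : 0 < 1 + t by rewrite addr_gt0.
    by rewrite -FA// Lle// ?divr_gt0// ler_pdivrMr// mul1r -lerBlDl ltW.
  rewrite RintegralZl// Rintegral_itv_obnd_cbnd// Rint_powR1p_ay// [1 + (x - 1)]addrC subrK.
  by rewrite mulrN mulrA.
have -> : A * expR ((r + 1) * ln x) = x ^+ k.+1 / (2 * c).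
  by rewrite /A mulrAC -expRD -(expR_ln_nat k.+1 x0) /r -natr1; congr (expR _ / _); ring.
rewrite Lge ?ltW// e2.
have -> : r + 1 = k.+1%:R - 2 * c by rewrite -[LHS]opprK -e2 opprB.
have kn0 : k.+1%:R != 0 :> R by rewrite pnatr_eq0.
have rn0 : k.+1%:R - 2 * c != 0 by rewrite -opprB e2 opprK.
move: (k.+1%:R : R) (x ^+ k.+1) kn0 rn0 => kk X kn0 rn0.
by field; rewrite kn0 rn0 gt_eqF.
Qed.
End KernelTransform.

(** * Mellin-Barnes representation of the iterated integral *)

Section MellinGint.
Context {R : realType}.
Local Notation mu := (@lebesgue_measure R).
Local Notation C := (R[i]).
Local Notation Re := (@complex.Re R).
Local Notation Im := (@complex.Im R).
Local Notation normc := (@ComplexField.Normc.normc R).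
Local Notation "x %:C" := (Complex (x : R) 0) (format "x %:C").
Variable c : R.
Local Notation line := (fun t : R => Complex c t).

Definition line_bounded (W : C -> C) := cmeasurable [set: R] (fun t => W (line t)) /\
  exists M, forall t, normc (W (line t)) <= M.

Lemma line_boundedM W V : line_bounded W -> line_bounded V -> line_bounded (fun s => W s * V s).
Proof.
move=> [mW [M WM]] [mV [N VN]]; split; first exact: cmeasurableM.
exists (M * N) => t; rewrite ComplexField.Normc.normcM.
by apply: ler_pM; rewrite ?normc_ge0.
Qed.

Lemma line_bounded_cst z : line_bounded (fun=> z).
Proof. by split; [split; exact: measurable_cst|exists (normc z)]. Qed.

(** On the line |s - j| >= Re (s - j) = c - j. The explicit real and imaginary parts serve for
    measurability. *)
Lemma line_boundedV (j : R) : j < c -> line_bounded (fun s => (s - j%:C)^-1).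
Proof.
move=> jc; have cj : 0 < c - j by rewrite subr_gt0.
have p t : 0 < (c - j) ^+ 2 + t ^+ 2 by rewrite ltr_pwDl ?exprn_gt0// sqr_ge0.
have E t : (line t - j%:C)^-1 =
    Complex ((c - j) * ((c - j) ^+ 2 + t ^+ 2)^-1) (- t * ((c - j) ^+ 2 + t ^+ 2)^-1).
  have -> : line t - j%:C = Complex (c - j) t by apply: complex_eq => /=; ring.
  have n0 : Complex (c - j) t != 0.
    by apply: contraTneq cj => /(congr1 Re)/= ->; rewrite ltxx.
  apply: (mulfI n0); rewrite divff//.
  have pn : (c - j) ^+ 2 + t ^+ 2 != 0 by rewrite gt_eqF.
  by apply: complex_eq; rewrite ?cReM ?cImM /=; field.
have mi : measurable_fun [set: R] (fun t : R => ((c - j) ^+ 2 + t ^+ 2)^-1).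
  by apply: (measurableT_comp (@measurable_invr R)); apply: measurable_funD => //; exact: measurable_funX.
split.
  under [X in cmeasurable _ X]eq_fun do rewrite E.
  by split => /=; apply: measurable_funM => //; exact: measurable_funN.
exists (c - j)^-1 => t; have := normc_Re (line t - j%:C).
have n1 : normc ((line t - j%:C)^-1) * normc (line t - j%:C) = 1.
  rewrite -ComplexField.Normc.normcM mulVf; last first.
    by apply: contraTneq cj => /(congr1 Re)/=; rewrite ?oppr0 ?subr0 => ->; rewrite ltxx.
  by rewrite -[RHS](@normr1 R) -(normcR 1).
have -> : Re (line t - j%:C) = c - j by [].
rewrite gtr0_norm// => h.
have nn : 0 < normc (line t - j%:C) by exact: lt_le_trans h.
rewrite -[leLHS](mulfK (lt0r_neq0 nn)) n1 mul1r.
by rewrite lef_pV2// posrE.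
Qed.

Lemma line_bounded_prod n (W : 'I_n -> C -> C) : (forall i, line_bounded (W i)) ->
  line_bounded (fun s => \prod_(i < n) W i s).
Proof.
move=> hW; elim: n W hW => [|n IH] W hW.
  by under [X in line_bounded X]eq_fun do rewrite big_ord0; exact: line_bounded_cst.
under [X in line_bounded X]eq_fun do rewrite big_ord_recl.
by apply: line_boundedM => //; exact: (IH (fun i => W (lift ord0 i))).
Qed.

Lemma line_bounded_betaC a k : (a + k).+1%:R < c -> line_bounded (betaC a k).
Proof.
move=> ac; rewrite /betaC; under [X in line_bounded X]eq_fun do rewrite -prodfV.
apply: line_boundedM; first exact: line_bounded_cst.
apply: line_bounded_prod => i.
under [X in line_bounded X]eq_fun do rewrite natC.
apply: line_boundedV; apply: le_lt_trans ac.
by rewrite ler_nat ltnS addnC leq_add2r -ltnS ltn_ord.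
Qed.

Lemma integrable_beta_weight a k : (a + k).+1%:R < c ->
  mu.-integrable `]0, +oo[ (EFin \o (fun t => `|t ^+ a * (1 + t) ^+ k| * expR (- c * ln (1 + t)))).
Proof.
move=> ac; have r1 : (a + k)%:R - c < -1 by rewrite ltrBlDr addrC -ltrBlDr opprK natr1.
apply: (integrable_le _ _ (integrable_powR1p r1)) => //.
  apply: measurable_funM.
    apply: measurableT_comp => //; apply: measurable_funM; first exact: measurable_funX.
    exact: measurable_pow1p.
  have [+ _] := @cmeasurable_cpowR1p R `]0, +oo[%classic (- c)%:C.
  by apply: eq_measurable_fun => t _; rewrite cpowR_real.
move=> t; rewrite /= in_itv/= andbT => t0; have t1 : 0 < 1 + t by rewrite addr_gt0.
rewrite normrM normr_id (ger0_norm (expR_ge0 _)) mulrDl expRD expR_ln_nat// ler_pM2r ?expR_gt0//.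
rewrite ger0_norm; last by rewrite mulr_ge0 ?exprn_ge0// ltW.
by rewrite exprD ler_pM2r ?exprn_gt0//; apply: lerXn2r; rewrite ?nnegrE ?ltW// ltrDr.
Qed.

Lemma mellin_rep_transf h H a k : (a + k).+1%:R < c -> mellin_rep c h H ->
  mellin_rep c (transf (fun t => t ^+ a * (1 + t) ^+ k) h) (fun s => H s * betaC a k s).
Proof.
move=> ac hH; have [mW [M WM]] := line_bounded_betaC ac.
apply: (mellin_rep_conv hH _ _ mW WM) => [||u].
- by apply: measurable_funM; [exact: measurable_funX|exact: measurable_pow1p].
- exact: integrable_beta_weight.
- by have [] := @beta_integral R a k (line u) ac.
Qed.

(** The only entry point of the indicator: [kernel_transf] writes its convolution as a combination
    of functions already represented, and the matching transform 1 / (s (s - k - 1)) is integrable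
    on the line although 1 / s is not. *)
Lemma mellin_rep_pow1p k : k.+1%:R < c ->
  mellin_rep c (transf (fun t => t ^+ 0 * (1 + t) ^+ k) (Gint [::])) (fun s => s^-1 * betaC 0 k s).
Proof.
move=> kc; have c0 : 0 < c by apply: lt_trans kc; rewrite ltr0n.
have hk := mellin_rep_kernel c0.
have := mellin_rep_lin (2 * c - k.+1%:R) (-1) (mellin_rep_transf (a := 0) kc hk) hk.
apply: mellin_rep_ext => [x x0|t].
  have E F : transf (fun t : R => t ^+ 0 * (1 + t) ^+ k) F = transf (fun t => (1 + t) ^+ k) F.
    by rewrite /transf; under eq_fun do under eq_Rintegral do rewrite expr0 mul1r.
  by rewrite !E -(kernel_transf kc x0) mulN1r.
have sR z (u : R) : Re z != u -> z - u%:C != 0.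
  by apply: contraNneq => /eqP; rewrite subr_eq0 => /eqP ->.
have s0 : line t != 0 by rewrite -[_ t]subr0; apply: sR; rewrite gt_eqF.
have s1 : line t - k.+1%:R != 0 by rewrite natC; apply: sR; rewrite gt_eqF.
have s2 : (2 * c)%:C - line t != 0 by rewrite -opprB oppr_eq0; apply: sR => /=; rewrite lt_eqF// ltr_pMl// ltr1n.
rewrite /betaC big_ord1 addn0 fact0.
rewrite (_ : (2 * c - k.+1%:R)%:C = (2 * c)%:C - k.+1%:R); last by rewrite natC; apply: complex_eq => /=; ring.
rewrite (_ : (-1)%:C = -1 :> C); last by apply: complex_eq => /=; rewrite ?oppr0.
move: (line t) (k.+1%:R : C) (Complex (2 * c) 0) s0 s1 s2 => s z w s0 s1 s2.
by field; rewrite s0 s1 s2.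
Qed.

(** Each step trades one power of t for 1 + t. The larger of the two new values of a + k equals the
    old one, so no room on the line is lost. *)
Lemma mellin_rep_Gint1 a k : (a + k).+1%:R < c ->
  mellin_rep c (transf (fun t => t ^+ a * (1 + t) ^+ k) (Gint [::])) (fun s => s^-1 * betaC a k s).
Proof.
elim: a k => [|a IH] k ac; first exact: mellin_rep_pow1p.
have ac1 : (a + k.+1).+1%:R < c by rewrite addnS -addSn.
have ac2 : (a + k).+1%:R < c by apply: le_lt_trans ac; rewrite ler_nat ltnS leq_add2r.
have := mellin_rep_lin 1 (-1) (IH _ ac1) (IH _ ac2).
apply: mellin_rep_ext => [x x0|t].
  have it b j : mu.-integrable `]0, +oo[ (EFin \o (fun t => t ^+ b * (1 + t) ^+ j * Gint [::] (x / (1 + t)))).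
    apply: (@integrable_transf _ (fun t => t ^+ b * (1 + t) ^+ j)) => //; first exact: nd_pos_Gint.
      by apply: measurable_funM; [exact: measurable_funX|exact: measurable_pow1p].
    move=> X; exists (X ^+ b * (1 + X) ^+ j) => u u0 uX.
    have u1 : 0 < 1 + u by rewrite addr_gt0.
    rewrite ger0_norm; last by rewrite mulr_ge0 ?exprn_ge0// ltW.
    have X0 : 0 <= X by rewrite (le_trans (ltW u0)).
    apply: ler_pM; rewrite ?exprn_ge0 ?(ltW u0) ?(ltW u1)//; apply: lerXn2r; rewrite ?nnegrE ?lerD2l//.
    - exact: ltW.
    - exact: ltW.
    - by rewrite addr_ge0.
  rewrite mul1r mulN1r /transf -(RintegralB _ (it a k.+1) (it a k))//.
  by apply: eq_Rintegral => u _; rewrite -mulrBl exprS [in RHS]exprS; ring.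
rewrite betaCS; last first.
  move=> i ia; apply: contraTneq ac => /(congr1 Re); rewrite natC /= => ->.
  by rewrite -leNgt ler_nat ltnS addnC leq_add2r.
have -> : (1 : R)%:C = 1 by [].
rewrite (_ : (-1)%:C = -1 :> C); last by apply: complex_eq => /=; rewrite ?oppr0.
by rewrite mulrBr mul1r mulN1r.
Qed.

(** The last exponent meets the indicator through [mellin_rep_Gint1]; all earlier ones act on a
    function that already has an absolutely convergent representation. *)
Lemma mellin_rep_Gint e es : all (fun e => e.+1%:R < c) (e :: es) ->
  mellin_rep c (Gint (e :: es)) (fun s => s^-1 * \prod_(j <- e :: es) betaC j 0 s).
Proof.
have E b F : transf (fun t : R => t ^+ b * (1 + t) ^+ 0) F = transf (fun t => t ^+ b) F.
  by rewrite /transf; under eq_fun do under eq_Rintegral do rewrite expr0 mulr1.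
elim: es e => [|e' es IH] e /andP[ec esc].
  under [X in mellin_rep _ _ X]eq_fun do rewrite big_seq1.
  by rewrite /= -E; apply: mellin_rep_Gint1; rewrite addn0.
rewrite (_ : Gint _ = transf (fun t => t ^+ e * (1 + t) ^+ 0) (Gint (e' :: es))); last by rewrite E.
under [X in mellin_rep _ _ X]eq_fun do rewrite big_cons [betaC e 0 _ * _]mulrC mulrA.
by apply: mellin_rep_transf; [rewrite addn0|exact: IH].
Qed.
End MellinGint.

(** * The Gamma function *)

Section GammaFunction.
Context {R : realType}.
Local Notation mu := (@lebesgue_measure R).
Local Notation C := (R[i]).
Local Notation Re := (@complex.Re R).
Local Notation Im := (@complex.Im R).
Local Notation normc := (@ComplexField.Normc.normc R).
Local Notation "x %:C" := (Complex (x : R) 0) (format "x %:C").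

Let mI : measurable (`]0, +oo[%classic : set R).
Proof. exact: measurable_itv. Qed.

Lemma ln_le_subr1 (u : R) : 0 < u -> ln u <= u - 1.
Proof. by move=> u0; rewrite lerBrDl -[leRHS]lnK ?posrE// expR_ge1Dx. Qed.

Lemma cvg_expR_ln_0 (x : R) : 0 < x -> expR (x * ln t) @[t --> 0^'+] --> (0 : R).
Proof.
move=> x0; apply/cvgrPdist_le => e e0; near=> t.
have t0 : 0 < t by near: t; exact: nbhs_right_gt.
rewrite sub0r normrN ger0_norm ?expR_ge0// -[leRHS]lnK ?posrE// ler_expR.
rewrite mulrC -ler_pdivlMr// -ler_expR lnK ?posrE//.
by near: t; apply: nbhs_right_le; rewrite expR_gt0.
Unshelve. all: by end_near. Qed.

Lemma is_derive_expR_ln (x t : R) : 0 < t ->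
  is_derive t 1 (fun t => expR (x * ln t)) (x * expR ((x - 1) * ln t)).
Proof.
move=> t0; have [dr _] := is_derive_cpowR x%:C t0.
rewrite (_ : (fun t => _) = (fun t => Re (cpowR t x%:C))); last first.
  by apply/funext => u; rewrite cpowR_real.
apply: is_derive_eq dr _.
rewrite (_ : x%:C - 1 = (x - 1)%:C); last by apply: complex_eq => /=; rewrite ?subr0.
by rewrite cpowR_real cReM /= mul0r subr0.
Qed.

Lemma expR_lnS (x t : R) : 0 < t -> expR ((x + 1) * ln t) = expR (x * ln t) * t.
Proof. by move=> t0; rewrite mulrDl mul1r expRD lnK. Qed.

(* [x * dominant x] is the derivative of [(t / (1 + t)) ^ x]. *)
Let dominant (x t : R) := expR ((x - 1) * ln t) * expR ((- x - 1) * ln (1 + t)).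

Let integrable_dominant (x : R) : 0 < x -> mu.-integrable `]0, +oo[ (EFin \o dominant x).
Proof.
move=> x0; have N1 (t : R) : 0 < t -> -1 < t by move=> t0; rewrite (lt_trans _ t0)// ltrN10.
pose F t := x^-1 * (expR (x * ln t) * expR (- x * ln (1 + t))).
apply: (@ge0_integrable_FTC_0y _ F _ 0 (x^-1 * 1)).
- by move=> t _; rewrite mulr_ge0 ?expR_ge0.
- move=> t t0; have t1 : 0 < 1 + t by rewrite addr_gt0.
  have := is_deriveZ x^-1 (is_deriveM (is_derive_expR_ln x t0) (is_derive_powR1p (- x) (N1 _ t0))).
  move=> h; apply: is_derive_eq h _; rewrite /GRing.scale/= /dominant.
  have -> : expR (x * ln t) = expR ((x - 1) * ln t) * t by rewrite -expR_lnS// subrK.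
  have -> : expR (- x * ln (1 + t)) = expR ((- x - 1) * ln (1 + t)) * (1 + t).
    by rewrite -expR_lnS// subrK.
  by field; rewrite gt_eqF.
- move=> t t0; apply: cvgM.
    exact: (is_derive_continuous (is_derive_expR_ln (x - 1) t0)).
  exact: (is_derive_continuous (is_derive_powR1p (- x - 1) (N1 _ t0))).
- rewrite -[X in _ --> X](mulr0 x^-1); apply: cvgM; first exact: cvg_cst.
  rewrite -[X in _ --> X](mul0r (expR (- x * ln (1 + 0)))); apply: cvgM; first exact: cvg_expR_ln_0.
  apply: cvg_at_right_filter.
  exact: (is_derive_continuous (is_derive_powR1p (- x) (ltrN10 R))).
apply: cvgM; first exact: cvg_cst.
apply/cvgrPdist_le => e e0; near=> t.
have t0 : 0 < t by near: t; exact: nbhs_pinfty_gt.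
have t1 : 0 < 1 + t by rewrite addr_gt0.
rewrite -expRD mulNr -mulrBr.
have -> : ln t - ln (1 + t) = - ln (1 + t^-1).
  by rewrite -ln_div ?posrE// -lnV ?posrE ?addr_gt0 ?invr_gt0//; congr ln; field; rewrite !gt_eqF// addrC.
have l1 : ln (1 + t^-1) <= t^-1.
  by apply: le_trans (ln_le_subr1 _) _; rewrite ?addr_gt0 ?invr_gt0// addrC addKr.
have l0 : 0 <= ln (1 + t^-1) by rewrite ln_ge0// lerDl invr_ge0 ltW.
rewrite mulrN ger0_norm; last first.
  by rewrite subr_ge0 expR_le1 oppr_le0 mulr_ge0// ltW.
have := expR_ge1Dx (- (x * ln (1 + t^-1))).
have : x * ln (1 + t^-1) <= e.
  apply: (@le_trans _ _ (x * t^-1)); first by rewrite ler_pM2l.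
  have xet : x / e <= t by near: t; apply: nbhs_pinfty_ge; rewrite num_real.
  by rewrite ler_pdivrMr// mulrC -ler_pdivrMr.
lra.
Unshelve. all: by end_near. Qed.

(** In logarithms, p ln((1 + t) / p) <= 1 + t - p <= t, by ln u <= u - 1. With p = Re z + 1 it
    compares the Euler integrand with [dominant]. *)
Lemma expRN_le_powR1p (p t : R) : 1 <= p -> 0 <= t ->
  expR (- t) <= expR (p * ln p) * expR (- p * ln (1 + t)).
Proof.
move=> p1 t0; have p0 : 0 < p by rewrite (lt_le_trans _ p1).
have t1 : 0 < 1 + t by rewrite ltr_pwDl.
rewrite -expRD ler_expR mulNr -mulrBr -opprB mulrN lerN2 -ln_div ?posrE//.
apply: (@le_trans _ _ (p * ((1 + t) / p - 1))).
  by rewrite ler_pM2l// ln_le_subr1// divr_gt0.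
rewrite mulrBr mulrCA divff ?gt_eqF// !mulr1; lra.
Qed.

Definition euler (z : C) (t : R) : C := cpowR t (z - 1) * (expR (- t))%:C.

Lemma normc_euler z t : normc (euler z t) = expR ((Re z - 1) * ln t) * expR (- t).
Proof.
rewrite ComplexField.Normc.normcM normc_cpowR normcR ger0_norm ?expR_ge0//.
by rewrite raddfB.
Qed.

Lemma normc_euler_le z (t : R) : 0 < Re z -> 0 < t ->
  normc (euler z t) <= expR ((Re z + 1) * ln (Re z + 1)) * dominant (Re z) t.
Proof.
move=> z0 t0; rewrite normc_euler /dominant [leRHS]mulrCA ler_pM2l ?expR_gt0//.
by rewrite -opprD; apply: expRN_le_powR1p; rewrite ?lerDr ltW.
Qed.

Lemma cintegrable_euler z : 0 < Re z -> cintegrable `]0, +oo[ (euler z).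
Proof.
move=> z0; apply: (cintegrable_le mI _ (integrableRZ (expR ((Re z + 1) * ln (Re z + 1))) mI (integrable_dominant z0))).
  apply: cmeasurableM.
    by rewrite -(complex_ReIm (z - 1)); apply: cmeasurable_cpowR.
  by apply: cmeasurableR; apply: measurableT_comp.
by move=> t; rewrite /= in_itv/= andbT => t0; exact: normc_euler_le.
Qed.

Lemma CGammaEulerE z : CGammaEuler z = cint `]0, +oo[ (euler z).
Proof. by []. Qed.

(** Integration by parts: z times the integrand at z, minus the integrand at z + 1, is the
    derivative of t^z exp(-t), which vanishes at both ends. *)
Lemma CGammaEulerS z : 0 < Re z -> CGammaEuler (z + 1) = z * CGammaEuler z.
Proof.
move=> z0; have z10 : 0 < Re (z + 1) by rewrite raddfD/= addr_gt0.
have i1 := cintegrable_euler z0; have i2 := cintegrable_euler z10.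
apply/esym/eqP; rewrite -subr_eq0 !CGammaEulerE.
rewrite -cintZ// -mulN1r -cintZ// -cintD//; [|exact: cintegrableZ..].
have eE t : (z * euler z t + -1 * euler (z + 1) t) =
    (z * cpowR t (z - 1) - cpowR t z) * (expR (- t))%:C.
  by rewrite /euler addrK mulN1r mulrA mulrBl.
have RD t (w : C) : Re (w * (expR (- t))%:C) = Re w * expR (- t).
  by rewrite cReM /= mulr0 subr0.
have ID t (w : C) : Im (w * (expR (- t))%:C) = Im w * expR (- t).
  by rewrite cImM /= mulr0 add0r.
have dE (t : R) : is_derive t 1 (fun t : R => expR (- t)) (- expR (- t)).
  by apply: is_derive_eq; rewrite ?scaleN1r ?mulrN1 ?mulN1r.
have d1 (f : R -> R) (df t : R) : is_derive t 1 f df ->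
    is_derive t 1 (fun t => f t * expR (- t)) ((df - f t) * expR (- t)).
  move=> fd; apply: is_derive_eq (is_deriveM fd (dE t)) _.
  by rewrite /GRing.scale/=; ring.
have lim0 (F : set_system R) : Filter F ->
    (fun t => expR (Re z * ln t) * expR (- t)) @ F --> (0 : R) ->
    normc (cpowR t z * (expR (- t))%:C - 0) @[t --> F] --> (0 : R).
  move=> FF; apply: cvg_trans; apply: near_eq_cvg; apply: nearW => t.
  by rewrite subr0 ComplexField.Normc.normcM normc_cpowR normcR ger0_norm ?expR_ge0.
rewrite (@cint_FTC_0y _ (fun t => cpowR t z * (expR (- t))%:C) _ 0 0) ?subrr//.
- by apply: cintegrableD => //; exact: cintegrableZ.
- move=> t t0; have [dr di] := is_derive_cpowR z t0.
  have {}dr := d1 _ _ _ dr; have {}di := d1 _ _ _ di.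
  split.
    under eq_fun do rewrite RD.
    by apply: is_derive_eq dr _; rewrite eE RD raddfB.
  under eq_fun do rewrite ID.
  by apply: is_derive_eq di _; rewrite eE ID raddfB.
- move=> t t0; have [dr di] := is_derive_cpowR z t0.
  have [er ei] := is_derive_cpowR (z - 1) t0.
  have [{}er {}ei] := is_derive_MRe z er ei.
  split.
  rewrite (_ : (fun t : R => Re _) = (fun t => (Re (z * cpowR t (z - 1)) - Re (cpowR t z)) * expR (- t))); last first.
      by apply/funext => v; rewrite eE RD raddfB.
    by apply: cvgM; [apply: cvgB; [exact: (is_derive_continuous er)|exact: (is_derive_continuous dr)]|exact: (is_derive_continuous (dE t))].
  rewrite (_ : (fun t : R => Im _) = (fun t => (Im (z * cpowR t (z - 1)) - Im (cpowR t z)) * expR (- t))); last first.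
      by apply/funext => v; rewrite eE ID raddfB.
    by apply: cvgM; [apply: cvgB; [exact: (is_derive_continuous ei)|exact: (is_derive_continuous di)]|exact: (is_derive_continuous (dE t))].
- apply: lim0; rewrite -[X in _ --> X](mul0r (expR (- 0))); apply: cvgM; first exact: cvg_expR_ln_0.
  by apply: cvg_at_right_filter; apply: is_derive_continuous; exact: dE.
apply: lim0; pose K := expR ((Re z + 1) * ln (Re z + 1)).
have K0 : 0 < K by exact: expR_gt0.
apply/cvgrPdist_le => e e0; near=> t.
have t0 : 0 < t by near: t; exact: nbhs_pinfty_gt.
have t1 : 0 < 1 + t by rewrite addr_gt0.
rewrite sub0r normrN ger0_norm ?mulr_ge0 ?expR_ge0//.
have h : expR (Re z * ln t) * expR (- t) <= K * (1 + t)^-1.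
  apply: (@le_trans _ _ (expR (Re z * ln (1 + t)) * (K * expR (- (Re z + 1) * ln (1 + t))))).
    apply: ler_pM; rewrite ?expR_ge0//.
      by rewrite ler_expR ler_pM2l// ler_ln ?posrE// lerDr.
    by apply: expRN_le_powR1p; rewrite ?lerDr ltW.
  rewrite mulrCA -expRD -mulrDl opprD addrA subrr sub0r mulN1r expRN lnK//.
apply: le_trans h _; rewrite ler_pdivrMr// mulrC -ler_pdivrMr//.
have : K / e <= t by near: t; apply: nbhs_pinfty_ge; rewrite num_real.
lra.
Unshelve. all: by end_near. Qed.

Lemma CGammaEulerD z n : 0 < Re z ->
  CGammaEuler (z + n%:R) = \prod_(i < n) (z + i%:R) * CGammaEuler z.
Proof.
move=> z0; elim: n => [|n IH]; first by rewrite big_ord0 addr0 mul1r.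
rewrite -natr1 addrA CGammaEulerS; last first.
  by rewrite natC /= raddfD/= ltr_wpDr.
by rewrite IH big_ord_recr/= mulrCA mulrA.
Qed.

Let powRE (x t : R) : 0 < t -> t `^ x = expR (x * ln t).
Proof. by move=> t0; rewrite /powR gt_eqF. Qed.

Lemma GammaRE (a : R) :
  GammaR a = \int[mu]_(t in `]0, +oo[) (expR ((a - 1) * ln t) * expR (- t)).
Proof. by apply: eq_Rintegral => t; rewrite inE/= in_itv/= andbT => t0; rewrite powRE. Qed.

Lemma CGammaEulerR (a : R) : CGammaEuler a%:C = (GammaR a)%:C.
Proof.
have E t : cpowR t (a%:C - 1) * (expR (- t))%:C = (expR ((a - 1) * ln t) * expR (- t))%:C.
  rewrite (_ : a%:C - 1 = (a - 1)%:C) ?cpowR_real; first by apply: complex_eq => /=; ring.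
  by apply: complex_eq => /=; ring.
rewrite /CGammaEuler GammaRE; under eq_cint do rewrite E.
apply: complex_eq => //=.
by rewrite Rintegral_cst ?mul0r//; exact: mI.
Qed.

Lemma integrable_GammaR (a : R) : 0 < a ->
  mu.-integrable `]0, +oo[ (EFin \o (fun t => expR ((a - 1) * ln t) * expR (- t))).
Proof.
move=> a0; have [+ _] := @cintegrable_euler a%:C a0.
apply: eq_integrable => // t _; congr (_%:E); rewrite /euler.
rewrite (_ : a%:C - 1 = (a - 1)%:C) ?cpowR_real; first by rewrite cReM /= mul0r subr0.
by apply: complex_eq => /=; ring.
Qed.

Lemma GammaRS (a : R) : 0 < a -> GammaR (a + 1) = a * GammaR a.
Proof.
move=> a0; have := @CGammaEulerS a%:C a0.
rewrite (_ : a%:C + 1 = (a + 1)%:C); last by apply: complex_eq => /=; ring.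
by rewrite !CGammaEulerR => /(congr1 Re); rewrite cReM /= mul0r subr0.
Qed.

Lemma GammaR1 : GammaR (1 : R) = 1.
Proof.
have i1 := integrable_GammaR (@ltr01 R).
have e1 : (fun t : R => expR ((1 - 1) * ln t) * expR (- t)) = (fun t : R => expR (- t)).
  by apply/funext => t; rewrite subrr mul0r expR0 mul1r.
rewrite GammaRE e1 in i1 *.
have dE (t : R) : is_derive t 1 (fun t : R => - expR (- t)) (expR (- t)).
  by apply: is_derive_eq; rewrite ?scaleN1r ?mulrN1 ?mulN1r ?opprK.
rewrite (@Rintegral_FTC_0y _ (fun t => - expR (- t)) _ (- 1) 0) ?sub0r ?opprK//.
- move=> t _; have : is_derive t 1 (fun t : R => expR (- t)) (- expR (- t)).
    by apply: is_derive_eq; rewrite ?scaleN1r ?mulrN1 ?mulN1r.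
  exact: is_derive_continuous.
- have := is_derive_continuous (dE 0); rewrite /continuous_at => h; apply: cvg_at_right_filter.
  by apply: cvg_trans h _; rewrite oppr0 expR0.
rewrite -[X in _ --> X]oppr0; apply: cvgN.
apply/cvgrPdist_le => e e0; near=> t.
rewrite sub0r normrN ger0_norm ?expR_ge0// -[leRHS]lnK ?posrE// ler_expR lerNl.
by near: t; apply: nbhs_pinfty_ge; rewrite num_real.
Unshelve. all: by end_near. Qed.

Lemma GammaR_nat (n : nat) : GammaR n.+1%:R = n`!%:R :> R.
Proof.
elim: n => [|n IH]; first by rewrite GammaR1.
by rewrite -natr1 GammaRS ?ltr0Sn// IH factS natrM.
Qed.
End GammaFunction.

(** * Absence of zeros of Gamma in the right half-plane *)

Section GammaNonvanishing.
Context {R : realType}.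
Local Notation mu := (@lebesgue_measure R).
Local Notation C := (R[i]).
Local Notation Re := (@complex.Re R).
Local Notation Im := (@complex.Im R).
Local Notation normc := (@ComplexField.Normc.normc R).
Local Notation "x %:C" := (Complex (x : R) 0) (format "x %:C").

Let mI : measurable (`]0, +oo[%classic : set R).
Proof. exact: measurable_itv. Qed.

Let W (b t : R) := expR ((b - 1) * ln t) * expR (- t).

Let WS b t : 0 < t -> W (b + 1) t = W b t * t.
Proof.
move=> t0; rewrite /W (_ : b + 1 - 1 = b - 1 + 1); last by ring.
by rewrite (expR_lnS _ t0) [LHS]mulrAC.
Qed.

Let iW b : 0 < b -> mu.-integrable `]0, +oo[ (EFin \o W b).
Proof. exact: integrable_GammaR. Qed.

Let WE b : \int[mu]_(t in `]0, +oo[) W b t = GammaR b.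
Proof. by rewrite GammaRE. Qed.

Let RintZ (k : R) (f : R -> R) : mu.-integrable `]0, +oo[ (EFin \o f) ->
  \int[mu]_(t in `]0, +oo[) (k * f t) = k * \int[mu]_(t in `]0, +oo[) f t.
Proof. by move=> fi; rewrite RintegralZl. Qed.

Let RintD (f g : R -> R) : mu.-integrable `]0, +oo[ (EFin \o f) ->
  mu.-integrable `]0, +oo[ (EFin \o g) ->
  \int[mu]_(t in `]0, +oo[) (f t + g t) =
  \int[mu]_(t in `]0, +oo[) f t + \int[mu]_(t in `]0, +oo[) g t.
Proof. by move=> fi gi; rewrite RintegralD. Qed.

(* [t ^ (b - 1)] is at least [t + (b - 2) * (t - 1)], whose integral against
   [expR (- t)] is [1]. *)
Lemma GammaR_ge1 (b : R) : 2 <= b -> 1 <= GammaR b.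
Proof.
move=> b2; have b0 : 0 < b by rewrite (lt_le_trans _ b2).
have -> : 1 = \int[mu]_(t in `]0, +oo[) ((b - 1) * W 2 t + (2 - b) * W 1 t).
  rewrite RintD; [|by apply: integrableRZ => //; exact: iW..].
  rewrite !RintZ; [|exact: iW..].
  by rewrite !WE (@GammaR_nat R 1) GammaR1 factS fact0 muln1; ring.
rewrite -WE; apply: le_Rintegral => //.
- by apply: integrableRD => //; apply: integrableRZ => //; exact: iW.
- exact: iW.
move=> t; rewrite /= in_itv/= andbT => t0.
have e2 : W 2 t = t * expR (- t) by rewrite /W (_ : 2 - 1 = 1 :> R) ?mul1r ?lnK//; ring.
have e1 : W 1 t = expR (- t) by rewrite /W subrr mul0r expR0 mul1r.
have eb : W b t = expR ((b - 2) * ln t) * t * expR (- t).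
  rewrite /W (_ : b - 1 = b - 2 + 1); last by ring.
  by rewrite (expR_lnS _ t0).
rewrite e1 e2 eb mulrA -mulrDl ler_pM2r ?expR_gt0//.
have l1 : 1 - t^-1 <= ln t.
  by have := @ln_le_subr1 R t^-1; rewrite invr_gt0 lnV ?posrE// => /(_ t0); lra.
have h : 1 + (b - 2) * (1 - t^-1) <= expR ((b - 2) * ln t).
  by apply: le_trans (expR_ge1Dx _); rewrite lerD2l ler_wpM2l// subr_ge0.
apply: (@le_trans _ _ ((1 + (b - 2) * (1 - t^-1)) * t)); last by rewrite ler_pM2r.
by rewrite le_eqVlt; apply/orP; left; apply/eqP; field; rewrite gt_eqF.
Qed.

Lemma GammaR_gt0 (b : R) : 0 < b -> 0 < GammaR b.
Proof.
move=> b0; have : 1 <= GammaR (b + 1 + 1) by apply: GammaR_ge1; lra.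
rewrite !GammaRS ?addr_gt0// => h.
have : 0 < (b + 1) * (b * GammaR b) by rewrite (lt_le_trans _ h).
by rewrite pmulr_rgt0 ?addr_gt0// pmulr_rgt0.
Qed.

(** Moments of the Gamma weight in Horner form: each further power of t multiplies Gamma(b) by the
    next of b, b + 1, b + 2, b + 3. *)
Let GammaR_poly4 (b c0 c1 c2 c3 c4 : R) : 0 < b ->
  let f t := c0 * W b t + (c1 * W (b + 1) t + (c2 * W (b + 1 + 1) t +
    (c3 * W (b + 1 + 1 + 1) t + c4 * W (b + 1 + 1 + 1 + 1) t))) in
  mu.-integrable `]0, +oo[ (EFin \o f) /\
  \int[mu]_(t in `]0, +oo[) f t =
  GammaR b * (c0 + b * (c1 + (b + 1) * (c2 + (b + 2) * (c3 + (b + 3) * c4)))).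
Proof.
move=> b0 f; have b1 : 0 < b + 1 by rewrite addr_gt0.
have b2 : 0 < b + 1 + 1 by rewrite addr_gt0.
have b3 : 0 < b + 1 + 1 + 1 by rewrite addr_gt0.
have b4 : 0 < b + 1 + 1 + 1 + 1 by rewrite addr_gt0.
have iZ k d : 0 < d -> mu.-integrable `]0, +oo[ (EFin \o (fun t => k * W d t)).
  by move=> d0; apply: integrableRZ => //; exact: iW.
have i34 := integrableRD mI (iZ c3 _ b3) (iZ c4 _ b4).
have i234 := integrableRD mI (iZ c2 _ b2) i34.
have i1234 := integrableRD mI (iZ c1 _ b1) i234.
split; first exact: (integrableRD mI (iZ c0 _ b0) i1234).
rewrite /f (RintD (iZ c0 _ b0) i1234) (RintD (iZ c1 _ b1) i234) (RintD (iZ c2 _ b2) i34).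
rewrite (RintD (iZ c3 _ b3) (iZ c4 _ b4)).
rewrite (RintZ _ (iW b0)) (RintZ _ (iW b1)) (RintZ _ (iW b2)) (RintZ _ (iW b3)) (RintZ _ (iW b4)).
rewrite !WE (GammaRS b3) (GammaRS b2) (GammaRS b1) (GammaRS b0); ring.
Qed.

(** Apply ln v <= v - 1 at u or at 1 / u, according to the sign of ln u. For u = t / a, multiplying
    the right side by t^2 gives a polynomial of degree 4 in t, so its integral is explicit. *)
Lemma ln_sqr_le (u : R) : 0 < u -> ln u ^+ 2 <= (u - 1) ^+ 2 + (1 - u^-1) ^+ 2.
Proof.
move=> u0; have uV0 : 0 < u^-1 by rewrite invr_gt0.
have h1 := ln_le_subr1 u0; have := ln_le_subr1 uV0; rewrite lnV ?posrE// => h2.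
have [l0|l0] := leP 0 (ln u).
  apply: (@le_trans _ _ ((u - 1) ^+ 2)); last by rewrite lerDl sqr_ge0.
  by rewrite lerXn2r// nnegrE// (le_trans l0).
apply: (@le_trans _ _ ((1 - u^-1) ^+ 2)); last by rewrite lerDr sqr_ge0.
rewrite -sqrrN -[leRHS]sqrrN opprB lerXn2r// nnegrE ?(le_trans _ h2)// oppr_ge0 ltW//.
Qed.

(* With [u = t / a], [cos v >= 1 - v ^+ 2 / 2] and [ln_sqr_le] bound the
   integrand below by a polynomial of degree 4 against [t ^ (b - 1) * expR (- t)]. *)
Lemma Re_euler_ge (b y h a : R) : 0 < b -> h = y ^+ 2 / 2 -> a = b + 2 ->
  GammaR b * (- h * a ^+ 2 + b * (2 * h * a + (b + 1) * (1 - 2 * h + (b + 2) * (2 * h / a + (b + 3) * (- h / a ^+ 2))))) <=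
  Re (cpowR a (Complex 0 (- y)) * CGammaEuler (Complex a y)).
Proof.
move=> b0 hE aE; have a0 : 0 < a by rewrite aE addr_gt0.
have [fi <-] := GammaR_poly4 (- h * a ^+ 2) (2 * h * a) (1 - 2 * h) (2 * h / a) (- h / a ^+ 2) b0.
have iE := @cintegrable_euler R (Complex a y) a0.
rewrite CGammaEulerE -(cintZ _ mI iE).
refine (@le_Rintegral _ _ _ mu _ _ _ mI fi (cintegrableZ (cpowR a (Complex 0 (- y))) mI iE).1 _) => t tD; cbv beta.
have {tD}t0 : 0 < t by move: tD; rewrite /= in_itv/= andbT.
rewrite (WS (b + 1 + 1 + 1) t0) (WS (b + 1 + 1) t0) (WS (b + 1) t0) (WS b t0).
(* The factor a^(-iy) recentres the phase at t = a, and a = b + 2 leaves the t^2 that clears the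
   denominator of (1 - 1/u)^2. *)
have -> : Re (cpowR a (Complex 0 (- y)) * euler (Complex a y) t) =
    W b t * t ^+ 2 * cos (y * ln (t / a)).
  rewrite /euler mulrA cReM /= mulr0 !subr0.
  have -> : cos (y * ln (t / a)) = cos (- y * ln a) * cos (y * ln t) - sin (- y * ln a) * sin (y * ln t).
    by rewrite -cosD ln_div ?posrE//; congr cos; ring.
  have -> : W b t * t ^+ 2 = expR ((a - 1) * ln t) * expR (- t).
    rewrite (_ : a - 1 = b + 1 + 1 - 1); last by rewrite aE; ring.
    by rewrite -/(W (b + 1 + 1) t) (WS (b + 1) t0) (WS b t0) expr2 mulrA.
  by rewrite /cpowR /= mul0r expR0 !mul1r; ring.
have W0 : 0 < W b t by rewrite mulr_gt0 ?expR_gt0.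
set u := t / a; have u0 : 0 < u by rewrite divr_gt0.
have c1 := onem_cos_le (y * ln u).
have c2 : (y * ln u) ^+ 2 / 2 <= h * ((u - 1) ^+ 2 + (1 - u^-1) ^+ 2).
  rewrite exprMn mulrAC -hE ler_wpM2l ?ln_sqr_le//.
  by rewrite hE divr_ge0 ?sqr_ge0.
have c3 : 1 - h * ((u - 1) ^+ 2 + (1 - u^-1) ^+ 2) <= cos (y * ln u) by lra.
apply: (@le_trans _ _ (W b t * t ^+ 2 * (1 - h * ((u - 1) ^+ 2 + (1 - u^-1) ^+ 2)))).
  rewrite le_eqVlt; apply/orP; left; apply/eqP; rewrite /u.
  by move: (W b t) => w; field; rewrite !gt_eqF.
by rewrite ler_wpM2l// mulr_ge0 ?sqr_ge0// ltW.
Qed.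

(* A zero at [z] propagates to all [z + n], which [Re_euler_ge] excludes for
   large [n]. *)
Lemma CGammaEuler_neq0 z : 0 < Re z -> CGammaEuler z != 0.
Proof.
move=> z0; apply/eqP => Gz; set y := Im z; pose h := y ^+ 2 / 2.
have h0 : 0 <= h by rewrite divr_ge0 ?sqr_ge0.
(* For b >= 4, h (2b + 4) <= 3hb, which is below b (b + 1) once b > 3h; hence the threshold 3h + 4.
   The extra 2 compensates the shift in b = Re z + n - 2. *)
pose n := (Num.truncn (3 * h + 4 + 2)).+1.
pose b := Re z + n%:R - 2.
have bh : 3 * h + 4 < b.
  by rewrite /b; have := truncnS_gt (3 * h + 4 + 2); rewrite -/n; lra.
have b0 : 0 < b by lra.
have := Re_euler_ge b0 (erefl h) (erefl (b + 2)).
have -> : Complex (b + 2) y = z + n%:R.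
  by rewrite natC; apply: complex_eq; rewrite raddfD /= ?addr0// subrK.
rewrite (CGammaEulerD n z0) Gz !mulr0.
apply/negP; rewrite -ltNge pmulr_rgt0 ?GammaR_gt0//.
have b2 : 0 < b + 2 by rewrite addr_gt0.
have -> : - h * (b + 2) ^+ 2 + b * (2 * h * (b + 2) + (b + 1) * (1 - 2 * h + (b + 2) * (2 * h / (b + 2) + (b + 3) * (- h / (b + 2) ^+ 2)))) =
   (b + 1) * b - h * (2 * b + 4) + h * (b / (b + 2)).
  have alg (h' b' : R) : b' + 2 != 0 -> - h' * (b' + 2) ^+ 2 + b' * (2 * h' * (b' + 2) + (b' + 1) * (1 - 2 * h' + (b' + 2) * (2 * h' / (b' + 2) + (b' + 3) * (- h' / (b' + 2) ^+ 2)))) =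
      (b' + 1) * b' - h' * (2 * b' + 4) + h' * (b' / (b' + 2)) by move=> ?; field.
  by apply: alg; rewrite gt_eqF.
apply: ltr_wpDr; first by rewrite mulr_ge0// divr_ge0// ltW.
rewrite subr_gt0; apply: (@le_lt_trans _ _ (3 * h * b)).
  rewrite -mulrA mulrCA ler_wpM2l//; lra.
by rewrite ltr_pM2r//; lra.
Qed.
End GammaNonvanishing.

(** * Gamma quotients as rational functions *)

Section MeijerG.
Context {R : realType}.
Local Notation mu := (@lebesgue_measure R).
Local Notation C := (R[i]).
Local Notation Re := (@complex.Re R).
Local Notation "x %:C" := (Complex (x : R) 0) (format "x %:C").

Lemma CGammaE (z : C) : 0 < Re z -> CGamma z = CGammaEuler z.
Proof.
move=> z0; rewrite /CGamma z0 big_ord0 divr1; congr CGammaEuler.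
by apply: complex_eq; rewrite raddfD/= ?addr0.
Qed.

(** The functional equation is applied [a] times starting from s - a, which lists the factors in
    reverse order; the cancellation uses that Gamma(s - a) is nonzero. *)
Lemma CGamma_ratio (s : C) (a : nat) : a%:R < Re s ->
  CGamma (s - a%:R) / CGamma s = (\prod_(i < a) (s - i.+1%:R))^-1.
Proof.
move=> as_; have r0 : 0 < Re (s - a%:R) by rewrite natC raddfB/= subr_gt0.
have s0 : 0 < Re s by rewrite (le_lt_trans _ as_).
rewrite !CGammaE// -{2}[s](subrK a%:R) CGammaEulerD//.
have n0 := CGammaEuler_neq0 r0.
rewrite (reindex_inj rev_ord_inj)/= invfM mulrCA divff// mulr1; congr (_^-1).
apply: eq_bigr => i _; rewrite natrB ?ltn_ord//; ring.
Qed.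

(** Each Gamma(s - a_k) pairs with one of the K denominators Gamma(s), and the remaining Gamma(s) /
    Gamma(1 + s) is 1 / s. *)
Lemma meijer_integrand (K : nat) (a : 'I_K -> nat) (s : C) : 0 < Re s ->
  (forall k, (a k)%:R < Re s) ->
  CGamma s * \prod_(k < K) CGamma (s - (a k)%:R) / (CGamma s ^+ K * CGamma (1 + s)) =
  s^-1 * \prod_(k < K) (\prod_(i < a k) (s - i.+1%:R))^-1.
Proof.
move=> s0 as_; have sn : s != 0 by apply: contraTneq s0 => ->; rewrite ltxx.
have gn : CGamma s != 0 by rewrite CGammaE// CGammaEuler_neq0.
under [in RHS]eq_bigr do rewrite -CGamma_ratio//.
rewrite [in RHS]big_split/= prodr_const card_ord exprVn.
rewrite [1 + s]addrC [CGamma (s + 1)]CGammaE ?raddfD/= ?addr_gt0// CGammaEulerS// -CGammaE//.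
have gKn : CGamma s ^+ K != 0 by rewrite expf_neq0.
move: (CGamma s) (CGamma s ^+ K) (\prod_(k < K) _) gn gKn sn => g gK p gn gKn sn.
by field; rewrite gn gKn sn.
Qed.
End MeijerG.

(** * The Meijer representation *)

Section MeijerRepresentation.
Context {R : realType}.
Local Notation mu := (@lebesgue_measure R).
Local Notation C := (R[i]).
Local Notation Re := (@complex.Re R).
Local Notation "x %:C" := (Complex (x : R) 0) (format "x %:C").

(** [q] accumulates the factors 1 + t_j of the outer variables and [A] their powers. With both kept
    general, the joint constraint turns into the recursion at x / q. *)
Lemma iint_Gint (K : nat) (e : 'I_K -> nat) (x q A : R) : 0 < x -> 0 < q ->
  iint K (fun t => ((q * \prod_(k < K) (1 + nth (0%R : R) t k) <= x)%R%:R *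
     (A * \prod_(k < K) nth (0%R : R) t k ^+ e k))%:E) =
  (A * Gint [seq e k | k <- enum 'I_K] (x / q))%:E.
Proof.
move=> x0; elim: K e q A => [|K IH] e q A q0.
  rewrite /= !big_ord0 !mulr1 (_ : enum 'I_0 = [::]); last by apply: size0nil; rewrite size_enum_ord.
  by rewrite /= ler_pdivlMr// mul1r mulrC.
rewrite enum_ordSl/= -map_comp.
set es := [seq _ | _ <- _].
have mI0 : measurable (`[0, +oo[%classic : set R) by exact: measurable_itv.
have xq : 0 < x / q by rewrite divr_gt0.
have FE (t : R) : 0 <= t -> iint K (fun s =>
    ((q * \prod_(k < K.+1) (1 + nth (0%R : R) (t :: s) k) <= x)%R%:R *
     (A * \prod_(k < K.+1) nth (0%R : R) (t :: s) k ^+ e k))%:E) =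
    (A * (t ^+ e ord0 * Gint es (x / q / (1 + t))))%:E.
  move=> t0; have t1 : 0 < 1 + t by rewrite ltr_pwDl.
  have -> : x / q / (1 + t) = x / (q * (1 + t)) by rewrite invfM mulrA.
  rewrite mulrA -(IH (fun k => e (lift ord0 k)) (q * (1 + t)) (A * t ^+ e ord0)) ?mulr_gt0//.
  congr (iint K); apply/funext => s.
  by rewrite !big_ord_recl/= !mulrA.
transitivity (\int[mu]_(t in `[0%R, +oo[) (A * (t ^+ e ord0 * Gint es (x / q / (1 + t))))%:E)%E.
  by apply: eq_integral => t; rewrite inE/= in_itv/= andbT => /FE.
have it : mu.-integrable `]0, +oo[ (EFin \o (fun t => t ^+ e ord0 * Gint es (x / q / (1 + t)))).
  apply: (@integrable_transf _ (fun t => t ^+ e ord0)) => //; first exact: nd_pos_Gint.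
  exact: exprn_loc_bounded.
have mI : measurable (`]0, +oo[%classic : set R) by exact: measurable_itv.
have itA := integrableRZ A mI it.
(* [iint] integrates over the closed half-line and [transf] over the open one; they differ by the
   null point 0. *)
rewrite -(integral_itv_obnd_cbnd (f := fun t : R => (A * (t ^+ e ord0 * Gint es (x / q / (1 + t))))%:E)); last first.
  by have /integrableP[] := itA.
by rewrite -(EFin_Rintegral mI itA) RintegralZl.
Qed.

Lemma g_funE (K m : nat) (l : 'I_K -> nat) (x : R) : 0 < x ->
  g_fun m l x = Gint [seq (m + l k - 1)%N | k <- enum 'I_K] x.
Proof.
move=> x0; have := iint_Gint (fun k => (m + l k - 1)%N) 1 x0 ltr01.
rewrite divr1 mul1r /g_fun => h; rewrite -[RHS]/(fine (_%:E)) -h; congr (fine (iint K _)); apply/funext => t.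
by rewrite !mul1r.
Qed.

Lemma realC_prod (K : nat) (f : 'I_K -> R) : (\prod_(k < K) f k)%:C = \prod_(k < K) (f k)%:C.
Proof. exact: (rmorph_prod (real_complex R)). Qed.

(** The factorials (m + l_k - 1)! in the Beta integrals are the prefactors Gamma(m + l_k). The
    condition on [c] puts every Gamma argument in the open right half-plane, where [CGamma] is the
    Euler integral. *)
Lemma g_fun_meijerG (K m : nat) (l : 'I_K -> nat) (x c : R) : (0 < K)%N -> (0 < m)%N ->
  0 < x -> (forall k, (m + l k)%:R < c) ->
  (g_fun m l x)%:C = (\prod_(k < K) GammaR (m + l k)%:R)%:C *
     meijerG 0 K.+1 (1 :: [seq (1 + (l k + m)%:R) | k <- enum 'I_K]) (nseq K 1 ++ [:: 0]) c x.
Proof.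
move=> K0 m0 x0 hc; rewrite g_funE//.
have aS k : (m + l k - 1).+1 = (m + l k)%N by rewrite subn1 prednK// addn_gt0 m0.
have c0 : 0 < c by apply: le_lt_trans (hc (Ordinal K0)); exact: ler0n.
set es := [seq _ | _ <- enum 'I_K]; set G := \prod_(k < K) _.
have rep : mellin_rep c (Gint es) (fun s => s^-1 * \prod_(j <- es) betaC j 0 s).
  have : size es = K by rewrite size_map size_enum_ord.
  have : all (fun e => e.+1%:R < c) es by apply/allP => e /mapP[k _ ->]; rewrite aS.
  by case: (es) => [_ /esym K00|e es' h _]; [rewrite K00 in K0|exact: mellin_rep_Gint].
have [B [iB HB mH hE]] := rep; rewrite hE// => {hE}.
have iH := @integrable_line R c (fun s => s^-1 * \prod_(j <- es) betaC j 0 s) B x iB HB mH.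
pose Phi (s : C) := s^-1 * \prod_(k < K) (\prod_(i < m + l k) (s - i.+1%:R))^-1.
have HE s : s^-1 * \prod_(j <- es) betaC j 0 s = G%:C * Phi s.
  rewrite /Phi mulrCA; congr (_ * _); rewrite /es big_map big_enum/= realC_prod -big_split/=.
  apply: eq_bigr => k _; rewrite /betaC natC -aS GammaR_nat; congr (_ * _^-1).
    by rewrite !aS.
  by rewrite !aS.
have Gn0 : G%:C != 0.
  suff : G != 0 by apply: contra => /eqP/(congr1 Re)/= ->.
  by rewrite prodf_seq_neq0; apply/allP => k _; rewrite -aS GammaR_nat pnatr_eq0 -lt0n fact_gt0.
have iP : cintegrable setT (fun t => Phi (Complex c t) * cpowR x (Complex c t)).
  apply: eq_cintegrable (cintegrableZ (G%:C)^-1 measurableT iH) => // t _.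
  by rewrite HE -!mulrA mulKf.
have -> : cint setT (fun t => (Complex c t)^-1 * \prod_(j <- es) betaC j 0 (Complex c t) * cpowR x (Complex c t)) =
    G%:C * cint setT (fun t => Phi (Complex c t) * cpowR x (Complex c t)).
  rewrite -(cintZ _ measurableT iP); apply: eq_cint => t _.
  by rewrite HE -mulrA.
rewrite /meijerG mulrCA; congr (_ * (_ * _)); apply: eq_cint => t _; congr (_ * _).
have C1 : Complex (1 : R) 0 = 1 by [].
set L := [seq 1 + (l k + m)%:R | k <- enum 'I_K].
have sa : size (1 :: L) = K.+1 by rewrite /= size_map size_enum_ord.
have nthL (k : 'I_K) : nth 0 L k = 1 + (l k + m)%:R.
  by rewrite /L (nth_map k) ?size_enum_ord// nth_ord_enum.
have sb : size (nseq K (1 : R) ++ [:: 0]) = K.+1 by rewrite size_cat size_nseq addn1.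
have num s : \prod_(j < K.+1) CGamma (1 - Complex (nth 0 (1 :: L) j) 0 + s) =
    CGamma s * \prod_(k < K) CGamma (s - (m + l k)%:R).
  rewrite big_ord_recl; congr (CGamma _ * _); first by rewrite [nth _ _ _]/(1 : R) C1 subrr add0r.
  apply: eq_bigr => k _; congr CGamma.
  rewrite (_ : nth 0 (1 :: L) (lift ord0 k) = 1 + (l k + m)%:R); last exact: nthL.
  rewrite natC [(m + l k)%N]addnC.
  rewrite (_ : Complex (1 + _) 0 = 1 + (l k + m)%:R%:C); last by apply: complex_eq => /=; rewrite ?addr0.
  by rewrite opprD addrA subrr add0r addrC.
have den s : \prod_(0 <= j < K.+1) CGamma (1 - Complex (nth 0 (nseq K (1 : R) ++ [:: 0]) j) 0 + s) =
    CGamma s ^+ K * CGamma (1 + s).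
  rewrite big_mkord big_ord_recr; congr (_ * CGamma _); last first.
    by rewrite nth_cat size_nseq ltnn subnn [nth _ _ _]/(0 : R) subr0.
  rewrite -[in RHS](card_ord K) -prodr_const; apply: eq_bigr => k _; congr CGamma.
  rewrite (_ : nth 0 _ _ = 1); last by rewrite nth_cat size_nseq /= ltn_ord nth_nseq ltn_ord.
  by rewrite C1 subrr add0r.
rewrite sa sb num den (big_geq (leqnn K.+1)) big_ord0 mul1r mulr1.
by rewrite /Phi -meijer_integrand.
Qed.
End MeijerRepresentation.

(** * Law of the product *)

Section ProductLaw.
Context {R : realType}.
Local Notation mu := (@lebesgue_measure R).

Fixpoint Jint (fs : seq (R -> R)) : R -> R :=
  if fs is f :: fs' then transf f (Jint fs') else fun y => (1 <= y)%R%:R.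

Definition loc_bounded_pos (f : R -> R) := [/\ measurable_fun setT f,
  forall X, exists A, forall t, 0 < t -> t <= X -> `|f t| <= A &
  forall t, 0 < t -> 0 <= f t].

Lemma nd_pos_Jint (fs : seq (R -> R)) : (forall f, f \in fs -> loc_bounded_pos f) ->
  nd_pos (Jint fs).
Proof.
elim: fs => [_|f fs IH h] /=; first exact: (nd_pos_Gint [::]).
have [mf fb f0] := h f (mem_head _ _).
by apply: nd_pos_transf => //; apply: IH => g gfs; apply: h; rewrite inE gfs orbT.
Qed.

Let mulp (z : R * R) : R := (1 + z.1) * z.2.

Let measurable_mulp : measurable_fun setT mulp.
Proof.
by apply: measurable_funM; [apply: measurable_funD; [exact: measurable_cst|exact: measurable_fst]|exact: measurable_snd].
Qed.

Let mulp_mfun : {mfun (R * R)%type >-> R} :=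
  HB.pack mulp (isMeasurableFun.Build _ _ _ _ mulp measurable_mulp).

(** Given A, the normalised law of (Y, V) agrees with the product measure on rectangles, hence
    everywhere. The case P(A) = 0 is treated apart, since normalising divides by P(A). *)
Lemma product_measure_rect d (T : measurableType d) (P : probability T R)
    (m1 m2 : probability R R) (Y V : T -> R) (A : set T) (E : set (R * R)) :
  measurable A -> measurable_fun setT Y -> measurable_fun setT V ->
  (forall B D, measurable B -> measurable D ->
    P (A `&` (Y @^-1` B `&` V @^-1` D)) = (P A * (m1 B * m2 D))%E) ->
  measurable E ->
  P (A `&` (fun w => (Y w, V w)) @^-1` E) = (P A * (m1 \x^ m2)%E E)%E.
Proof.
move=> mA mY mV h mE.
have mYV : measurable_fun setT (fun w => (Y w, V w)) by exact: measurable_fun_pair.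
have mpre (E' : set (R * R)) : measurable E' -> measurable ((fun w => (Y w, V w)) @^-1` E').
  by move=> mE'; rewrite -[X in measurable X]setTI; exact: mYV.
have [A0|A0] := eqVneq (P A) 0%E.
  rewrite A0 mul0e; apply/eqP; rewrite eq_le measure_ge0 andbT -A0.
  by apply: le_measure; rewrite ?inE//; apply: measurableI => //; exact: mpre.
have Af : P A \is a fin_num by exact: fin_num_measure.
have pA : 0 < fine (P A).
  by rewrite fine_gt0// lt_neqAle eq_sym A0 measure_ge0/= -ge0_fin_numE.
unshelve epose (m' := pushforward (mrestr P mA) (fun w => (Y w, V w)) : {measure set (R * R) -> \bar R}).
  exact: mYV.
have iA : 0 <= (fine (P A))^-1 by rewrite invr_ge0 ltW.
pose m'' := mscale (NngNum iA) m' : {measure set (R * R) -> \bar R}.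
have m''E E' : m'' E' = ((fine (P A))^-1%:E * P (A `&` (fun w => (Y w, V w)) @^-1` E'))%E.
  by rewrite /m'' /mscale /= /pushforward /mrestr setIC.
have u1 := @product_measure_unique _ _ _ _ _ m1 m2 m''.
(* Uniqueness also identifies the product measure [\x] with [\x^], the version computed by sections
   at a fixed second coordinate, which [cdf_mulp] unfolds. *)
have u2 := @product_measure_unique _ _ _ _ _ m1 m2 (product_measure2 m1 m2).
rewrite -u2//; last by move=> B D mB mD; exact: product_measure2E.
rewrite u1//; last first.
  move=> B D mB mD; rewrite m''E.
  rewrite (_ : _ @^-1` _ = Y @^-1` B `&` V @^-1` D)//.
  by rewrite h// -{2}(fineK Af) muleA -EFinM mulVf ?mul1e// gt_eqF.
have pV : (P A * (fine (P A))^-1%:E = 1)%E by rewrite -{1}(fineK Af) -EFinM divff// gt_eqF.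
by rewrite m''E muleA pV mul1e.
Qed.

(** For fixed t > 0, (1 + t) v <= y means v <= y / (1 + t). The measure [\x^] integrates the first
    coordinate innermost, where the density of [m1] can be inserted; Tonelli then exchanges the
    order. *)
Lemma cdf_mulp (m1 m2 : probability R R) (f J : R -> R) (y : R) :
  loc_bounded_pos f -> (forall t, t <= 0 -> f t = 0) -> nd_pos J ->
  (forall B, measurable B -> m1 B = \int[mu]_(r in B) (f r)%:E)%E ->
  (forall y, 0 < y -> m2 [set v | v <= y] = (J y)%:E) -> 0 < y ->
  (m1 \x^ m2)%E (mulp @^-1` [set v | v <= y]) = (transf f J y)%:E.
Proof.
move=> [mf fb f0] fz Jp m1E m2E y0.
have f_ge0 t : 0 <= f t by have [/fz ->//|/f0] := leP t 0.
have my : measurable [set v : R | v <= y].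
  by rewrite (_ : [set v | _] = `]-oo, y]%classic)//; apply/seteqP; split => v /=; rewrite in_itv.
have mE : measurable (mulp @^-1` [set v | v <= y]).
  by rewrite -[X in measurable X]setTI; exact: measurable_mulp.
pose h (z : R * R) : \bar R := (f z.1 * (\1_(mulp @^-1` [set v | v <= y]) z))%:E.
have mh : measurable_fun setT h.
  apply/measurable_EFinP; apply: measurable_funM.
    exact: (measurableT_comp mf measurable_fst).
  exact: measurable_indic.
have h0 z : (0 <= h z)%E by rewrite lee_fin mulr_ge0.
transitivity (\int[m2]_v \int[mu]_t h (t, v))%E.
  apply: eq_integral => v _; rewrite /= m1E; last exact: measurable_ysection.
  rewrite integral_mkcond; apply: eq_integral => t _.
  rewrite patchE /h indicE /=.
  have -> : (t \in ysection (mulp @^-1` [set v0 | v0 <= y]) v) = ((t, v) \in mulp @^-1` [set v0 | v0 <= y]).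
    exact: mem_ysection.
  by case: ifP => _; rewrite ?mulr1 ?mulr0.
transitivity (\int[mu]_t \int[m2]_v h (t, v))%E.
  exact/esym/(@fubini_tonelli _ _ _ _ _ mu m2 h mh h0).
rewrite /transf.
have mI : measurable (`]0, +oo[%classic : set R) by exact: measurable_itv.
rewrite EFin_Rintegral//; last exact: integrable_transf.
rewrite [in RHS]integral_mkcond; apply: eq_integral => t _; rewrite patchE mem_setE in_itv/= andbT.
case: ifPn => [t0|]; last first.
  by rewrite -leNgt => /fz ft; apply: integral0_eq => v _; rewrite /h ft mul0r.
have t1 : 0 < 1 + t by rewrite addr_gt0.
have sE : [set v | v <= y / (1 + t)] = (fun v => mulp (t, v)) @^-1` [set v | v <= y].
  by apply/seteqP; split => v /=; rewrite /mulp/= ler_pdivlMr// mulrC.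
have ms : measurable [set v : R | v <= y / (1 + t)].
  by rewrite (_ : [set v | _] = `]-oo, y / (1 + t)]%classic)//; apply/seteqP; split => v /=; rewrite in_itv.
transitivity (\int[m2]_v ((f t)%:E * (\1_[set v | (v <= y / (1 + t))%R] v)%:E))%E.
  by apply: eq_integral => v _; rewrite /h EFinM sE !indicE.
rewrite ge0_integralZl//; last 2 first.
- by apply/measurable_EFinP; exact: measurable_indic.
- by rewrite lee_fin.
transitivity ((f t)%:E * m2 [set v | (v <= y / (1 + t))%R])%E.
  by rewrite integral_indic// setIT.
by rewrite m2E ?divr_gt0.
Qed.

(* The event [A] lets the induction condition on the first factor. *)
Lemma prod_law (K : nat) (m1 : 'I_K -> probability R R) (f : 'I_K -> R -> R) :
  (forall k, loc_bounded_pos (f k)) -> (forall k t, t <= 0 -> f k t = 0) ->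
  (forall k B, measurable B -> m1 k B = \int[mu]_(r in B) (f k r)%:E)%E ->
  exists rho : probability R R,
  (forall y, 0 < y -> rho [set v | v <= y] = (Jint [seq f k | k <- enum 'I_K] y)%:E) /\
  (forall d (T : measurableType d) (P : probability T R) (X : 'I_K -> T -> R) (A : set T),
    measurable A -> (forall k, measurable_fun setT (X k)) ->
    (forall B : 'I_K -> set R, (forall k, measurable (B k)) ->
      P (A `&` \bigcap_(k in [set: 'I_K]) (X k @^-1` B k)) = (P A * \prod_(k < K) m1 k (B k))%E) ->
    forall D, measurable D ->
      P (A `&` (fun w => \prod_(k < K) (1 + X k w)) @^-1` D) = (P A * rho D)%E).
Proof.
elim: K m1 f => [|K IH] m1 f fd fz m1E.
  (* An empty product is constantly 1, and the Dirac mass at 1 has the indicator of y >= 1 as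
     distribution function. *)
  exists \d_(1 : R); split => [y y0|d T P X A mA mX _ D mD].
    rewrite (_ : enum 'I_0 = [::]); last by apply: size0nil; rewrite size_enum_ord.
    by rewrite /= diracE; congr ((nat_of_bool _)%:R%:E); apply/idP/idP => [/set_mem|/mem_set].
  rewrite [X in (_ * X)%E](_ : _ = ((1 \in D)%:R)%:E); last exact: diracE.
  have [D1|D1] := boolP (1 \in D).
    rewrite mule1; congr (P _); apply/seteqP; split => [w []//|w Aw]; split => //=.
    by rewrite big_ord0; exact/set_mem.
  rewrite mule0 (_ : _ `&` _ = set0) ?measure0//; apply/seteqP; split => // w [_] /=.
  by rewrite big_ord0; move/mem_set; rewrite (negbTE D1).
(* [rho'] is fixed before the probability space and the event, so one law serves every intersection
   of [A] with an event on the first factor. *)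
have [rho' [rhoJ rhoP]] := IH (fun k => m1 (lift ord0 k)) (fun k => f (lift ord0 k))
  (fun k => fd _) (fun k => fz _) (fun k => @m1E _).
exists (distribution (product_measure2 (m1 ord0) rho') mulp_mfun); split => [y y0|d T P X A mA mX h D mD].
  rewrite enum_ordSl /= -map_comp.
  have Jp : nd_pos (Jint [seq f (lift ord0 k) | k <- enum 'I_K]).
    by apply: nd_pos_Jint => g /mapP[k _ ->]; exact: fd.
  exact: (cdf_mulp (fd ord0) (fz ord0) Jp (m1E ord0) rhoJ y0).
have prodT : (\prod_(k < K) m1 (lift ord0 k) setT = 1)%E.
  by apply: big1 => k _; exact: probability_setT.
have hC (C : set R) (B : 'I_K -> set R) : measurable C -> (forall k, measurable (B k)) ->
    P (A `&` X ord0 @^-1` C `&` \bigcap_(k in [set: 'I_K]) (X (lift ord0 k) @^-1` B k)) =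
    (P A * (m1 ord0 C * \prod_(k < K) m1 (lift ord0 k) (B k)))%E.
  move=> mC mB.
  pose B' (k : 'I_K.+1) := if unlift ord0 k is Some j then B j else C.
  have mB' k : measurable (B' k) by rewrite /B'; case: unliftP.
  have B'0 : B' ord0 = C by rewrite /B' unlift_none.
  have B'S k : B' (lift ord0 k) = B k by rewrite /B' liftK.
  have := h B' mB'; rewrite big_ord_recl B'0.
  under eq_bigr do rewrite B'S.
  move=> <-; congr (P _); rewrite -setIA; congr (_ `&` _).
  apply/seteqP; split => w /=.
    move=> [Cw Bw] k _; case: (unliftP ord0 k) => [j ->|->]; rewrite ?B'S ?B'0//; exact: Bw.
  move=> Bw; split; first by have := Bw ord0 Logic.I; rewrite B'0.
  by move=> k _; have := Bw (lift ord0 k) Logic.I; rewrite B'S.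
have hC0 (C : set R) : measurable C -> P (A `&` X ord0 @^-1` C) = (P A * m1 ord0 C)%E.
  move=> mC; have := hC C (fun=> setT) mC (fun=> measurableT).
  by rewrite prodT mule1 => <-; congr (P _); apply/seteqP; split => [w []|w []].
have mXC k (C : set R) : measurable C -> measurable (X k @^-1` C).
  by move=> mC; rewrite -[Y in measurable Y]setTI; exact: mX.
pose V w := \prod_(k < K) (1 + X (lift ord0 k) w).
have mV : measurable_fun setT V.
  by apply: measurable_prod => k _; apply: measurable_funD.
have -> : (fun w => \prod_(k < K.+1) (1 + X k w)) @^-1` D =
    (fun w => (X ord0 w, V w)) @^-1` (mulp @^-1` D).
  by apply/seteqP; split => w /=; rewrite big_ord_recl.
apply: product_measure_rect => //; last first.
  by rewrite -[Y in measurable Y]setTI; exact: measurable_mulp.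
move=> C D' mC mD'; rewrite setIA.
have mAC : measurable (A `&` X ord0 @^-1` C) by apply: measurableI => //; exact: mXC.
rewrite (rhoP _ _ P (fun k => X (lift ord0 k)) _ mAC)//.
  by rewrite hC0// muleA.
by move=> B mB; rewrite hC// hC0// muleA.
Qed.
End ProductLaw.

(** * Series expansion *)

Section ExpansionOfJint.
Context {R : realType}.
Local Notation mu := (@lebesgue_measure R).

Let mI : measurable (`]0, +oo[%classic : set R).
Proof. exact: measurable_itv. Qed.

Lemma integrableR_sum (I : Type) (s : seq I) (D : set R) (f : I -> R -> R) : measurable D ->
  (forall i, mu.-integrable D (EFin \o f i)) ->
  mu.-integrable D (EFin \o (fun t => \sum_(i <- s) f i t)) /\
  \int[mu]_(t in D) (\sum_(i <- s) f i t) = \sum_(i <- s) \int[mu]_(t in D) f i t.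
Proof.
move=> mD fi; elim: s => [|i s [IHi IHe]].
  rewrite big_nil; under eq_fun do rewrite big_nil.
  split; last by rewrite Rintegral_cst ?mul0r.
  exact: integrable0.
rewrite big_cons (_ : (fun t => _) = (fun t => f i t + \sum_(j <- s) f j t)); last first.
  by apply/funext => t; rewrite big_cons.
by split; [exact: integrableRD|rewrite RintegralD// IHe].
Qed.

Definition expsum (c : R) (N : nat) (t : R) := \sum_(i < N.+1) ((i`!%:R)^-1 * c ^+ i * t ^+ i).

Lemma expsumE c N t : expsum c N t = series (exp_coeff (c * t)) N.+1.
Proof.
rewrite /series/= big_mkord; apply: eq_bigr => i _.
by rewrite /exp_coeff /= exprMn -mulrA mulrC.
Qed.

Lemma measurable_expsum c N : measurable_fun setT (expsum c N).
Proof. by apply: measurable_sum => i; apply: measurable_funM => //; exact: measurable_funX. Qed.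

Lemma expsum_cvg c t : expsum c N t @[N --> \oo] --> expR (c * t).
Proof.
rewrite (_ : (fun N => _) = [sequence series (exp_coeff (c * t)) n.+1]_n); last first.
  by apply/funext => N; exact: expsumE.
by rewrite (cvg_shiftS (series (exp_coeff (c * t)))); exact: is_cvg_series_exp_coeff.
Qed.

(** The bound is uniform in [N]: absolute values give a partial sum of the increasing series of
    exp(|c| t). *)
Lemma expsum_le c N t : 0 <= t -> `|expsum c N t| <= expR (`|c| * t).
Proof.
move=> t0; apply: (@le_trans _ _ (expsum `|c| N t)).
  apply: le_trans (ler_norm_sum _ _ _) _; apply: ler_sum => i _.
  by rewrite !normrM !normrX normfV normr_nat (ger0_norm t0).
rewrite expsumE; apply: nondecreasing_cvgn_le; last exact: is_cvg_series_exp_coeff.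
apply/nondecreasing_seqP => n; rewrite seriesEord/= big_ord_recr/= lerDl.
by rewrite mulr_ge0 ?invr_ge0// exprn_ge0// mulr_ge0.
Qed.

Definition ffun_cons (K : nat) (I : finType) (p : I * {ffun 'I_K -> I}) : {ffun 'I_K.+1 -> I} :=
  [ffun k => if unlift ord0 k is Some j then p.2 j else p.1].

Lemma ffun_consE (K : nat) (I : finType) (p : I * {ffun 'I_K -> I}) :
  ffun_cons p ord0 = p.1 /\ forall j, ffun_cons p (lift ord0 j) = p.2 j.
Proof. by split=> [|j]; rewrite ffunE ?unlift_none ?liftK. Qed.

Lemma sum_ffunS (K : nat) (I : finType) (F : {ffun 'I_K.+1 -> I} -> R) :
  \sum_n F n = \sum_i \sum_n F (ffun_cons (i, n)).
Proof.
rewrite pair_big/= (reindex (@ffun_cons K I)); last first.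
  exists (fun n : {ffun 'I_K.+1 -> I} => (n ord0, [ffun j => n (lift ord0 j)])) => [[i n] _|n _].
    have [e0 eS] := ffun_consE (i, n).
    by rewrite e0; congr (_, _); apply/ffunP => j; rewrite ffunE eS.
  apply/ffunP => k; rewrite ffunE; case: unliftP => [j ->|->]//.
  by rewrite /= ffunE.
by apply: eq_bigr => -[i n] _.
Qed.

(** The multiple series cut to the cube {0, ..., N}^K. With the same cutoff in every index, the sum
    over the first index separates, as in [partial_expansionS]. *)
Definition partial_expansion (K : nat) (e : 'I_K -> nat) (c : 'I_K -> R) (N : nat) (y : R) :=
  \sum_(n : {ffun 'I_K -> 'I_N.+1})
    (\prod_(k < K) (((n k)`!)%:R^-1 * c k ^+ n k) *
     Gint [seq (e k + n k)%N | k <- enum 'I_K] y).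

Lemma integrable_transf_exp e (es : seq nat) (y : R) : 0 < y ->
  mu.-integrable `]0, +oo[ (EFin \o (fun t => t ^+ e * Gint es (y / (1 + t)))).
Proof.
move=> y0; apply: (@integrable_transf _ (fun t => t ^+ e)) => //; first exact: nd_pos_Gint.
exact: exprn_loc_bounded.
Qed.

Lemma partial_expansionS (K : nat) (e : 'I_K.+1 -> nat) (c : 'I_K.+1 -> R) N y : 0 < y ->
  partial_expansion e c N y = \int[mu]_(t in `]0, +oo[) (t ^+ e ord0 * expsum (c ord0) N t *
    partial_expansion (fun k : 'I_K => e (lift ord0 k)) (fun k : 'I_K => c (lift ord0 k)) N (y / (1 + t))).
Proof.
move=> y0; rewrite /partial_expansion sum_ffunS.
pose a (i : 'I_N.+1) := (i`!%:R)^-1 * c ord0 ^+ i.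
pose b (n : {ffun 'I_K -> 'I_N.+1}) := \prod_(k < K) (((n k)`!)%:R^-1 * c (lift ord0 k) ^+ n k).
pose es (n : {ffun 'I_K -> 'I_N.+1}) := [seq (e (lift ord0 k) + n k)%N | k <- enum 'I_K].
pose g i n t := a i * b n * (t ^+ (e ord0 + i) * Gint (es n) (y / (1 + t))).
have ig i n : mu.-integrable `]0, +oo[ (EFin \o g i n).
  by apply: integrableRZ => //; exact: integrable_transf_exp.
transitivity (\sum_(i < N.+1) \sum_n \int[mu]_(t in `]0, +oo[) g i n t).
  apply: eq_bigr => i _; apply: eq_bigr => n _.
  have [e0 eS] := ffun_consE (i, n).
  rewrite enum_ordSl /= -map_comp big_ord_recl e0.
  rewrite (eq_bigr (fun k => ((n k)`!)%:R^-1 * c (lift ord0 k) ^+ n k)); last by move=> k _; rewrite eS.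
  rewrite (@eq_map _ _ _ (fun k => (e (lift ord0 k) + n k)%N)); last by move=> k; rewrite /= eS.
  by rewrite /g RintegralZl//; exact: integrable_transf_exp.
transitivity (\sum_(i < N.+1) \int[mu]_(t in `]0, +oo[) \sum_n g i n t).
  by apply: eq_bigr => i _; rewrite (integrableR_sum _ mI (ig i)).2.
rewrite -(integrableR_sum _ mI (fun i => (integrableR_sum _ mI (ig i)).1)).2.
apply: eq_Rintegral => t _.
rewrite /expsum -mulrA mulr_suml mulr_sumr; apply: eq_bigr => i _.
rewrite !mulr_sumr; apply: eq_bigr => n _.
by rewrite /g -/(b n) -/(es n) exprD /a; ring.
Qed.

Lemma partial_expansion_measurable (K : nat) (e : 'I_K -> nat) (c : 'I_K -> R) N y : 0 < y ->
  measurable_fun (`]0, +oo[%classic : set R) (fun t => partial_expansion e c N (y / (1 + t))).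
Proof.
move=> y0; apply: measurable_sum => n; apply: measurable_funM => //.
by apply: measurable_div1p => //; exact: nd_pos_Gint.
Qed.

Lemma partial_expansion_lt1 (K : nat) (e : 'I_K -> nat) (c : 'I_K -> R) N y :
  0 < y -> y < 1 -> partial_expansion e c N y = 0.
Proof.
move=> y0 y1; apply: big1 => n _.
by have [_ _ ->] := @nd_pos_Gint R [seq (e k + n k)%N | k <- enum 'I_K]; rewrite ?mulr0.
Qed.

Lemma exp_weight_bound (e : nat) (c : R) N (X t : R) : 0 < t -> t <= X ->
  `|t ^+ e * expsum c N t| <= X ^+ e * expR (`|c| * X).
Proof.
move=> t0 tX; rewrite normrM; apply: ler_pM => //.
  rewrite ger0_norm; last by rewrite exprn_ge0// ltW.
  by apply: lerXn2r => //; rewrite nnegrE ltW// (lt_le_trans t0).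
apply: le_trans (expsum_le _ _ (ltW t0)) _.
by rewrite ler_expR ler_wpM2l.
Qed.

(** Uniformity in [N] is the point: [expsum_le] bounds the weights by a full exponential, and the
    majorant of [transf_bound] involves neither [N] nor y. The resulting [M] feeds the dominated
    convergence below. *)
Lemma partial_expansion_bound (K : nat) (e : 'I_K -> nat) (c : 'I_K -> R) (X : R) :
  exists M, forall N y, 0 < y -> y <= X -> `|partial_expansion e c N y| <= M.
Proof.
elim: K e c => [|K IH] e c.
  exists 1 => N y y0 yX; rewrite /partial_expansion (big_pred1 [ffun k : 'I_0 => (ord0 : 'I_N.+1)]).
    rewrite big_ord0 mul1r (_ : enum 'I_0 = [::]) /=; last by apply: size0nil; rewrite size_enum_ord.
    by case: (1 <= y); rewrite ?normr1 ?normr0.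
  by move=> n /=; apply/esym/eqP/ffunP => -[].
have [M MP] := IH (fun k : 'I_K => e (lift ord0 k)) (fun k : 'I_K => c (lift ord0 k)).
pose A := X ^+ e ord0 * expR (`|c ord0| * X).
have q_int : mu.-integrable `]0, +oo[ (EFin \o (fun t : R => expR (- 2 * ln (1 + t)))).
  by apply: integrable_powR1p; rewrite ltrN2 ltr1n.
exists (\int[mu]_(t in `]0, +oo[) (A * M * X ^+ 2 * expR (- 2 * ln (1 + t)))) => N y y0 yX.
rewrite partial_expansionS//.
have h t : 0 < t -> `|t ^+ e ord0 * expsum (c ord0) N t *
    partial_expansion (fun k : 'I_K => e (lift ord0 k)) (fun k : 'I_K => c (lift ord0 k)) N (y / (1 + t))| <=
    A * M * X ^+ 2 * expR (- 2 * ln (1 + t)).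
  move=> t0; apply: (@transf_bound _ (fun t => t ^+ e ord0 * expsum (c ord0) N t)
    (partial_expansion (fun k : 'I_K => e (lift ord0 k)) (fun k : 'I_K => c (lift ord0 k)) N) X A M y t) => //.
  - by move=> z z0 z1; exact: partial_expansion_lt1.
  - by move=> u u0 uX; exact: exp_weight_bound.
  - by move=> z z0 zX; exact: MP.
have ib := integrableRZ (A * M * X ^+ 2) mI q_int.
have mes := measurable_expsum (c ord0) N.
have ii : mu.-integrable `]0, +oo[ (EFin \o (fun t => t ^+ e ord0 * expsum (c ord0) N t *
    partial_expansion (fun k : 'I_K => e (lift ord0 k)) (fun k : 'I_K => c (lift ord0 k)) N (y / (1 + t)))).
  apply: (integrable_le mI _ ib).
    apply: measurable_funM; last exact: partial_expansion_measurable.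
    by apply: measurable_funM; [exact: measurable_funX|exact: measurable_funTS].
  by move=> t; rewrite /= in_itv/= andbT; exact: h.
refine (le_trans (@le_normr_Rintegral _ _ R mu _ _ mI ii) _).
apply: le_Rintegral => //.
  by apply: integrable_norm.
by move=> t; rewrite /= in_itv/= andbT; exact: h.
Qed.

(** Dominated convergence in the outermost variable. The inner expansion converges at y / (1 + t) by
    induction, which is why y is generalised. *)
Lemma partial_expansion_cvg (K : nat) (e : 'I_K -> nat) (c : 'I_K -> R) (y : R) : 0 < y ->
  partial_expansion e c N y @[N --> \oo] -->
  Jint [seq (fun t => t ^+ e k * expR (c k * t)) | k <- enum 'I_K] y.
Proof.
elim: K e c y => [|K IH] e c y y0.
  rewrite (_ : enum 'I_0 = [::]) /=; last by apply: size0nil; rewrite size_enum_ord.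
  rewrite (_ : (fun N => _) = (fun=> (1 <= y)%R%:R)); first exact: cvg_cst.
  apply/funext => N; rewrite /partial_expansion (big_pred1 [ffun k : 'I_0 => (ord0 : 'I_N.+1)]).
    by rewrite big_ord0 mul1r (_ : enum 'I_0 = [::]) //=; apply: size0nil; rewrite size_enum_ord.
  by move=> n /=; apply/esym/eqP/ffunP => -[].
pose e' k := e (lift ord0 k); pose c' k := c (lift ord0 k).
have [M MP] := partial_expansion_bound e' c' y.
pose A := y ^+ e ord0 * expR (`|c ord0| * y).
under eq_fun do rewrite partial_expansionS//.
rewrite enum_ordSl /= -map_comp.
have q_int : mu.-integrable `]0, +oo[ (EFin \o (fun t : R => expR (- 2 * ln (1 + t)))).
  by apply: integrable_powR1p; rewrite ltrN2 ltr1n.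
apply: (proj2 (@Rdominated_cvg _ _ _ _ (fun t => A * M * y ^+ 2 * expR (- 2 * ln (1 + t))) mI _ _ _ _)).
- move=> N; apply: measurable_funM; last exact: partial_expansion_measurable.
  apply: measurable_funM; first exact: measurable_funX.
  by apply: measurable_funTS; exact: measurable_expsum.
- move=> t; rewrite /= in_itv/= andbT => t0.
  apply: cvgM; last by apply: IH; rewrite divr_gt0// addr_gt0.
  by apply: cvgM; [exact: cvg_cst|exact: expsum_cvg].
- exact: integrableRZ.
move=> N t; rewrite /= in_itv/= andbT => t0.
apply: (@transf_bound _ (fun t => t ^+ e ord0 * expsum (c ord0) N t)
    (partial_expansion e' c' N) y A M y t) => //.
- by move=> z z0 z1; exact: partial_expansion_lt1.
- by move=> u u0 uX; exact: exp_weight_bound.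
- by move=> z z0 zX; exact: MP.
Qed.

(** Used to extract the normalising constants of the Gamma densities. Agreement is required only for
    t > 0, because [gamma_pdf] is cut off at 0 and t^e exp(ct) is not. *)
Lemma Jint_scale (K : nat) (f h : 'I_K -> R -> R) (a : 'I_K -> R) (y : R) :
  (forall k, loc_bounded_pos (h k)) -> (forall k t, 0 < t -> f k t = a k * h k t) -> 0 < y ->
  Jint [seq f k | k <- enum 'I_K] y = \prod_(k < K) a k * Jint [seq h k | k <- enum 'I_K] y.
Proof.
elim: K f h a y => [|K IH] f h a y hb fE y0.
  by rewrite big_ord0 mul1r (_ : enum 'I_0 = [::]) //=; apply: size0nil; rewrite size_enum_ord.
have E (u : 'I_K.+1 -> R -> R) :
    [seq u k | k <- enum 'I_K.+1] = u ord0 :: [seq u (lift ord0 k) | k <- enum 'I_K].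
  by rewrite enum_ordSl /= -map_comp.
rewrite !E big_ord_recl /=.
have [mh bh h0] := hb ord0.
have nd : nd_pos (Jint [seq h (lift ord0 k) | k <- enum 'I_K]).
  by apply: nd_pos_Jint => g /mapP[k _ ->].
rewrite /transf -RintegralZl//; last exact: (integrable_transf nd mh bh y0).
apply: eq_Rintegral => t; rewrite inE/= in_itv/= andbT => t0.
rewrite fE// (IH _ (fun k => h (lift ord0 k)) (fun k => a (lift ord0 k)))//; last 2 first.
- by move=> k u u0; exact: fE.
- by rewrite divr_gt0// addr_gt0.
by rewrite /=; ring.
Qed.
End ExpansionOfJint.

(** * Gamma densities of integer shape *)

Section GammaDensity.
Context {R : realType}.

Lemma loc_bounded_exp_weight (e : nat) (c : R) : loc_bounded_pos (fun t => t ^+ e * expR (c * t)).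
Proof.
split.
- apply: measurable_funM; first exact: measurable_funX.
  by apply: measurableT_comp => //; apply: measurable_funM.
- move=> X; exists (X ^+ e * expR (`|c| * X)) => t t0 tX.
  rewrite normrM (ger0_norm (expR_ge0 _)); apply: ler_pM => //.
    rewrite ger0_norm; last by rewrite exprn_ge0// ltW.
    by apply: lerXn2r => //; rewrite nnegrE ltW// (lt_le_trans t0).
  rewrite ler_expR (le_trans (ler_norm _))// normrM (gtr0_norm t0).
  by rewrite ler_wpM2l.
by move=> t t0; rewrite mulr_ge0 ?expR_ge0// exprn_ge0// ltW.
Qed.

Lemma gamma_pdfE (e : nat) (b t : R) : 0 < b -> 0 < t ->
  gamma_pdf e.+1%:R b t = (GammaR e.+1%:R)^-1 * b^-1 ^+ e.+1 * (t ^+ e * expR (- b^-1 * t)).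
Proof.
move=> b0 t0; rewrite /gamma_pdf t0 -[X in X - 1]natr1 addrK !powR_mulrn ?ltW//.
rewrite (_ : - t / b = - b^-1 * t); last by rewrite !mulNr mulrC.
by rewrite invfM exprVn mulrC.
Qed.

Lemma gamma_pdf_le0 (a b t : R) : t <= 0 -> gamma_pdf a b t = 0.
Proof. by move=> t0; rewrite /gamma_pdf ltNge t0. Qed.

(** The shape e + 1 is an integer at least 1, so the density has no singularity at 0. *)
Lemma loc_bounded_gamma_pdf (e : nat) (b : R) : 0 < b -> loc_bounded_pos (gamma_pdf e.+1%:R b).
Proof.
move=> b0; have [mw wb w0] := loc_bounded_exp_weight e (- b^-1).
pose c := (GammaR e.+1%:R)^-1 * b^-1 ^+ e.+1.
have c0 : 0 <= c.
  by rewrite mulr_ge0 ?exprn_ge0 ?invr_ge0 ?(ltW b0)// GammaR_nat.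
split.
- rewrite (_ : gamma_pdf _ _ = fun t => c * (t ^+ e * expR (- b^-1 * t)) * \1_(`]0, +oo[%classic) t).
    apply: measurable_funM; first exact: measurable_funM.
    by apply: measurable_indic; exact: measurable_itv.
  apply/funext => t; rewrite indicE mem_setE in_itv/= andbT.
  have [t0|t0] := ltP 0 t; first by rewrite gamma_pdfE// mulr1.
  by rewrite gamma_pdf_le0// mulr0.
- move=> X; have [A hA] := wb X; exists (c * A) => t t0 tX.
  by rewrite gamma_pdfE// normrM (ger0_norm c0) ler_wpM2l// hA.
by move=> t t0; rewrite gamma_pdfE// -/c mulr_ge0// w0.
Qed.
End GammaDensity.

(** * Matching of the constants and passage to the limit *)

Unset Implicit Arguments.

(** The multiple series is read as the limit over growing cubes of indices. The Meijer identity
    holds for every contour to the right of all the poles of the numerator. *)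
Theorem theorem2 (R : realType) (K m : nat) (hK : (1 <= K)%N) (hm : (1 <= m)%N)
  (sigma2 Pw lam : 'I_K -> R) (N0 : R)
  (hsigma : forall k, 0 < sigma2 k) (hPw : forall k, 0 < Pw k)
  (hlam : forall k, 0 <= lam k < 1) (hN0 : 0 < N0)
  (l : 'I_K -> nat)
  (d : measure_display) (T : measurableType d) (P : probability T R)
  (X : 'I_K -> {RV P >-> R})
  (hind : mutually_independent P (fun k => (X k : T -> R)))
  (hlaw : forall k, has_density P (X k)
            (gamma_pdf (m + l k)%:R (Omega m Pw sigma2 lam N0 k)))
  (x : R) (hx : 0 < x) :
  let gam := snr Pw N0 in
  let dA := (m * K + \sum_(k < K) l k)%N in
  (fun N : nat =>
     gam ^- dA *
     \prod_(k < K) ((GammaR (m + l k)%:R)^-1 *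
        (m%:R / (theta Pw k * sigma2 k * (1 - lam k ^+ 2))) ^+ (m + l k)) *
     \sum_(n : {ffun 'I_K -> 'I_N.+1})
        (\prod_(k < K) (((n k)`!)%:R^-1 *
            (- (m%:R / (gam * theta Pw k * sigma2 k * (1 - lam k ^+ 2)))) ^+ n k) *
         g_fun m (fun k => (n k + l k)%N) x))
    @ \oo --> cdf_of P (fun w => \prod_(k < K) (1 + X k w)) x
  /\
  (forall c : R, (forall k, (m + l k)%:R < c) ->
     Complex (g_fun m l x) 0 =
     Complex (\prod_(k < K) GammaR (m + l k)%:R) 0 *
     meijerG 0 K.+1
       (1 :: [seq (1 + (l k + m)%:R) | k <- enum 'I_K])
       (nseq K 1 ++ [:: 0]) c x).
Proof.
move=> gam dA; split; last by move=> c; exact: g_fun_meijerG.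
(* The subtraction is exact because m >= 1, so the exponent [e k] corresponds to the shape e k +
   1. *)
pose e k := (m + l k - 1)%N.
have eS k : (m + l k)%N = (e k).+1 by rewrite /e subn1 prednK// addn_gt0 hm.
pose Om := Omega m Pw sigma2 lam N0.
have lam1 k : 0 < 1 - lam k ^+ 2.
  have /andP[l0 l1] := hlam k; rewrite subr_gt0 expr2.
  by rewrite (le_lt_trans _ l1)// ler_piMr// ltW.
have m0 : 0 < m%:R :> R by rewrite ltr0n.
have Om0 k : 0 < Om k.
  by rewrite /Om /Omega divr_gt0 ?mulr_gt0 ?hPw ?hsigma ?lam1.
have S0 : 0 < \sum_(k < K) Pw k.
  rewrite (bigD1 (Ordinal hK))//= ltr_wpDr ?hPw//.
  by apply: sumr_ge0 => k _; rewrite ltW ?hPw.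
have gam0 : 0 < gam by rewrite divr_gt0.
have OmE k : m%:R / (gam * theta Pw k * sigma2 k * (1 - lam k ^+ 2)) = (Om k)^-1.
  rewrite /Om /Omega /gam /snr /theta; move: (lam1 k) (hsigma k) (hPw k).
  move: (1 - _) (sigma2 k) (Pw k) (\sum_(k < K) _) S0 => u s p S S0 u0 s0 p0.
  by field; rewrite !gt_eqF.
have OmE' k : m%:R / (theta Pw k * sigma2 k * (1 - lam k ^+ 2)) = gam * (Om k)^-1.
  have alg (g th s u v : R) : g != 0 -> v / (th * s * u) = g * (v / (g * th * s * u)).
    move=> g0; transitivity (g * (v / (g * (th * s * u)))); last by rewrite !mulrA.
    by rewrite [in RHS]invfM (mulrCA v) (mulVKf g0).
  by rewrite -OmE; apply: alg; rewrite gt_eqF.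
pose C k := (GammaR (e k).+1%:R)^-1 * (Om k)^-1 ^+ (e k).+1.
(* The powers of [gam] produced by [OmE'] have total exponent equal to the sum of the m + l_k, that
   is [dA], and cancel the prefactor. *)
have constE : gam ^- dA * \prod_(k < K) ((GammaR (m + l k)%:R)^-1 *
    (m%:R / (theta Pw k * sigma2 k * (1 - lam k ^+ 2))) ^+ (m + l k)) = \prod_(k < K) C k.
  under eq_bigr do rewrite OmE' exprMn mulrCA eS.
  rewrite big_split/= prodrXr mulrA -[RHS]mul1r; congr (_ * _).
  rewrite (_ : (\sum_(k < K) (e k).+1)%N = dA) ?mulVf// ?expf_neq0 ?gt_eqF//.
  under eq_bigr do rewrite -eS.
  by rewrite big_split/= sum_nat_const card_ord mulnC.
have [rho [rhoJ rhoP]] := prod_law (m1 := fun k => distribution P (X k))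
  (fun k => loc_bounded_gamma_pdf (e k) (Om0 k))
  (fun k t t0 => gamma_pdf_le0 _ _ t0)
  (fun k B mB => eq_rect _ (fun a => P (X k @^-1` B) = \int[lebesgue_measure]_(r in B) (gamma_pdf a%:R (Om k) r)%:E)%E (hlaw k B mB) _ (eS k)).
have mX k : measurable_fun setT (X k : T -> R) by exact: measurable_funP.
(* Independence in the form required by [prod_law], with the whole space as conditioning event. *)
have indT (B : 'I_K -> set R) : (forall k, measurable (B k)) ->
    P (setT `&` \bigcap_(k in [set: 'I_K]) (X k @^-1` B k)) =
    (P setT * \prod_(k < K) distribution P (X k) (B k))%E.
  by move=> mB; rewrite setTI probability_setT mul1e; exact: hind.
have mx : measurable [set v : R | v <= x].
  by rewrite (_ : [set v | _] = `]-oo, x]%classic)//; apply/seteqP; split => v /=; rewrite in_itv.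
have cdfE : cdf_of P (fun w => \prod_(k < K) (1 + X k w)) x =
    \prod_(k < K) C k * Jint [seq (fun t => t ^+ e k * expR (- (Om k)^-1 * t)) | k <- enum 'I_K] x.
  rewrite -(Jint_scale (f := fun k => gamma_pdf (e k).+1%:R (Om k)) _ _ hx); last 2 first.
  - by move=> k; exact: loc_bounded_exp_weight.
  - by move=> k t t0; exact: gamma_pdfE.
  have := rhoP _ _ P X setT measurableT mX indT _ mx.
  by rewrite setTI probability_setT mul1e rhoJ// /cdf_of => ->.
rewrite cdfE (_ : (fun N : nat => _) = (fun N => \prod_(k < K) C k * partial_expansion e (fun k => - (Om k)^-1) N x)).
  by apply: cvgM; [exact: cvg_cst|exact: partial_expansion_cvg].
(* It remains to match exponents, m + (n_k + l_k) - 1 = e_k + n_k, and the expansion variable -1 /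
   Omega_k. *)
apply/funext => N; rewrite constE; congr (_ * _); apply: eq_bigr => n _.
rewrite g_funE//; congr (_ * Gint _ x).
  by apply: eq_bigr => k _; rewrite OmE.
by apply: eq_map => k; rewrite /e addnCA addnC addnBAC// addn_gt0 hm.
Qed.
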